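(* Let $n\ge1$. There exist $\Lambda>0$ and $C>0$ such that the following holds with the constants $\varepsilon=\varepsilon(\Lambda)$, $c_i=c_i(\Lambda)$, $i=0,\dots,3$, described in the context. Let $R>0$, let $X\subseteq\mathbb{R}^{n+1}$ be $(\varepsilon,R)$-Reifenberg flat, let $0<s\le r$, let $(Y^r_t)$ be an $r$-approximate evolution of $X$ and let $(Z^s_t)$ be an $s$-approximate evolution of $X$ (both with respect to $\Lambda$). Then for every $t\in[c_3r^2,c_0R^2]$ $$d_H(Y^r_t,Z^s_t)\le C\,r^{1/2}t^{1/4}.$$
   Context: $d_H$ is the Hausdorff distance and $B(x,r)$ is a Euclidean ball in $\mathbb{R}^{n+1}$. Reifenberg flat sets: a compact, connected set $X\subseteq\mathbb{R}^{n+1}$ is $(\varepsilon,R)$-Reifenberg flat if for every $x\in X$ and $0<r<R$ there is a hyperplane $P$ with $d_H(B(x,r)\cap P,\,B(x,r)\cap X)\le\varepsilon r$. Approximating family: by a known theorem there are fixed constants $a_1,a_2,\varepsilon_0>0$ such that every $(\varepsilon,R)$-Reifenberg flat $X$ with $0<\varepsilon<\varepsilon_0$ admits a family $(X^r)_{0<r<R/4}$ of smooth compact embedded hypersurfaces with (i) $d_H(X^r,X)\le a_1\varepsilon r$; (ii) second fundamental form bounded by $|A|\le a_2\varepsilon/r$; (iii) for every $x\in X$ and $s\in(r,R/4)$, $B(x,s)\cap X^r=G\cup B$ with $G$ connected and $B\cap B(x,(1-20\varepsilon)s)=\emptyset$. Constants: for every $\Lambda>0$ there exist (and we fix) $\varepsilon(\Lambda),c_0(\Lambda),\dots,c_3(\Lambda)>0$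 with $c_1c_2<\min\{10^{-6},\Lambda^{-1}\}$ and $c_1^2<\frac1{80}$ such that for every $(\varepsilon(\Lambda),R)$-Reifenberg flat $X$ and every approximating family $(X^r)$ of $X$, each $X^r$ flows smoothly by mean curvature for $t\in[0,c_0R^2]$ and the flow satisfies (E1)–(E3) below (with $Y_t=X^r_t$) for every $t\in[c_3r^2,c_0R^2]$: (E1) the second fundamental form of $Y_t$ satisfies $|A(t)|\le c_1/\sqrt t$; (E2) $d_H(Y_t,X)\le c_2\sqrt t$; (E3) for every $x\in X$ and $s\in(\sqrt t/c_1,R/4)$, $B(x,s)\cap Y_t=G\cup B$ with $G$ connected and $B\cap B(x,\frac9{10}s)=\emptyset$. $r$-approximate evolution (with respect to $\Lambda$): a smooth mean curvature flow $(Y_t)_{t\in(0,c_0R^2]}$ of compact embedded hypersurfaces in $\mathbb{R}^{n+1}$ satisfying (E1)–(E3) for every $t\in[c_3r^2,c_0R^2]$. *)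

(* Defs.v *)
From HB Require Import structures.
From mathcomp Require Import all_boot all_order all_algebra.
From mathcomp Require Import all_classical all_reals all_analysis.

Set Implicit Arguments.
Unset Strict Implicit.
Unset Printing Implicit Defensive.

Import Order.TTheory GRing.Theory Num.Theory.
Import numFieldNormedType.Exports.

Local Open Scope classical_set_scope.
Local Open Scope ring_scope.

(* The library's norm and [ball] on ['rV[R]_n.+1] are those of the sup norm:
   they give the usual topology, hence the library's [open], [compact],
   [connected] and directional derivatives, but every metric quantity below
   uses the Euclidean norm [enorm]. *)
Definition dot (R : realType) (n : nat) (u v : 'rV[R]_n.+1) : R :=
  \sum_(i < n.+1) u 0 i * v 0 i.

Definition enorm (R : realType) (n : nat) (u : 'rV[R]_n.+1) : R :=
  Num.sqrt (dot u u).

Definition eball (R : realType) (n : nat) (x : 'rV[R]_n.+1) (r : R) :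
    set 'rV[R]_n.+1 :=
  [set y | enorm (y - x) < r].

Definition thickening (R : realType) (n : nat) (A : set 'rV[R]_n.+1) (d : R) :
    set 'rV[R]_n.+1 :=
  [set x | exists2 a, A a & enorm (x - a) <= d].

(* The value is [+oo] when exactly one of the two sets is empty. *)
Definition dH (R : realType) (n : nat) (A B : set 'rV[R]_n.+1) : \bar R :=
  ereal_inf [set d%:E | d in
    [set d : R | 0 <= d /\ A `<=` thickening B d /\ B `<=` thickening A d]].

Definition hyperplane (R : realType) (n : nat) (P : set 'rV[R]_n.+1) : Prop :=
  exists nu : 'rV[R]_n.+1, exists c : R,
    nu != 0 /\ P = [set y | dot nu y = c].

Definition reifenberg_flat (R : realType) (n : nat) (eps rad : R)
    (X : set 'rV[R]_n.+1) : Prop :=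
  [/\ compact X, connected X &
    forall (x : 'rV[R]_n.+1) (r : R), X x -> 0 < r -> r < rad ->
      exists2 P, hyperplane P &
        (dH (eball x r `&` P) (eball x r `&` X) <= (eps * r)%:E)%E].

(* C^k on an open set of a finite-dimensional space: all iterated directional
   derivatives up to order k exist and are continuous. *)
Fixpoint Ck_on (R : realType) (V W : normedModType R) (k : nat) (U : set V)
    (f : V -> W) : Prop :=
  (forall x, U x -> {for x, continuous f}) /\
  match k with
  | 0 => True
  | k'.+1 => forall v : V,
      (forall x, U x -> derivable f x v) /\ Ck_on k' U (fun x => 'D_v f x)
  end.

Definition smooth_on (R : realType) (V W : normedModType R) (U : set V)
    (f : V -> W) : Prop :=
  forall k, Ck_on k U f.

(* Embedded n-dimensional hypersurface of R^(n+1), without boundary: locally a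
   regular level set. *)
Definition hypersurface (R : realType) (n : nat) (M : set 'rV[R]_n.+1) : Prop :=
  forall p, M p -> exists (U : set 'rV[R]_n.+1) (u : 'rV[R]_n.+1 -> R),
    [/\ open U, U p, smooth_on U u,
        forall q, U q -> exists v, 'D_v u q != 0 &
        forall q, U q -> (M q <-> u q = 0)].

Definition compact_hypersurface (R : realType) (n : nat)
    (M : set 'rV[R]_n.+1) : Prop :=
  compact M /\ hypersurface M.

(* v is the velocity at p of a smooth curve lying in M. *)
Definition tangent (R : realType) (n : nat) (M : set 'rV[R]_n.+1)
    (p v : 'rV[R]_n.+1) : Prop :=
  exists (e : R) (g : R -> 'rV[R]_n.+1),
    [/\ 0 < e, smooth_on (ball (0 : R) e) g,
        forall t, ball (0 : R) e t -> M (g t),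
        g 0 = p & derive1 g 0 = v].

(* nu restricted to M is a unit normal field near p; it is smooth on a full
   neighbourhood of p, which allows one to differentiate it. *)
Definition unit_normal_near (R : realType) (n : nat) (M : set 'rV[R]_n.+1)
    (p : 'rV[R]_n.+1) (nu : 'rV[R]_n.+1 -> 'rV[R]_n.+1) : Prop :=
  exists U : set 'rV[R]_n.+1,
    [/\ open U, U p, smooth_on U nu &
        forall q, U q -> M q ->
          enorm (nu q) = 1 /\ forall v, tangent M q v -> dot (nu q) v = 0].

Definition tproj (R : realType) (n : nat) (nu v : 'rV[R]_n.+1) : 'rV[R]_n.+1 :=
  v - dot nu v *: nu.

(* Second fundamental form A(v, w) = <D_v nu, w>, extended from the tangent
   space to R^(n+1) by zero on the normal line.  Only tangential derivatives of
   nu enter, so the extension of nu off M is irrelevant.  Thanks to the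
   extension by zero, the Hilbert-Schmidt norm and the trace over the tangent
   space may be computed in the standard basis of R^(n+1). *)
Definition sff (R : realType) (n : nat) (nu : 'rV[R]_n.+1 -> 'rV[R]_n.+1)
    (p v w : 'rV[R]_n.+1) : R :=
  dot ('D_(tproj (nu p) v) nu p) (tproj (nu p) w).

Definition sff_norm (R : realType) (n : nat)
    (nu : 'rV[R]_n.+1 -> 'rV[R]_n.+1) (p : 'rV[R]_n.+1) : R :=
  Num.sqrt (\sum_(i < n.+1) \sum_(j < n.+1)
    sff nu p (delta_mx 0 i) (delta_mx 0 j) ^+ 2).

(* On the unit sphere with outer normal nu this is - n *: nu: the vector points
   inwards.  It is invariant under nu |-> - nu. *)
Definition mean_curvature_vector (R : realType) (n : nat)
    (nu : 'rV[R]_n.+1 -> 'rV[R]_n.+1) (p : 'rV[R]_n.+1) : 'rV[R]_n.+1 :=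
  - (\sum_(i < n.+1) sff nu p (delta_mx 0 i) (delta_mx 0 i)) *: nu p.

(* |A| <= k on M; the norm does not depend on the local unit normal. *)
Definition sff_le (R : realType) (n : nat) (M : set 'rV[R]_n.+1) (k : R) :
    Prop :=
  forall p nu, M p -> unit_normal_near M p nu -> sff_norm nu p <= k.

(* Smooth mean curvature flow (Y_t) of compact embedded hypersurfaces over the
   time interval I: Y_t = F_t(M) with F smooth on I x M, each F_t an embedding
   (injective immersion of a compact hypersurface) and dF/dt the mean curvature
   vector.  The parameter manifold is diffeomorphic to each Y_t, so it may be
   taken to be a hypersurface of R^(n+1).  Smoothness on I x M, including at
   the end points of I, means that F is smooth on an open neighbourhood. *)
Definition smooth_mcf (R : realType) (n : nat) (I : set R)
    (Y : R -> set 'rV[R]_n.+1) : Prop :=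
  (forall t, I t -> compact_hypersurface (Y t)) /\
  exists (M : set 'rV[R]_n.+1) (F : R -> 'rV[R]_n.+1 -> 'rV[R]_n.+1)
         (W : set (R * 'rV[R]_n.+1)),
    [/\ compact_hypersurface M, open W, I `*` M `<=` W,
        smooth_on W (fun z : R * 'rV[R]_n.+1 => F z.1 z.2) &
        forall t, I t ->
          [/\ Y t = F t @` M,
              forall p q, M p -> M q -> F t p = F t q -> p = q,
              forall p v, M p -> tangent M p v -> v != 0 -> 'D_v (F t) p != 0 &
              forall p nu, M p -> unit_normal_near (Y t) (F t p) nu ->
                derive1 (F ^~ p) t = mean_curvature_vector nu (F t p)]].

(* B(x, s) `&` Y = G `|` B with G connected and B disjoint from B(x, th s). *)
Definition connected_up_to (R : realType) (n : nat) (Y : set 'rV[R]_n.+1)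
    (x : 'rV[R]_n.+1) (s th : R) : Prop :=
  exists G B : set 'rV[R]_n.+1,
    [/\ eball x s `&` Y = G `|` B, connected G &
        B `&` eball x (th * s) = set0].

(* [Xr r] stands for X^r, 0 < r < rad / 4. *)
Definition approximating_family (R : realType) (n : nat) (a1 a2 eps rad : R)
    (X : set 'rV[R]_n.+1) (Xr : R -> set 'rV[R]_n.+1) : Prop :=
  forall r, 0 < r -> r < rad / 4 ->
    [/\ compact_hypersurface (Xr r),
        (dH (Xr r) X <= (a1 * eps * r)%:E)%E,
        sff_le (Xr r) (a2 * eps / r) &
        forall x s, X x -> r < s -> s < rad / 4 ->
          connected_up_to (Xr r) x s (1 - 20 * eps)].

Definition approximation_constants (R : realType) (n : nat)
    (a1 a2 eps0 : R) : Prop :=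
  [/\ 0 < a1, 0 < a2, 0 < eps0 &
    forall (eps rad : R) (X : set 'rV[R]_n.+1),
      0 < eps -> eps < eps0 -> 0 < rad -> reifenberg_flat eps rad X ->
      exists Xr, approximating_family a1 a2 eps rad X Xr].

Record constants (R : realType) := Constants {
  ceps : R; c0 : R; c1 : R; c2 : R; c3 : R }.

Definition estimates (R : realType) (n : nat) (k : constants R) (rad : R)
    (X : set 'rV[R]_n.+1) (t : R) (Yt : set 'rV[R]_n.+1) : Prop :=
  [/\ sff_le Yt (c1 k / Num.sqrt t),
      (dH Yt X <= (c2 k * Num.sqrt t)%:E)%E &
      forall x s, X x -> Num.sqrt t / c1 k < s -> s < rad / 4 ->
        connected_up_to Yt x s (9 / 10)].

Definition flow_constants (R : realType) (n : nat) (a1 a2 Lam : R)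
    (k : constants R) : Prop :=
  [/\ [/\ 0 < ceps k, 0 < c0 k, 0 < c1 k, 0 < c2 k & 0 < c3 k],
      c1 k * c2 k < Num.min (10 ^- 6) Lam^-1,
      c1 k ^+ 2 < 80^-1 &
      forall (rad : R) (X : set 'rV[R]_n.+1) (Xr : R -> set 'rV[R]_n.+1),
        0 < rad -> reifenberg_flat (ceps k) rad X ->
        approximating_family a1 a2 (ceps k) rad X Xr ->
        forall r, 0 < r -> r < rad / 4 ->
          exists Y : R -> set 'rV[R]_n.+1,
            [/\ Y 0 = Xr r, smooth_mcf `[0, c0 k * rad ^+ 2] Y &
                forall t, c3 k * r ^+ 2 <= t -> t <= c0 k * rad ^+ 2 ->
                  estimates k rad X t (Y t)]].

Definition approximate_evolution (R : realType) (n : nat) (k : constants R)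
    (rad r : R) (X : set 'rV[R]_n.+1) (Y : R -> set 'rV[R]_n.+1) : Prop :=
  smooth_mcf `]0, c0 k * rad ^+ 2] Y /\
  forall t, c3 k * r ^+ 2 <= t -> t <= c0 k * rad ^+ 2 ->
    estimates k rad X t (Y t).

(* Main.v *)
(* Call (y, z) with y in Y_t, z in Z_t a normal pair if y - z is normal to Z_t,
   and put kappa = c1 / sqrt t.  If |A| <= kappa on Z_t and kappa |y - z| <= 1/20,
   then z is the strict minimum of |. - y| on every connected subset of Z_t
   containing z and lying within 1.1 / kappa of y; this is proved by raising the
   level of |. - y|, which is convex in graph charts where
   kappa |<nu, . - y>| < 1.  By (E2) and (E3) there is then no normal pair with
   3 c2 sqrt t < |y - z| <= 1 / (20 kappa) while sqrt t < c1 rad / 4.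

   At a normal pair which locally maximises or minimises |y - z| among normal
   pairs, comparing mean curvatures along Z_t gives
   |d/dt |y - z|^2| <= 8 kappa^2 |y - z|^2 in the relevant direction, and
   8 c1^2 < 1/2.  So normal pairs cannot cross the lower barrier
   A sqrt t from below, with A = 16 c2^2 sqrt t1 and t1 = c3 r^2, nor the upper
   barrier C / sqrt t from above, and the window between the barriers
   stays free.  The upper barrier is needed only for t >= (c1 rad / 8)^2, where
   (E3) is not available any more.  A point of Y_t starting within
   the lower barrier at t1, by (E2), thus stays within it, and
   sqrt (A sqrt t) is a multiple of r^(1/2) t^(1/4).  If r is comparable to rad,
   (E2) is enough. *)

Require Import Defs.
From HB Require Import structures.
From mathcomp Require Import all_boot all_order all_algebra.
From mathcomp Require Import all_classical all_reals all_analysis.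
From mathcomp Require Import ring lra.

Set Implicit Arguments.
Unset Strict Implicit.
Unset Printing Implicit Defensive.

Import Order.TTheory GRing.Theory Num.Theory.
Import numFieldNormedType.Exports.

Local Open Scope classical_set_scope.
Local Open Scope ring_scope.

(** * Euclidean vectors and curves *)

Section Euclid.
Variables (R : realType) (n : nat).
Local Notation V := 'rV[R]_n.+1.
Implicit Types (u v w x y z : V) (a : R).

(** It is enough to keep a window of distances free of normal pairs.

    That argument looks backwards in time. A normal pair in the window is a strict minimum on its
    sheet, so minimising over nearby points of [Z] at slightly earlier times gives a normal pair
    with the same point of [Y]. Hence a pair strictly inside the window never occurs at the first
    occupied time: the pair found there lies on a barrier, and no normal pair at that time lies
    strictly inside, which makes it locally extremal. Extremality is what the maximum principle
    consumes: it forces the normals of [Y] and [Z] to be parallel and orders the curvature of [Y]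
    against that of the parallel surface of [Z]. The slope of the barrier then puts a normal pair
    into the window at an earlier time, a contradiction.

    Normality is imposed at [Z_t] only, so that pairs with a given point of [Y] come from a
    minimisation in one variable. The other inclusion exchanges the flows. *)

Lemma dotC u v : dot u v = dot v u.
Proof. by apply: eq_bigr => i _; rewrite mulrC. Qed.

Lemma dotDl u v w : dot (u + v) w = dot u w + dot v w.
Proof. by rewrite -big_split; apply: eq_bigr => i _; rewrite mxE mulrDl. Qed.

Lemma dotZl a u v : dot (a *: u) v = a * dot u v.
Proof. by rewrite mulr_sumr; apply: eq_bigr => i _; rewrite mxE mulrA. Qed.

Lemma dotNl u v : dot (- u) v = - dot u v.
Proof. by rewrite -scaleN1r dotZl mulN1r. Qed.

Lemma dotBl u v w : dot (u - v) w = dot u w - dot v w.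
Proof. by rewrite dotDl dotNl. Qed.

Lemma dotDr u v w : dot u (v + w) = dot u v + dot u w.
Proof. by rewrite dotC dotDl !(dotC _ u). Qed.

Lemma dotZr a u v : dot u (a *: v) = a * dot u v.
Proof. by rewrite dotC dotZl (dotC v). Qed.

Lemma dotNr u v : dot u (- v) = - dot u v.
Proof. by rewrite dotC dotNl (dotC v). Qed.

Lemma dotBr u v w : dot u (v - w) = dot u v - dot u w.
Proof. by rewrite dotDr dotNr. Qed.

Lemma dot0l u : dot 0 u = 0.
Proof. by rewrite -(scale0r (0 : V)) dotZl mul0r. Qed.

Lemma dot0r u : dot u 0 = 0.
Proof. by rewrite dotC dot0l. Qed.

Definition dotE := (dotDl, dotDr, dotNl, dotNr, dotZl, dotZr).

Lemma dot_sumr I (r : seq I) (F : I -> V) u :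
  dot u (\sum_(i <- r) F i) = \sum_(i <- r) dot u (F i).
Proof. by elim/big_rec2: _ => [|i x y _ <-]; rewrite ?dot0r// dotDr. Qed.

Lemma dot_delta u i : dot u (delta_mx 0 i) = u 0 i.
Proof.
rewrite /dot (bigD1 i)//= mxE !eqxx mulr1 big1 ?addr0// => j ji.
by rewrite mxE (negbTE ji) andbF mulr0.
Qed.

Lemma dotvv_ge0 u : 0 <= dot u u.
Proof. by apply: sumr_ge0 => i _; rewrite -expr2 sqr_ge0. Qed.

Lemma dotvv_eq0 u : (dot u u == 0) = (u == 0).
Proof.
apply/eqP/eqP => [|->]; last by rewrite dot0l.
move=> /psumr_eq0P u0; apply/rowP => i; rewrite mxE.
apply/eqP; rewrite -sqrf_eq0 expr2 u0// => j _.
by rewrite -expr2 sqr_ge0.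
Qed.

Lemma dotvv_gt0 u : (0 < dot u u) = (u != 0).
Proof. by rewrite lt_def dotvv_eq0 dotvv_ge0 andbT. Qed.

Lemma sqr_enorm u : enorm u ^+ 2 = dot u u.
Proof. by rewrite sqr_sqrtr// dotvv_ge0. Qed.

Lemma enorm_ge0 u : 0 <= enorm u.
Proof. exact: sqrtr_ge0. Qed.

Lemma enorm_eq0 u : (enorm u == 0) = (u == 0).
Proof. by rewrite -sqrf_eq0 sqr_enorm dotvv_eq0. Qed.

Lemma enorm_gt0 u : (0 < enorm u) = (u != 0).
Proof. by rewrite lt_def enorm_eq0 enorm_ge0 andbT. Qed.

Lemma enorm0 : enorm (0 : V) = 0.
Proof. by apply/eqP; rewrite enorm_eq0. Qed.

Lemma enormZ a u : enorm (a *: u) = `|a| * enorm u.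
Proof. by rewrite /enorm dotZl dotZr mulrA -expr2 sqrtrM ?sqr_ge0// sqrtr_sqr. Qed.

Lemma enormN u : enorm (- u) = enorm u.
Proof. by rewrite -scaleN1r enormZ normrN normr1 mul1r. Qed.

Lemma enormB u v : enorm (u - v) = enorm (v - u).
Proof. by rewrite -enormN opprB. Qed.

Lemma dot_sqr_le u v : dot u v ^+ 2 <= dot u u * dot v v.
Proof.
have [->|v0] := eqVneq v 0; first by rewrite !dot0r expr0n mulr0.
have vv : 0 < dot v v by rewrite dotvv_gt0.
have := dotvv_ge0 (u - (dot u v / dot v v) *: v).
rewrite !dotE (dotC v u).
set c := dot u v; set d := dot v v in vv *; set e := dot u u.
have -> : e - c / d * c + (- (c / d * c) - c / d * - (c / d * d)) =
          (e * d - c ^+ 2) / d by field; rewrite gt_eqF.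
by rewrite pmulr_lge0 ?invr_gt0// subr_ge0.
Qed.

Lemma dot_le u v : `|dot u v| <= enorm u * enorm v.
Proof.
rewrite -(@ler_pXn2r _ 2) ?nnegrE ?mulr_ge0 ?enorm_ge0//.
by rewrite real_normK ?num_real// exprMn !sqr_enorm dot_sqr_le.
Qed.

Lemma enormD u v : enorm (u + v) <= enorm u + enorm v.
Proof.
rewrite -(@ler_pXn2r _ 2) ?nnegrE ?addr_ge0 ?enorm_ge0//.
rewrite sqr_enorm !dotE (dotC v u) sqrrD !sqr_enorm.
have := dot_le u v; move: (ler_norm (dot u v)); lra.
Qed.

Lemma enormDB u v w : enorm (u - w) <= enorm (u - v) + enorm (v - w).
Proof. by rewrite (le_trans _ (enormD _ _))// subrKA. Qed.

Lemma coord_le u i : `|u 0 i| <= `|u|.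
Proof.
have := le_bigmax (0 : R) (fun ij : 'I_1 * 'I_n.+1 => `|u ij.1 ij.2|) (0, i).
by rewrite /Num.Def.normr /= mx_normrE.
Qed.

Lemma norm_le_enorm u : `|u| <= enorm u.
Proof.
rewrite [leLHS]/Num.Def.normr /= mx_normrE; apply: bigmax_le; first exact: enorm_ge0.
move=> [i j] _ /=; rewrite ord1.
rewrite -(@ler_pXn2r _ 2) ?nnegrE ?enorm_ge0// sqr_enorm real_normK ?num_real//.
rewrite /dot (bigD1 j)//= -expr2 lerDl; apply: sumr_ge0 => k _.
by rewrite -expr2 sqr_ge0.
Qed.

Lemma enorm_le_norm u : enorm u <= n.+1%:R * `|u|.
Proof.
rewrite -(@ler_pXn2r _ 2) ?nnegrE ?enorm_ge0 ?mulr_ge0// sqr_enorm.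
rewrite (@le_trans _ _ (n.+1%:R * `|u| ^+ 2))//.
  rewrite /dot (le_trans (y := \sum_(i < n.+1) `|u| ^+ 2))//.
    apply: ler_sum => i _; rewrite -expr2 -real_normK ?num_real//.
    by rewrite lerXn2r ?nnegrE// coord_le.
  by rewrite sumr_const card_ord mulr_natl.
rewrite exprMn ler_wpM2r ?sqr_ge0// expr2 ler_peMr//.
by rewrite (_ : 1 = 1%:R)// ler_nat.
Qed.

Lemma rV_sum_delta u : u = \sum_(i < n.+1) u 0 i *: (delta_mx 0 i : V).
Proof. exact: row_sum_delta. Qed.

End Euclid.

(** * Euclidean balls and continuity *)

Section EuclidTopology.
Variables (R : realType) (n : nat).
Local Notation V := 'rV[R]_n.+1.

Lemma near_gt (T : topologicalType) (f : T -> R) (t : T) (a : R) :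
  {for t, continuous f} -> a < f t -> \forall s \near t, a < f s.
Proof. by move=> cf h; apply: (cf _ (open_nbhs_nbhs (conj (@open_gt R a) h))). Qed.

Lemma near_lt (T : topologicalType) (f : T -> R) (t : T) (a : R) :
  {for t, continuous f} -> f t < a -> \forall s \near t, f s < a.
Proof. by move=> cf h; apply: (cf _ (open_nbhs_nbhs (conj (@open_lt R a) h))). Qed.

Lemma near_ltC (T : topologicalType) (f g : T -> R) (t : T) :
  {for t, continuous f} -> {for t, continuous g} -> f t < g t ->
  \forall s \near t, f s < g s.
Proof.
move=> cf cg fg; have c : {for t, continuous (fun s => g s - f s)} by exact: continuousB.
have h : 0 < g t - f t by rewrite subr_gt0.
by apply: filterS (near_gt c h) => s; rewrite subr_gt0.
Qed.

Lemma continuous_sumR (T : topologicalType) I (r : seq I) (F : I -> T -> R) (t : T) :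
  (forall i, {for t, continuous (F i)}) ->
  {for t, continuous (fun s => \sum_(i <- r) F i s)}.
Proof.
move=> cF; apply: (@cvg_big _ _ (fun x y : R => x + y)) => [|i _]; last exact: cF.
by move=> z; apply: (@cvgD _ _ _ _ _ fst snd); [exact: cvg_fst|exact: cvg_snd].
Qed.

Lemma dot_continuous (T : topologicalType) (f g : T -> V) (t : T) :
  {for t, continuous f} -> {for t, continuous g} ->
  {for t, continuous (fun s => dot (f s) (g s))}.
Proof.
move=> cf cg; apply: continuous_sumR => i.
apply: cvgM.
  by apply: (@continuous_comp _ _ _ f (fun M : V => M 0 i)) => //; exact: coord_continuous.
by apply: (@continuous_comp _ _ _ g (fun M : V => M 0 i)) => //; exact: coord_continuous.
Qed.

Lemma enorm_continuous (T : topologicalType) (f : T -> V) (t : T) :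
  {for t, continuous f} -> {for t, continuous (fun s => enorm (f s))}.
Proof.
move=> cf; apply: (@continuous_comp _ _ _ (fun s => dot (f s) (f s)) Num.sqrt).
  exact: dot_continuous.
exact: sqrt_continuous.
Qed.

(** Bridge between the sup norm, which carries the topology, and [enorm], which carries the metric
    estimates; the two are comparable up to the factor [n.+1]. *)
Lemma nbhs_enormP (x : V) (A : set V) :
  nbhs x A <-> exists2 d : R, 0 < d & forall y, enorm (y - x) < d -> A y.
Proof.
split=> [/nbhs_ballP[d /= d0 dA]|[d d0 dA]].
  exists d => // y yx; apply: dA; rewrite -ball_normE /ball_/= distrC.
  exact: le_lt_trans (norm_le_enorm _) yx.
apply/nbhs_ballP; exists (d / n.+1%:R) => /=; first by rewrite divr_gt0.
move=> y; rewrite -ball_normE /ball_/= distrC => yx; apply: dA.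
apply: le_lt_trans (enorm_le_norm _) _.
by rewrite mulrC -ltr_pdivlMr.
Qed.

Lemma near_enorm (x : V) (d : R) : 0 < d -> \forall y \near x, enorm (y - x) < d.
Proof. by move=> d0; apply/nbhs_enormP; exists d. Qed.

Lemma nbhs_enorm_lt (x z : V) (d : R) : enorm (x - z) < d ->
  nbhs x [set y | enorm (y - z) < d].
Proof.
move=> xd; apply/nbhs_enormP; exists (d - enorm (x - z)); first by rewrite subr_gt0.
by move=> y yx /=; have := enormDB y x z; lra.
Qed.

End EuclidTopology.

(** * Directional derivatives and the mean value theorem *)

Section Curves.
Variables (R : realType).

Lemma is_derive_comp (V W : normedModType R) (f : V -> W) (g : R -> V) s dg :
  is_derive s (1 : R) g dg -> differentiable f (g s) ->
  is_derive s (1 : R) (f \o g) ('D_dg f (g s)).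
Proof.
move=> [dg1 dgE] df.
have dgs : differentiable g s by apply/derivable1_diffP.
have dfg : differentiable (f \o g) s by exact: differentiable_comp.
apply: DeriveDef; first exact/derivable1_diffP.
by rewrite deriveE// diff_comp//= deriveE// -dgE deriveE.
Qed.

Lemma is_derive_line (V : normedModType R) (x v : V) (s : R) :
  is_derive s (1 : R) (fun h : R => x + h *: v) v.
Proof.
have h : is_derive s (1 : R) (fun h : R => h *: (1 *: v)) (1 *: (1 *: v)).
  have dz : differentiable (fun h : R => h *: (1 *: v)) s.
    by apply: differentiableZl.
  apply: DeriveDef; first exact/derivable1_diffP.
  by rewrite deriveE// (diffZl _) //= diff_val.
rewrite !scale1r in h *.
by rewrite -{2}(add0r v); apply: is_deriveD.
Qed.

Variable n : nat.
Local Notation V := 'rV[R]_n.+1.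

Lemma is_derive_coord (W : normedModType R) (f : W -> V) (t v : W) df :
  is_derive t v f df -> forall i, is_derive t v (fun s => f s 0 i) (df 0 i).
Proof.
move=> [fd <-] i; apply: DeriveDef; first by move/derivable_mxP: fd; exact.
by rewrite derive_mx// mxE.
Qed.

Lemma is_derive_dot (W : normedModType R) (f g : W -> V) (t v : W) df dg :
  is_derive t v f df -> is_derive t v g dg ->
  is_derive t v (fun s => dot (f s) (g s)) (dot df (g t) + dot (f t) dg).
Proof.
move=> hf hg; rewrite /dot -big_split/=.
have -> : (fun s => \sum_(i < n.+1) f s 0 i * g s 0 i) =
  \sum_(i < n.+1) ((fun s => f s 0 i) * (fun s => g s 0 i)).
  by apply/funext => s; rewrite fct_sumE.
apply: is_derive_sum => i.
apply: is_derive_eq; first exact: (is_deriveM (is_derive_coord hf i) (is_derive_coord hg i)).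
by rewrite /GRing.scale/= addrC; congr (_ + _); rewrite mulrC.
Qed.

Lemma differentiable_rV (W : normedModType R) (f : W -> V) (t : W) :
  (forall i, differentiable (fun s => f s 0 i) t) -> differentiable f t.
Proof.
move=> h.
have -> : f = \sum_(i < n.+1) (fun s => f s 0 i *: (delta_mx 0 i : V)).
  by apply/funext => s; rewrite fct_sumE [LHS]rV_sum_delta.
by apply: differentiable_sum => i; apply: differentiableZl.
Qed.

Lemma differentiable_coordr (W : normedModType R) (f : W -> V) (t : W) i :
  differentiable f t -> differentiable (fun s => f s 0 i) t.
Proof. by move=> h; exact: (differentiable_comp h (differentiable_coord _ _ _)). Qed.

Lemma differentiable_dot (W : normedModType R) (f g : W -> V) (t : W) :
  differentiable f t -> differentiable g t ->
  differentiable (fun s => dot (f s) (g s)) t.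
Proof.
move=> hf hg.
have -> : (fun s => dot (f s) (g s)) =
  \sum_(i < n.+1) ((fun s => f s 0 i) * (fun s => g s 0 i)).
  by apply/funext => s; rewrite fct_sumE.
by apply: differentiable_sum => i; apply: differentiableM; apply: differentiable_coordr.
Qed.

Lemma derive_dirZ (W U : normedModType R) (f : W -> U) x (a : R) v :
  differentiable f x -> 'D_(a *: v) f x = a *: 'D_v f x.
Proof. by move=> df; rewrite !deriveE// linearZ. Qed.

Lemma derive_dir_sum (W : normedModType R) (f : V -> W) x v :
  differentiable f x -> 'D_v f x = \sum_(i < n.+1) v 0 i *: 'D_(delta_mx 0 i) f x.
Proof.
move=> df; rewrite deriveE// {1}(rV_sum_delta v) linear_sum.
by apply: eq_bigr => i _; rewrite linearZ/= -deriveE.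
Qed.

End Curves.

Section MeanValue.
Variables (R : realType).

Lemma is_derive_eps (f : R -> R) (s D : R) :
  (forall e : R, 0 < e -> \forall h \near 0^', `|D - h^-1 * (f (s + h) - f s)| < e) ->
  is_derive s (1 : R) f D.
Proof.
move=> H.
have C : h^-1 *: ((f \o shift s) (h *: (1 : R)) - f s) @[h --> 0^'] --> D.
  apply/cvgrPdist_lt => e e0; apply: filterS (H e e0) => h.
  by rewrite /= [h *: 1]/GRing.scale/= mulr1 [h + s]addrC.
by split; [apply/cvg_ex; exists D|exact: cvg_lim C].
Qed.

Lemma line_continuous (V : normedModType R) (x v : V) (s : R) :
  {for s, continuous (fun t : R => x + t *: v)}.
Proof.
apply: differentiable_continuous; apply/derivable1_diffP.
by case: (is_derive_line x v s).
Qed.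

Lemma is_derive1_line (V W : normedModType R) (f : V -> W) (x v : V) (s : R) D :
  is_derive (x + s *: v) v f D -> is_derive s (1 : R) (fun h => f (x + h *: v)) D.
Proof.
have E : (fun h : R => h^-1 *: (((fun h => f (x + h *: v)) \o shift s) (h *: (1 : R)) -
      (fun h => f (x + h *: v)) s)) =
    (fun h => h^-1 *: ((f \o shift (x + s *: v)) (h *: v) - f (x + s *: v))).
  apply/funext => h /=; congr (_ *: (f _ - _)).
  by rewrite [h *: 1]/GRing.scale/= mulr1 scalerDl addrCA.
by move=> [fd fE]; split; rewrite /derivable /derive E.
Qed.

Lemma is_derive_line1 (V W : normedModType R) (f : V -> W) (x v : V) D :
  is_derive (0 : R) (1 : R) (fun h => f (x + h *: v)) D -> is_derive x v f D.
Proof.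
have E : (fun h : R => h^-1 *: (((fun h => f (x + h *: v)) \o shift 0) (h *: (1 : R)) -
      (fun h => f (x + h *: v)) 0)) =
    (fun h => h^-1 *: ((f \o shift x) (h *: v) - f x)).
  apply/funext => h /=; congr (_ *: (f _ - f _)).
    by rewrite [h *: 1]/GRing.scale/= mulr1 addr0 addrC.
  by rewrite scale0r addr0.
by move=> [fd fE]; split; move: fd fE; rewrite /derivable /derive E.
Qed.

(** Of [f] only one directional derivative is given, so the chain rule is applied to its restriction
    to the line through [x] in direction [v]. *)
Lemma is_derive_outer (V W : normedModType R) (f : V -> R) (phi : R -> W) (x v : V) D :
  is_derive x v f D -> differentiable phi (f x) ->
  is_derive x v (phi \o f) ('D_D phi (f x)).
Proof.
move=> hf hp; apply: is_derive_line1.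
have hf0 : is_derive (0 : R) (1 : R) (fun h => f (x + h *: v)) D.
  by apply: is_derive1_line; rewrite scale0r addr0.
have := is_derive_comp hf0; rewrite scale0r addr0 => /(_ _ phi).
exact.
Qed.

(** Both signs of [a] are covered, and the intermediate parameter is bounded by [|a|]; this bound is
    what keeps the intermediate point in a given neighbourhood. *)
Lemma MVT_line (V : normedModType R) (f : V -> R) (x v : V) (a : R) :
  (forall s, `|s| <= `|a| -> derivable f (x + s *: v) v) ->
  exists2 c : R, `|c| <= `|a| & f (x + a *: v) - f x = a * 'D_v f (x + c *: v).
Proof.
move=> df.
have H s : `|s| <= `|a| ->
    is_derive s (1 : R) (fun h => f (x + h *: v)) ('D_v f (x + s *: v)).
  by move=> sa; apply: is_derive1_line; apply/derivableP/df.
have [a0|a0|->] := ltgtP a 0; last first.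
- by exists 0 => //; rewrite !scale0r !addr0 mul0r subrr.
- have Ha s : s \in `[0, a] -> `|s| <= `|a|.
    by rewrite in_itv/= => /andP[s0 sa]; rewrite !ger0_norm// ltW.
  have cf : {within `[0, a], continuous (fun h => f (x + h *: v))}.
    by apply: derivable_within_continuous => s /Ha /H[].
  have Hd s : s \in `]0, a[ -> is_derive s (1 : R) (fun h => f (x + h *: v))
      ('D_v f (x + s *: v)).
    by move=> sa; apply: H; apply: Ha; apply: subset_itv_oo_cc.
  have [c ca] := MVT a0 Hd cf.
  rewrite scale0r addr0 subr0 mulrC => ->; exists c => //.
  by apply: Ha; apply: subset_itv_oo_cc.
- have Ha s : s \in `[a, 0] -> `|s| <= `|a|.
    by rewrite in_itv/= => /andP[s0 sa]; rewrite !ler0_norm ?lerN2// ltW.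
  have cf : {within `[a, 0], continuous (fun h => f (x + h *: v))}.
    by apply: derivable_within_continuous => s /Ha /H[].
  have Hd s : s \in `]a, 0[ -> is_derive s (1 : R) (fun h => f (x + h *: v))
      ('D_v f (x + s *: v)).
    by move=> sa; apply: H; apply: Ha; apply: subset_itv_oo_cc.
  have [c ca] := MVT a0 Hd cf.
  rewrite scale0r addr0 sub0r mulrN mulrC => e; exists c.
    by apply: Ha; apply: subset_itv_oo_cc.
  by rewrite -[RHS]opprK -e opprB.
Qed.

Lemma differentiable_eps (V W : normedModType R) (f : V -> W) (x : V)
  (L : {linear V -> W}) : continuous L ->
  (forall e : R, 0 < e -> \forall h \near (0 : V), `|f (h + x) - (f x + L h)| <= e * `|h|) ->
  differentiable f x.
Proof.
move=> cL H.
have o : f \o shift x = cst (f x) + L +o_ (0 : V) id.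
  apply/eqaddoP => e e0; near=> h; rewrite /= !fctE/=.
  by near: h; exact: H.
by apply/diff_locallyP; rewrite (diff_unique cL o).
Unshelve. all: by end_near. Qed.

Variable n : nat.
Local Notation V := 'rV[R]_n.+1.

(** Truncation to the first [k] coordinates. Consecutive truncations differ by a multiple of one
    basis vector, so they form a path from 0 to [h] whose steps are accessible to [MVT_line]. *)
Let tr (k : nat) (h : V) : V := \row_(i < n.+1) if (i < k)%N then h 0 i else 0.

Let tr0 h : tr 0 h = 0.
Proof. by apply/rowP => i; rewrite !mxE. Qed.

Let trn h : tr n.+1 h = h.
Proof. by apply/rowP => i; rewrite !mxE ltn_ord. Qed.

Let trS (k : 'I_n.+1) h : tr k.+1 h = tr k h + h 0 k *: delta_mx 0 k.
Proof.
apply/rowP => i; rewrite !mxE eqxx/= ltnS leq_eqVlt.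
have [->|ik] := eqVneq i k; first by rewrite eqxx ltnn add0r mulr1.
by rewrite mulr0 addr0 (_ : (i == k :> nat) = false)//; apply/negbTE.
Qed.

Let normtr (k : nat) (h : V) (c : R) (j : 'I_n.+1) : `|c| <= `|h 0 j| -> (k <= j)%N ->
   `|tr k h + c *: delta_mx 0 j| <= `|h|.
Proof.
move=> ch kj.
rewrite [leLHS]/Num.Def.normr /= mx_normrE; apply: bigmax_le => // -[i' i] _ /=.
rewrite ord1 !mxE eqxx/=.
have [->|ij] := eqVneq i j.
  by rewrite ltnNge kj add0r mulr1 (le_trans ch)// coord_le.
by rewrite mulr0 addr0; case: ifPn => _; rewrite ?normr0// coord_le.
Qed.

(** [Ck_on] only speaks of directional derivatives, while the chain rule along curves needs full
    differentiability. The increment telescopes along the truncations, and continuity of the partial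
    derivatives makes each step small. *)
Lemma partials_differentiable (f : V -> R) (x : V) :
  (\forall y \near x, forall i, derivable f y (delta_mx 0 i)) ->
  (forall i, {for x, continuous (fun y => 'D_(delta_mx 0 i) f y)}) ->
  differentiable f x.
Proof.
move=> df cf.
pose L0 (h : V) : R := \sum_(i < n.+1) h 0 i * 'D_(delta_mx 0 i) f x.
have linL : linear L0.
  move=> a u v; rewrite /L0 scaler_sumr -big_split/=; apply: eq_bigr => i _.
  by rewrite !mxE mulrDl; congr (_ + _); rewrite /GRing.scale/= mulrA.
pose Lm := GRing.isLinear.Build _ _ _ _ _ linL.
pose L : {linear V -> R} := HB.pack L0 Lm.
apply: (@differentiable_eps _ _ f x L).
  move=> h; apply: (@continuous_sumR R V) => i.
  by apply: continuousM; [exact: coord_continuous|exact: cst_continuous].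
move=> e e0.
have e1 : 0 < e / n.+1%:R by rewrite divr_gt0.
have /nbhs_ballP[d /= d0 dP] : \forall y \near x, forall i,
    derivable f y (delta_mx 0 i) /\
    `|'D_(delta_mx 0 i) f x - 'D_(delta_mx 0 i) f y| < e / n.+1%:R.
  have H : \forall y \near x, forall i,
     `|'D_(delta_mx 0 i) f x - 'D_(delta_mx 0 i) f y| < e / n.+1%:R.
    apply: (@filter_forall _ _ (fun i y =>
      `|'D_(delta_mx 0 i) f x - 'D_(delta_mx 0 i) f y| < e / n.+1%:R) (nbhs x)) => i.
    by have /cvgrPdist_lt/(_ _ e1) := cf i.
  by apply: filterS2 df H => y h1 h2 i; split.
near=> h.
have hd : `|h| < d by near: h; apply/nbhs_ballP; exists d => // h; rewrite -ball_normE /ball_/= sub0r normrN.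
have -> : f (h + x) - (f x + L h) = \sum_(k < n.+1)
    (f (x + tr k.+1 h) - f (x + tr k h) - h 0 k * 'D_(delta_mx 0 k) f x).
  rewrite sumrB -/(L h) -(big_mkord predT (fun k => f (x + tr k.+1 h) - f (x + tr k h))).
  rewrite (@telescope_sumr _ 0 n.+1 (fun k => f (x + tr k h)))// trn tr0 addr0.
  by rewrite opprD addrA (addrC h).
have -> : e * `|h| = \sum_(k < n.+1) (e / n.+1%:R * `|h|).
  rewrite sumr_const card_ord -(mulr_natl (_ * _)) mulrA mulrCA.
  by rewrite divff ?mulr1// pnatr_eq0.
apply: (le_trans (ler_norm_sum _ _ _)); apply: ler_sum => k _.
rewrite trS addrA.
have inb c : `|c| <= `|h 0 k| -> ball x d (x + tr k h + c *: delta_mx 0 k).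
  move=> ck; rewrite -ball_normE /ball_/= -addrA opprD addNKr normrN.
  exact: le_lt_trans (normtr ck (leqnn k)) hd.
have [|c ca ->] := @MVT_line V f (x + tr k h) (delta_mx 0 k) (h 0 k).
  by move=> s /inb /dP/(_ k)[].
rewrite -mulrBr normrM mulrC ler_pM//; last exact: coord_le.
by rewrite distrC ltW//; have [_] := dP _ (inb c ca) k.
Unshelve. all: by end_near. Qed.

End MeanValue.

(** * Smooth functions *)

Section Smooth.
Variables (R : realType).
Implicit Types (V W : normedModType R).

Lemma Ck_on_continuous V W k (U : set V) (f : V -> W) :
  Ck_on k U f -> forall x, U x -> {for x, continuous f}.
Proof. by case: k => [|k] []. Qed.

Lemma Ck_on_pred V W k (U : set V) (f : V -> W) : Ck_on k.+1 U f -> Ck_on k U f.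
Proof.
elim: k f => [|k IH] f [cf df]; first by split.
by split=> // v; have [dv Cv] := df v; split => //; exact: IH.
Qed.

Lemma Ck_on_eq V W k (U : set V) (f g : V -> W) : open U ->
  (forall x, U x -> f x = g x) -> Ck_on k U f -> Ck_on k U g.
Proof.
move=> oU; elim: k f g => [|k IH] f g fg [cf df].
all: have fgn x : U x -> \forall y \near x, f y = g y
  by move=> Ux; apply: filterS (open_nbhs_nbhs (conj oU Ux)) => y /fg.
all: have cg x : U x -> {for x, continuous g}
  by move=> Ux; rewrite /prop_for /continuous_at -fg//; apply: cvg_trans (cf _ Ux);
     apply: near_eq_cvg; exact: fgn.
  by split.
split=> // v; have [dv Cv] := df v; split => [x Ux|].
  exact: near_eq_derivable (fgn _ Ux) (dv _ Ux).
by apply: IH Cv => x Ux; apply: near_eq_derive; exact: fgn.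
Qed.

Lemma Ck_on_cst V W k (U : set V) (c : W) : open U -> Ck_on k U (fun=> c).
Proof.
move=> oU; elim: k c => [|k IH] c; split => //.
- by move=> x _; exact: cst_continuous.
- by move=> x _; exact: cst_continuous.
- move=> v; split => [x _|]; first exact: derivable_cst.
  by apply: (@Ck_on_eq _ _ _ _ (fun=> 0)) => // x _; rewrite derive_cst.
Qed.

Lemma Ck_on_add V W k (U : set V) (f g : V -> W) : open U ->
  Ck_on k U f -> Ck_on k U g -> Ck_on k U (fun x => f x + g x).
Proof.
move=> oU; elim: k f g => [|k IH] f g [cf df] [cg dg]; split => //.
- by move=> x Ux; apply: continuousD; [exact: cf|exact: cg].
- by move=> x Ux; apply: continuousD; [exact: cf|exact: cg].
- move=> v; have [dfv Cfv] := df v; have [dgv Cgv] := dg v; split => [x Ux|].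
    by apply: derivableD; [exact: dfv|exact: dgv].
  apply: (Ck_on_eq oU _ (IH _ _ Cfv Cgv)) => x Ux.
  by rewrite -deriveD//; [exact: dfv|exact: dgv].
Qed.

Lemma Ck_on_sum V W k (U : set V) I (r : seq I) (F : I -> V -> W) : open U ->
  (forall i, Ck_on k U (F i)) -> Ck_on k U (fun x => \sum_(i <- r) F i x).
Proof.
move=> oU CF; elim: r => [|i r IH].
  by apply: (Ck_on_eq oU _ (@Ck_on_cst V W k U 0 oU)) => x _; rewrite big_nil.
by apply: (Ck_on_eq oU _ (Ck_on_add oU (CF i) IH)) => x _; rewrite big_cons.
Qed.

Lemma Ck_on_mul V k (U : set V) (f g : V -> R) : open U ->
  Ck_on k U f -> Ck_on k U g -> Ck_on k U (fun x => f x * g x).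
Proof.
move=> oU; elim: k f g => [|k IH] f g Cf Cg.
  by split => // x Ux; apply: continuousM; [apply: (Ck_on_continuous Cf)|apply: (Ck_on_continuous Cg)].
split=> [x Ux|v].
  by apply: continuousM; [apply: (Ck_on_continuous Cf)|apply: (Ck_on_continuous Cg)].
have [dfv Cfv] := Cf.2 v; have [dgv Cgv] := Cg.2 v; split => [x Ux|].
  by apply: derivableM; [exact: dfv|exact: dgv].
have C1 := IH _ _ (Ck_on_pred Cf) Cgv.
have C2 := IH _ _ (Ck_on_pred Cg) Cfv.
apply: (Ck_on_eq oU _ (Ck_on_add oU C1 C2)) => x Ux.
by rewrite -[RHS]/('D_v (f * g) x) deriveM//; [exact: dfv|exact: dgv].
Qed.

Lemma Ck_on_scalel V W k (U : set V) (f : V -> R) (w : W) : open U ->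
  Ck_on k U f -> Ck_on k U (fun x => f x *: w).
Proof.
move=> oU; elim: k f => [|k IH] f [cf df]; split => //.
- by move=> x Ux; apply: continuousZr_tmp; exact: cf.
- by move=> x Ux; apply: continuousZr_tmp; exact: cf.
- move=> v; have [dv Cv] := df v.
  have H x : U x -> is_derive x v (fun x => f x *: w) ('D_v f x *: w).
    move=> Ux; have := is_derive_outer (phi := fun r : R => r *: w) (derivableP (dv x Ux)).
    have dphi r : is_diff r (fun r : R => r *: w) (fun r : R => r *: w) by exact: is_diff_scalel.
    by rewrite deriveE// diff_val; exact.
  split => [x /H[]//|].
  by apply: (Ck_on_eq oU _ (IH _ Cv)) => x /H[].
Qed.

(** The power -3/2 is written as a product of three inverse square roots, so that the derivative is
    built from functions already known to be [C^k] in the induction of [Ck_on_rsqrt]. *)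
Lemma is_derive_rsqrt V (f : V -> R) x v : 0 < f x -> derivable f x v ->
  is_derive x v (fun y => (Num.sqrt (f y))^-1)
    (- 2^-1 * ((Num.sqrt (f x))^-1 * ((Num.sqrt (f x))^-1 * (Num.sqrt (f x))^-1))
     * 'D_v f x).
Proof.
move=> f0 df.
have s0 : 0 < Num.sqrt (f x) by rewrite sqrtr_gt0.
have hs := is_derive1_sqrt f0.
have dphi : is_derive (f x) (1 : R) (fun r : R => (Num.sqrt r)^-1)
    (- Num.sqrt (f x) ^- 2 *: (2 * Num.sqrt (f x))^-1).
  have dv : derivable (@Num.sqrt R) (f x) 1 by case: hs.
  have s1 : Num.sqrt (f x) != 0 by rewrite gt_eqF.
  split; first exact: derivableV.
  by rewrite deriveV//; congr (_ *: _); case: hs.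
have dd : differentiable (fun r : R => (Num.sqrt r)^-1) (f x).
  by apply/derivable1_diffP; case: dphi.
apply: is_derive_eq; first exact: (is_derive_outer (derivableP df) dd).
rewrite -[X in 'D_X _ _]mulr1 -[X in 'D_X _ _]/(_ *: _) derive_dirZ//.
have [_ ->] := dphi; rewrite /GRing.scale/=; field.
by rewrite gt_eqF.
Qed.

Lemma Ck_on_rsqrt V k (U : set V) (f : V -> R) : open U ->
  (forall x, U x -> 0 < f x) ->
  Ck_on k U f -> Ck_on k U (fun x => (Num.sqrt (f x))^-1).
Proof.
move=> oU f0; elim: k => [|k IH] Cf.
all: have cf x : U x -> {for x, continuous (fun x => (Num.sqrt (f x))^-1)}
  by move=> Ux; apply: continuousV; [rewrite gt_eqF// sqrtr_gt0 f0|
    apply: (@continuous_comp _ _ _ f (@Num.sqrt R));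
    [exact: Ck_on_continuous Cf _ Ux|exact: sqrt_continuous]].
  by split.
split => // v; have [dv Cv] := Cf.2 v.
split => [x Ux|]; first by case: (is_derive_rsqrt (f0 _ Ux) (dv _ Ux)).
have C1 := IH (Ck_on_pred Cf).
have C2 := Ck_on_mul oU (Ck_on_mul oU (@Ck_on_cst _ _ k U (- 2^-1 : R) oU)
  (Ck_on_mul oU C1 (Ck_on_mul oU C1 C1))) Cv.
by apply: (Ck_on_eq oU _ C2) => x Ux; case: (is_derive_rsqrt (f0 _ Ux) (dv _ Ux)).
Qed.

Lemma Ck_on_rV V n k (U : set V) (f : V -> 'rV[R]_n.+1) : open U ->
  (forall i, Ck_on k U (fun x => f x 0 i)) -> Ck_on k U f.
Proof.
move=> oU Cf.
have -> : f = (fun x => \sum_(i < n.+1) f x 0 i *: (delta_mx 0 i : 'rV[R]_n.+1)).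
  by apply/funext => x; exact: rV_sum_delta.
by apply: Ck_on_sum => // i; exact: Ck_on_scalel.
Qed.

Lemma Ck_on_coord V n k (U : set V) (f : V -> 'rV[R]_n.+1) i : open U ->
  Ck_on k U f -> Ck_on k U (fun x => f x 0 i).
Proof.
move=> oU; elim: k f => [|k IH] f [cf df]; split => //.
- by move=> x Ux; apply: (@continuous_comp _ _ _ f (fun M : 'rV[R]_n.+1 => M 0 i)); [exact: cf|exact: coord_continuous].
- by move=> x Ux; apply: (@continuous_comp _ _ _ f (fun M : 'rV[R]_n.+1 => M 0 i)); [exact: cf|exact: coord_continuous].
- move=> v; have [dv Cv] := df v; split => [x Ux|].
    by have /derivable_mxP := dv x Ux; exact.
  apply: (Ck_on_eq oU _ (IH _ Cv)) => x Ux.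
  by rewrite derive_mx ?mxE//; exact: dv.
Qed.

Lemma Ck_on_differentiable n k (U : set 'rV[R]_n.+1) (f : 'rV[R]_n.+1 -> R) x :
  open U -> U x -> Ck_on k.+1 U f -> differentiable f x.
Proof.
move=> oU Ux [cf df]; apply: partials_differentiable.
  by apply: filterS (open_nbhs_nbhs (conj oU Ux)) => y Uy i; have [dv _] := df (delta_mx 0 i); exact: dv.
by move=> i; have [_ Cv] := df (delta_mx 0 i); exact: Ck_on_continuous Cv _ Ux.
Qed.

Lemma Ck_on_differentiable_rV m n k (U : set 'rV[R]_n.+1)
    (f : 'rV[R]_n.+1 -> 'rV[R]_m.+1) x :
  open U -> U x -> Ck_on k.+1 U f -> differentiable f x.
Proof.
move=> oU Ux Cf; apply: differentiable_rV => i.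
exact: Ck_on_differentiable oU Ux (Ck_on_coord i oU Cf).
Qed.

End Smooth.

(** * Unit normals and the second fundamental form *)

Section UnitGradient.
Variables (R : realType) (n : nat).
Local Notation V := 'rV[R]_n.+1.

Definition grad (u : V -> R) (x : V) : V := \row_i 'D_(delta_mx 0 i) u x.

(** Unit normal of all level sets of [u] at once; being defined off the zero set, it can be
    differentiated in every direction. *)
Definition ugrad (u : V -> R) (x : V) : V :=
  locked ((Num.sqrt (dot (grad u x) (grad u x)))^-1 *: grad u x).

Variables (U : set V) (u : V -> R).
Hypothesis oU : open U.
Hypothesis su : smooth_on U u.
Hypothesis gu : forall q, U q -> exists v, 'D_v u q != 0.

Lemma level_differentiable x : U x -> differentiable u x.
Proof. by move=> Ux; exact: Ck_on_differentiable oU Ux (su 1). Qed.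

Lemma derive_grad x v : U x -> 'D_v u x = dot (grad u x) v.
Proof.
move=> Ux; rewrite derive_dir_sum; last exact: level_differentiable.
by apply: eq_bigr => i _; rewrite mxE mulrC.
Qed.

Lemma grad_neq0 x : U x -> grad u x != 0.
Proof.
by move=> Ux; have [v] := gu Ux; apply: contraNneq; rewrite derive_grad// => ->; rewrite dot0l.
Qed.

Lemma enorm_grad_gt0 x : U x -> 0 < enorm (grad u x).
Proof. by move=> /grad_neq0; rewrite enorm_gt0. Qed.

Lemma gradE x : U x -> grad u x = enorm (grad u x) *: ugrad u x.
Proof.
move=> Ux; rewrite /ugrad -?lock scalerA -/(enorm (grad u x)) mulfV ?scale1r//.
by rewrite enorm_eq0 grad_neq0.
Qed.

Lemma derive_ugrad x v : U x -> 'D_v u x = enorm (grad u x) * dot (ugrad u x) v.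
Proof. by move=> Ux; rewrite derive_grad// {1}gradE// dotZl. Qed.

Lemma smooth_grad : smooth_on U (grad u).
Proof.
move=> k; apply: Ck_on_rV => // i.
have [_] := (su k.+1).2 (delta_mx 0 i).
by apply: Ck_on_eq => // x _; rewrite mxE.
Qed.

Lemma smooth_ugrad : smooth_on U (ugrad u).
Proof.
move=> k; apply: Ck_on_rV => // i.
have Cg j := Ck_on_coord j oU (smooth_grad k).
have Cd : Ck_on k U (fun x => dot (grad u x) (grad u x)).
  by apply: Ck_on_sum => // j; exact: Ck_on_mul.
have C1 : Ck_on k U (fun x => (Num.sqrt (dot (grad u x) (grad u x)))^-1).
  by apply: Ck_on_rsqrt => // x Ux; rewrite dotvv_gt0 grad_neq0.
by apply: (Ck_on_eq oU _ (Ck_on_mul oU C1 (Cg i))) => x Ux; rewrite /ugrad -?lock [RHS]mxE.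
Qed.

Lemma dot_ugrad x : U x -> dot (ugrad u x) (ugrad u x) = 1.
Proof.
move=> Ux; rewrite /ugrad -?lock dotZl dotZr -/(enorm (grad u x)) -sqr_enorm expr2.
by field; rewrite gt_eqF// enorm_grad_gt0.
Qed.

Lemma enorm_ugrad x : U x -> enorm (ugrad u x) = 1.
Proof. by move=> Ux; rewrite /enorm dot_ugrad// sqrtr1. Qed.

Lemma differentiable_ugrad x : U x -> differentiable (ugrad u) x.
Proof. by move=> Ux; exact: Ck_on_differentiable_rV oU Ux (smooth_ugrad 1). Qed.

Lemma differentiable_derive_ugrad x v : U x -> differentiable (fun y => 'D_v (ugrad u) y) x.
Proof.
move=> Ux; have [_ h] := (smooth_ugrad 2).2 v.
exact: (@Ck_on_differentiable_rV _ _ _ 0 _ _ _ oU Ux h).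
Qed.

Lemma dot_derive_ugrad x v : U x -> dot ('D_v (ugrad u) x) (ugrad u x) = 0.
Proof.
move=> Ux.
have h : is_derive x v (ugrad u) ('D_v (ugrad u) x).
  by apply: derivableP; apply: diff_derivable; exact: differentiable_ugrad.
have := is_derive_dot h h.
have hn : \forall y \near x, 1 = dot (ugrad u y) (ugrad u y).
  by apply: filterS (open_nbhs_nbhs (conj oU Ux)) => y Uy; rewrite dot_ugrad.
move=> [_]; rewrite -(near_eq_derive v hn) derive_cst (dotC (ugrad u x)).
by move/eqP; rewrite eq_sym -mulr2n mulrn_eq0/= => /eqP.
Qed.

Variable M : set V.
Hypothesis Mu : forall q, U q -> (M q <-> u q = 0).

(** [u] vanishes along every curve in [M], so by the chain rule its gradient is orthogonal to the
    velocity. Through this lemma the curvature bounds and the flow equation, which quantify over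
    local unit normals, apply to [ugrad u]. *)
Lemma unit_normal_near_ugrad p : U p -> unit_normal_near M p (ugrad u).
Proof.
move=> Up; exists U; split => // [|q Uq Mq]; first exact: smooth_ugrad.
split=> [|v [e [g [e0 sg Mg g0 g1]]]]; first exact: enorm_ugrad.
have b0 : ball (0 : R) e 0 by exact: ballxx.
have dg : is_derive (0 : R) (1 : R) g v.
  by split; [have [h _] := (sg 1).2 (1 : R); exact: h|rewrite -derive1E].
have du : is_derive (0 : R) (1 : R) (u \o g) ('D_v u q).
  by rewrite -g0; apply: is_derive_comp => //; rewrite g0; exact: level_differentiable.
have cg : {for 0, continuous g} by exact: (Ck_on_continuous (sg 0)).
have hn : \forall t \near (0 : R), 0 = (u \o g) t.
  have Ug : \forall t \near (0 : R), U (g t).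
    by apply: cg; rewrite g0; exact: open_nbhs_nbhs.
  have Bg : \forall t \near (0 : R), ball (0 : R) e t by exact: nbhsx_ballx.
  by apply: filterS2 Ug Bg => t Ut Bt; apply/esym; apply: (Mu Ut).1; exact: Mg.
have [_] := du; rewrite -(near_eq_derive _ hn) derive_cst derive_ugrad// => /esym/eqP.
by rewrite mulf_eq0 gt_eqF ?enorm_grad_gt0//= => /eqP.
Qed.

End UnitGradient.

Section SecondForm.
Variables (R : realType) (n : nat).
Local Notation V := 'rV[R]_n.+1.
Variables (nu : V -> V) (p : V).
Hypothesis dnu : differentiable nu p.
Hypothesis nu1 : dot (nu p) (nu p) = 1.
Local Notation P := (tproj (nu p)).
Local Notation e := (fun i => (delta_mx 0 i : V)).

Lemma tproj_tangent v : dot (nu p) v = 0 -> P v = v.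
Proof. by rewrite /tproj => ->; rewrite scale0r subr0. Qed.

Lemma dot_tproj v : dot (nu p) (P v) = 0.
Proof. by rewrite /tproj !dotE nu1 mulr1 subrr. Qed.

(** The projected standard basis is a Parseval frame of the tangent space: a tangent vector has its
    ambient coordinates as coefficients. This frame takes the place of an orthonormal tangent
    basis. *)
Lemma tproj_sum v : dot (nu p) v = 0 -> v = \sum_(i < n.+1) v 0 i *: P (e i).
Proof.
move=> nv; rewrite -{1}(tproj_tangent nv) /tproj; under eq_bigr do rewrite scalerBr scalerA.
rewrite sumrB -rV_sum_delta -scaler_suml; congr (_ - _ *: _).
rewrite {1}(rV_sum_delta v) dot_sumr; apply: eq_bigr => i _.
by rewrite dotZr.
Qed.

Lemma sff_sum v w : dot (nu p) v = 0 -> dot (nu p) w = 0 ->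
  dot ('D_v nu p) w = \sum_(i < n.+1) v 0 i * \sum_(j < n.+1) w 0 j * sff nu p (e i) (e j).
Proof.
move=> nv nw; rewrite {1}(tproj_sum nv) deriveE// linear_sum dotC dot_sumr.
apply: eq_bigr => i _; rewrite linearZ/= dotZr; congr (_ * _).
rewrite dotC {1}(tproj_sum nw) dot_sumr; apply: eq_bigr => j _.
by rewrite dotZr -deriveE.
Qed.

(** The operator norm is at most the Hilbert-Schmidt norm, by Cauchy-Schwarz in each of the two
    indices. *)
Lemma sff_bound k v w : sff_norm nu p <= k -> dot (nu p) v = 0 -> dot (nu p) w = 0 ->
  `|dot ('D_v nu p) w| <= k * (enorm v * enorm w).
Proof.
move=> hk nv nw.
have k0 : 0 <= k by apply: le_trans hk; exact: sqrtr_ge0.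
set s := fun i => (\row_j sff nu p (e i) (e j) : V).
set t := (\row_i dot w (s i) : V).
have -> : dot ('D_v nu p) w = dot v t.
  rewrite sff_sum//; apply: eq_bigr => i _; rewrite mxE; congr (_ * _).
  by apply: eq_bigr => j _; rewrite mxE.
apply: (le_trans (dot_le _ _)); rewrite mulrCA ler_wpM2l ?enorm_ge0//.
rewrite -(@ler_pXn2r _ 2) ?nnegrE ?mulr_ge0 ?enorm_ge0// exprMn !sqr_enorm.
apply: (@le_trans _ _ (sff_norm nu p ^+ 2 * dot w w)); last first.
  by rewrite ler_wpM2r ?dotvv_ge0// lerXn2r ?nnegrE// sqrtr_ge0.
rewrite sqr_sqrtr; last by apply: sumr_ge0 => i _; apply: sumr_ge0 => j _; exact: sqr_ge0.
rewrite mulr_suml; apply: ler_sum => i _; rewrite mxE -expr2.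
apply: (le_trans (dot_sqr_le _ _)); rewrite mulrC le_eqVlt; apply/orP; left; apply/eqP.
by congr (_ * _); apply: eq_bigr => j _; rewrite mxE expr2.
Qed.

End SecondForm.

(** * Graph charts of level sets *)

Section Chart.
Variables (R : realType) (n : nat).
Local Notation V := 'rV[R]_n.+1.
Implicit Types (x y z N xi eta : V).

Definition cylinder z N (r eps : R) : set V :=
  [set x | enorm (tproj N (x - z)) < r /\ `|dot N (x - z)| < eps].

Definition disc N (r : R) : set V := [set xi | dot N xi = 0 /\ enorm xi < r].

Definition chart z N (k : V -> R) xi : V := z + xi + k xi *: N.

(* Velocity of the graph curve over the line of direction [eta]. *)
Definition theta (u : V -> R) N eta x : V :=
  eta - (dot (ugrad u x) eta / dot (ugrad u x) N) *: N.

(** The implicit function theorem for a graph over the tangent disc at [z]. The disc lies in a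
    hyperplane and is not open in the ambient space, so continuity is stated relative to it and
    derivatives along lines inside it. *)
Record level_chart (U : set V) (u : V -> R) z (r eps : R) (k : V -> R) : Prop :=
  LevelChart {
  lc_r0 : 0 < r;
  lc_eps0 : 0 < eps;
  lc_sub : cylinder z (ugrad u z) r eps `<=` U;
  lc_pos : forall x, cylinder z (ugrad u z) r eps x -> 0 < dot (ugrad u x) (ugrad u z);
  lc_lt : forall xi, disc (ugrad u z) r xi -> `|k xi| < eps;
  lc_root : forall xi, disc (ugrad u z) r xi -> u (chart z (ugrad u z) k xi) = 0;
  lc_uniq : forall xi h, disc (ugrad u z) r xi -> `|h| < eps ->
    u (z + xi + h *: ugrad u z) = 0 -> h = k xi;
  lc_cont : forall xi e, disc (ugrad u z) r xi -> 0 < e ->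
    \forall xi' \near xi, disc (ugrad u z) r xi' -> `|k xi' - k xi| < e;
  lc_derive : forall xi eta s, dot (ugrad u z) eta = 0 ->
    disc (ugrad u z) r (xi + s *: eta) ->
    is_derive s (1 : R) (fun t => chart z (ugrad u z) k (xi + t *: eta))
      (theta u (ugrad u z) eta (chart z (ugrad u z) k (xi + s *: eta)))
}.

Lemma cylinder_open z N r eps : open (cylinder z N r eps).
Proof.
rewrite openE => x [xr xe].
have c1 : {for x, continuous (fun x => enorm (tproj N (x - z)))}.
  apply: enorm_continuous; apply: continuousB.
    by apply: continuousB => //; exact: cst_continuous.
  apply: continuousZ; last exact: cst_continuous.
  apply: dot_continuous; first exact: cst_continuous.
  by apply: continuousB => //; exact: cst_continuous.
have c2 : {for x, continuous (fun x => `|dot N (x - z)|)}.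
  apply: (@continuous_comp _ _ _ (fun x => dot N (x - z)) Num.Def.normr); last exact: norm_continuous.
  apply: dot_continuous; first exact: cst_continuous.
  by apply: continuousB => //; exact: cst_continuous.
have h1 := near_lt c1 xr.
have h2 := near_lt c2 xe.
by rewrite /interior; near=> y; split; near: y.
Unshelve. all: by end_near. Qed.

Lemma cylinder_coord z N r eps xi h : dot N N = 1 -> disc N r xi -> `|h| < eps ->
  cylinder z N r eps (z + xi + h *: N).
Proof.
move=> NN [Nxi xir] he; rewrite /cylinder/= -[z + xi + _]addrA [z + _]addrC addrK.
rewrite !dotE Nxi NN mulr1 add0r; split => //.
by rewrite /tproj !dotE Nxi NN mulr1 add0r addrK.
Qed.

Lemma cylinder_disc z N r eps x : dot N N = 1 -> cylinder z N r eps x ->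
  disc N r (tproj N (x - z)) /\ x = z + tproj N (x - z) + dot N (x - z) *: N.
Proof.
move=> NN [xr xe]; split; first by split => //; rewrite /tproj !dotE NN mulr1 subrr.
by rewrite /tproj addrA subrK addrC subrK.
Qed.

Lemma cylinder_center z N r eps : 0 < r -> 0 < eps -> cylinder z N r eps z.
Proof. by move=> r0 e0; rewrite /cylinder/= subrr /tproj dot0r scale0r subrr enorm0 normr0. Qed.

Lemma disc0 N r : 0 < r -> disc N r 0.
Proof. by move=> r0; split; rewrite ?dot0r ?enorm0. Qed.

Lemma disc_convex N r xi xi' (s : R) : 0 <= s <= 1 -> disc N r xi -> disc N r xi' ->
  disc N r (xi + s *: (xi' - xi)).
Proof.
move=> /andP[s0 s1] [N1 r1] [N2 r2]; split; first by rewrite !dotE N1 N2 subrr mulr0 addr0.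
have -> : xi + s *: (xi' - xi) = (1 - s) *: xi + s *: xi'.
  by rewrite scalerBr scalerBl scale1r addrAC addrA.
apply: (le_lt_trans (enormD _ _)); rewrite !enormZ !ger0_norm ?subr_ge0//.
have [->|sn0] := eqVneq s 0; first by rewrite subr0 mul1r mul0r addr0.
have sp : 0 < s by rewrite lt_def sn0.
have h1 : (1 - s) * enorm xi <= (1 - s) * r by rewrite ler_wpM2l ?subr_ge0// ltW.
have h2 : s * enorm xi' < s * r by rewrite ltr_pM2l.
by have := ler_ltD h1 h2; rewrite -mulrDl subrK mul1r.
Qed.

Lemma disc_open N r xi eta (s : R) : dot N eta = 0 -> disc N r (xi + s *: eta) ->
  \forall t \near s, disc N r (xi + t *: eta).
Proof.
move=> Ne [Nx xr].
have Nxi : dot N xi = 0 by move: Nx; rewrite !dotE Ne mulr0 addr0.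
have c : {for s, continuous (fun t : R => enorm (xi + t *: eta))}.
  by apply: enorm_continuous; apply: differentiable_continuous; apply/derivable1_diffP;
     case: (is_derive_line xi eta s).
by apply: filterS (near_lt c xr) => t /= ht; split => //; rewrite !dotE Ne mulr0 Nxi addr0.
Qed.

Variables (U : set V) (u : V -> R).
Hypothesis oU : open U.
Hypothesis su : smooth_on U u.
Hypothesis gu : forall q, U q -> exists v, 'D_v u q != 0.

(** Near [z] the function [u] increases strictly in direction [N], so each vertical segment has
    exactly one zero. Signs just above and below the zero persist, which makes its height
    continuous; the mean value theorem along [eta] and then along [N] gives the derivative. *)
Lemma level_chart_exists z (O : set V) : U z -> u z = 0 -> nbhs z O ->
  exists r eps k, level_chart U u z r eps k /\ cylinder z (ugrad u z) r eps `<=` O.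
Proof.
move=> Uz uz0 Oz; set N := ugrad u z.
have NN : dot N N = 1 by exact: (dot_ugrad oU su gu Uz).
have eN : enorm N = 1 by rewrite /enorm NN sqrtr1.
have cn : {for z, continuous (fun x => dot (ugrad u x) N)}.
  apply: dot_continuous; last exact: cst_continuous.
  exact: (differentiable_continuous (differentiable_ugrad oU su gu Uz)).
have hpos : \forall x \near z, 0 < dot (ugrad u x) N.
  by apply: (near_gt cn); rewrite NN.
have /nbhs_enormP[d d0 dP] : nbhs z (O `&` U `&` [set x | 0 < dot (ugrad u x) N]).
  by apply: filterI hpos; apply: filterI => //; exact: open_nbhs_nbhs.
have inU x : enorm (x - z) < d -> U x by move=> /dP[[]].
have du x : enorm (x - z) < d -> differentiable u x.
  by move=> xd; apply: (level_differentiable oU su); exact: inU.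
have DN x : enorm (x - z) < d -> 0 < 'D_N u x.
  move=> /dP[[_ Ux] h]; rewrite (derive_ugrad oU su gu)// mulr_gt0//.
  exact: enorm_grad_gt0 Ux.
(* Intermediate points in [mono] have height up to [3 * eps]; with [enorm xi < d / 2] they stay
   within [d / 2 + 3 * d / 8 < d] of [z]. *)
pose eps := d / 8; have e0 : 0 < eps by rewrite divr_gt0.
have inb xi h : enorm xi < d / 2 -> `|h| <= 3 * eps -> enorm (z + xi + h *: N - z) < d.
  move=> xr he; rewrite addrC addrA addKr; apply: (le_lt_trans (enormD _ _)).
  rewrite enormZ eN mulr1; move: he; rewrite /eps => he; lra.
have mono xi h h' : enorm xi < d / 2 -> `|h| <= eps -> `|h'| <= eps -> h < h' ->
    u (z + xi + h *: N) < u (z + xi + h' *: N).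
  move=> xr he h'e hh.
  have E : z + xi + h' *: N = z + xi + h *: N + (h' - h) *: N.
    by rewrite -[RHS]addrA -scalerDl [h + _]addrC subrK.
  have B c : `|c| <= `|h' - h| -> enorm (z + xi + h *: N + c *: N - z) < d.
    move=> ch; rewrite -[z + xi + _ + _]addrA -scalerDl; apply: inb => //.
    have := ler_normD h c; have := ler_normB h' h; lra.
  have [|c ca e] := @MVT_line R V u (z + xi + h *: N) N (h' - h).
    by move=> s /B sB; apply: diff_derivable; exact: du.
  by rewrite E -subr_gt0 e mulr_gt0 ?subr_gt0//; apply: DN; exact: B.
have ee : `|eps| <= eps by rewrite ger0_norm// ltW.
have ene : `|- eps| <= eps by rewrite normrN.
have z2 : enorm (0 : V) < d / 2 by rewrite enorm0 divr_gt0.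
have n0 : `|0 : R| <= eps by rewrite normr0 ltW.
have u0 : u (z + 0 + 0 *: N) = 0 by rewrite addr0 scale0r addr0.
have up : 0 < u (z + 0 + eps *: N) by have := mono 0 0 eps z2 n0 ee e0; rewrite u0.
have un : u (z + 0 + (- eps) *: N) < 0 by have := mono 0 (- eps) 0 z2 ene n0; rewrite u0 oppr_lt0; exact.
have cu xi h : enorm xi < d / 2 -> `|h| <= eps ->
    {for xi, continuous (fun xi => u (z + xi + h *: N))}.
  move=> xr he; apply: (@continuous_comp _ _ _ (fun xi => z + xi + h *: N) u).
    apply: continuousD; last exact: cst_continuous.
    by apply: continuousD => //; exact: cst_continuous.
  by apply: differentiable_continuous; apply: du; apply: inb => //; apply: le_trans he _; lra.
have /nbhs_enormP[r1 r10 r1P] : nbhs (0 : V) [set xi |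
    0 < u (z + xi + eps *: N) /\ u (z + xi + (- eps) *: N) < 0].
  have h1 := near_gt (cu _ _ z2 ee) up.
  have h2 := near_lt (cu _ _ z2 ene) un.
  by apply: filterS2 h1 h2 => y.
pose r := Num.min r1 (d / 2).
have r0 : 0 < r by rewrite lt_min r10 divr_gt0.
have rd xi : disc N r xi -> enorm xi < d / 2 by move=> [_]; rewrite lt_min => /andP[].
have rs xi : disc N r xi -> 0 < u (z + xi + eps *: N) /\ u (z + xi + (- eps) *: N) < 0.
  by move=> [_]; rewrite lt_min => /andP[h _]; apply: r1P; rewrite subr0.
have root xi h h' : disc N r xi -> h < h' -> `|h| <= eps -> `|h'| <= eps ->
    u (z + xi + h *: N) < 0 -> 0 < u (z + xi + h' *: N) ->
    exists2 c, h < c < h' & u (z + xi + c *: N) = 0.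
  move=> xD hh he h'e un' up'.
  have cf : {within `[h, h'], continuous (fun c => u (z + xi + c *: N))}.
    apply: derivable_within_continuous => c; rewrite in_itv/= => /andP[hc ch].
    have ce : `|c| <= eps by move: he h'e; rewrite !ler_norml => /andP[? ?] /andP[? ?]; apply/andP; split; lra.
    have := is_derive_comp (is_derive_line (z + xi) N c) (du (z + xi + c *: N) _).
    by case=> //; apply: inb; [exact: rd|apply: le_trans ce _; lra].
  have [|c] := IVT (v := 0) (ltW hh) cf.
    by rewrite ge_min le_max (ltW un') (ltW up') orbT.
  rewrite in_itv/= => /andP[hc ch] uc; exists c => //; rewrite !lt_neqAle hc ch !andbT.
  apply/andP; split; first by apply/eqP => E; move: un'; rewrite E uc ltxx.
  by apply/eqP => E; move: up'; rewrite -E uc ltxx.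
have exk xi : disc N r xi -> exists h, `|h| < eps /\ u (z + xi + h *: N) = 0.
  move=> xD; have [p1 p2] := rs _ xD.
  have [|c /andP[c1 c2] uc] := root xi (- eps) eps xD _ ene ee p2 p1; first by rewrite gtrN.
  by exists c; split => //; rewrite ltr_norml c1 c2.
(* Off the disc a root need not exist, and [xget] may then return the height 0. *)
pose k xi := xget 0 [set h | `|h| < eps /\ u (z + xi + h *: N) = 0].
have kP xi : disc N r xi -> `|k xi| < eps /\ u (z + xi + k xi *: N) = 0.
  by move=> xD; have [h hP] := exk _ xD; exact: (xgetPex 0 (exk _ xD)).
have kU xi h : disc N r xi -> `|h| < eps -> u (z + xi + h *: N) = 0 -> h = k xi.
  move=> xD he uh; have [k1 k2] := kP _ xD.
  have [hk|hk|//] := ltgtP h (k xi).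
    by have := mono _ _ _ (rd _ xD) (ltW he) (ltW k1) hk; rewrite uh k2 ltxx.
  by have := mono _ _ _ (rd _ xD) (ltW k1) (ltW he) hk; rewrite uh k2 ltxx.
have kC xi e : disc N r xi -> 0 < e ->
    \forall xi' \near xi, disc N r xi' -> `|k xi' - k xi| < e.
  move=> xD e'0; have [k1 k2] := kP _ xD.
  (* The second term keeps the heights [k xi + e1] and [k xi - e1] in the range where [u] is
     monotone; the signs of [u] there survive for nearby [xi'] and trap its root. *)
  pose e1 := Num.min (e / 2) ((eps - `|k xi|) / 2).
  have e10 : 0 < e1 by rewrite lt_min !divr_gt0 // subr_gt0.
  have e1e : e1 <= e / 2 by rewrite ge_min lexx.
  have e1k : e1 <= (eps - `|k xi|) / 2 by rewrite ge_min lexx orbT.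
  have hp : `|k xi + e1| <= eps by have := ler_normD (k xi) e1; rewrite (gtr0_norm e10); lra.
  have hm : `|k xi - e1| <= eps by have := ler_normB (k xi) e1; rewrite (gtr0_norm e10); lra.
  have pp : 0 < u (z + xi + (k xi + e1) *: N).
    by rewrite -[ltLHS]k2; apply: mono; rewrite ?ltrDl//; [exact: rd|exact: ltW].
  have pm : u (z + xi + (k xi - e1) *: N) < 0.
    by rewrite -[ltRHS]k2; apply: mono; rewrite ?gtrBl//; [exact: rd|exact: ltW].
  have h1 := near_gt (cu _ _ (rd _ xD) hp) pp.
  have h2 := near_lt (cu _ _ (rd _ xD) hm) pm.
  apply: filterS2 h1 h2 => xi' /= p1 p2 xD'.
  have [|c /andP[c1 c2] uc] := root xi' _ _ xD' _ hm hp p2 p1; first by lra.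
  have ce : `|c| < eps by move: hp hm; rewrite !ler_norml ltr_norml => /andP[? ?] /andP[? ?]; apply/andP; split; lra.
  by rewrite -(kU _ _ xD' ce uc) ltr_norml; apply/andP; split; lra.
have cylb x : cylinder z N r eps x -> enorm (x - z) < d.
  move=> xC; have [xD ->] := cylinder_disc NN xC; case: xC => _ xe.
  by apply: inb; [exact: rd|apply: le_trans (ltW xe) _; lra].
exists r, eps, k; split; last by move=> x /cylb /dP[[]].
split; [exact: r0|exact: e0|by move=> x /cylb /inU| | | | exact: kU|exact: kC|].
- by move=> x /cylb /dP[].
- by move=> xi /kP[].
- by move=> xi /kP[].
move=> xi eta s Ne xD; set x0 := chart z N k (xi + s *: eta).
have x0d : enorm (x0 - z) < d by apply: cylb; apply: cylinder_coord => //; case: (kP _ xD).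
have Ux0 := inU _ x0d.
have cD v : {for x0, continuous (fun x => 'D_v u x)}.
  by have [_ Cv] := (su 1).2 v; exact: Cv.1 _ Ux0.
have hq : is_derive s (1 : R) (fun t => k (xi + t *: eta))
    (- ('D_eta u x0 / 'D_N u x0)).
  apply: is_derive_eps => e e'0.
  (* Numerator and denominator of the difference quotient are evaluated at two different
     intermediate points, hence joint continuity on pairs. *)
  have cg : {for (x0, x0), continuous (fun p : V * V => 'D_eta u p.1 / 'D_N u p.2)}.
    apply: continuousM.
      by apply: (@continuous_comp _ _ _ fst (fun x => 'D_eta u x)); [exact: cvg_fst|exact: cD].
    apply: continuousV; first by rewrite gt_eqF//; exact: DN.
    by apply: (@continuous_comp _ _ _ snd (fun x => 'D_N u x)); [exact: cvg_snd|exact: cD].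
  have /cvgrPdist_lt/(_ _ e'0) [[A B]/= [nA nB] AB] := cg.
  have /nbhs_enormP[d3 d30 d3P] : nbhs x0 (A `&` B `&` [set x | enorm (x - z) < d]).
    apply: filterI; first exact: filterI.
    exact: nbhs_enorm_lt.
  have d320 : 0 < d3 / 2 by rewrite divr_gt0.
  have L1 : \forall h \near (0 : R), `|k (xi + (s + h) *: eta) - k (xi + s *: eta)| < d3 / 2 /\
      `|h| * enorm eta < d3 / 2 /\ disc N r (xi + (s + h) *: eta).
    have c1 : {for 0, continuous (fun h : R => xi + (s + h) *: eta)}.
      have -> : (fun h : R => xi + (s + h) *: eta) = (fun h => (xi + s *: eta) + h *: eta).
        by apply/funext => h; rewrite scalerDl addrA.
      exact: line_continuous.
    have h1 : \forall h \near (0 : R), disc N r (xi + (s + h) *: eta) ->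
       `|k (xi + (s + h) *: eta) - k (xi + s *: eta)| < d3 / 2.
      have h0 : nbhs (xi + (s + 0) *: eta) [set y | disc N r y ->
          `|k y - k (xi + s *: eta)| < d3 / 2] by rewrite addr0; exact: kC.
      exact: (c1 _ h0).
    have h2 : \forall h \near (0 : R), disc N r (xi + (s + h) *: eta).
      have xD0 : disc N r (xi + s *: eta + 0 *: eta) by rewrite scale0r addr0.
      apply: filterS (disc_open Ne xD0) => h; by rewrite scalerDl addrA.
    have h3 : \forall h \near (0 : R), `|h| * enorm eta < d3 / 2.
      apply: near_lt; last by rewrite normr0 mul0r.
      by apply: continuousM; [exact: norm_continuous|exact: cst_continuous].
    by apply: filterS3 h1 h2 h3 => h a1 a2 a3; split; [exact: a1|split].
  near=> h.
  have hn0 : h != 0 by near: h; exact: nbhs_dnbhs_neq.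
  have [l1 [l2 l3]] : `|k (xi + (s + h) *: eta) - k (xi + s *: eta)| < d3 / 2 /\
      `|h| * enorm eta < d3 / 2 /\ disc N r (xi + (s + h) *: eta).
    by near: h; exact: nbhs_dnbhs L1.
  set a := k (xi + (s + h) *: eta) - k (xi + s *: eta) in l1 *.
  have P1 c : `|c| <= `|h| -> enorm (x0 + c *: eta - x0) < d3.
    move=> ch; rewrite addrC addKr enormZ; apply: (@le_lt_trans _ _ (`|h| * enorm eta)).
      by rewrite ler_wpM2r// enorm_ge0.
    by apply: (lt_trans l2); lra.
  have P2 c : `|c| <= `|a| -> enorm (x0 + h *: eta + c *: N - x0) < d3.
    move=> ca; rewrite -[x0 + _ + _]addrA [x0 + _]addrC addrK; apply: (le_lt_trans (enormD _ _)).
    rewrite (enormZ h) (enormZ c) eN mulr1; lra.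
  have [|c1 c1h e1] := @MVT_line R V u x0 eta h.
    by move=> t /P1 /d3P [_ /du]; exact: diff_derivable.
  have [|c2 c2a e2] := @MVT_line R V u (x0 + h *: eta) N a.
    by move=> t /P2 /d3P [_ /du]; exact: diff_derivable.
  have E0 : u x0 = 0 by rewrite /x0 /chart; case: (kP _ xD).
  have E1 : u (x0 + h *: eta + a *: N) = 0.
    have -> : x0 + h *: eta + a *: N = chart z N k (xi + (s + h) *: eta).
      rewrite /x0 /chart /a scalerBl scalerDl.
      by rewrite !addrA; apply/rowP => i; rewrite !mxE; ring.
    by rewrite /chart; case: (kP _ l3).
  have [[_ B2] /DN p2] := d3P _ (P2 _ c2a).
  have [[A1 _] _] := d3P _ (P1 _ c1h).
  have := AB (_, _) (conj A1 B2) => /=.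
  have -> : - ('D_eta u x0 / 'D_N u x0) - h^-1 * a =
     - ('D_eta u x0 / 'D_N u x0 - 'D_eta u (x0 + c1 *: eta) / 'D_N u (x0 + h *: eta + c2 *: N)).
    have : h * 'D_eta u (x0 + c1 *: eta) + a * 'D_N u (x0 + h *: eta + c2 *: N) = 0.
      by rewrite -e1 -e2 E0 E1; ring.
    set X := 'D_eta u (x0 + c1 *: eta); set Y := 'D_N u _ in p2 *.
    move=> hX; have -> : a = - (h * X) / Y.
      have Y0 : Y != 0 by rewrite gt_eqF.
      by apply: (mulIf Y0); rewrite mulfVK//; apply/eqP; rewrite -subr_eq0 opprK addrC hX.
    by field; rewrite hn0 !gt_eqF//; exact: DN.
  by rewrite normrN.
have hN : is_derive s (1 : R) (fun t => k (xi + t *: eta) *: N)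
    (- ('D_eta u x0 / 'D_N u x0) *: N).
  have dphi r' : is_diff r' (fun r : R => r *: N) (fun r : R => r *: N) by exact: is_diff_scalel.
  have := is_derive_outer (phi := fun r : R => r *: N) hq.
  by rewrite deriveE// diff_val; exact.
have h1 : is_derive s (1 : R) (fun t : R => z + xi + t *: eta) eta by exact: is_derive_line.
have -> : (fun t => chart z N k (xi + t *: eta)) =
   (fun t : R => z + xi + t *: eta) + (fun t => k (xi + t *: eta) *: N).
  by apply/funext => t; rewrite /chart addrA.
have -> : theta u N eta x0 = eta + - ('D_eta u x0 / 'D_N u x0) *: N.
  rewrite /theta scaleNr; congr (_ - _ *: _).
  rewrite !(derive_ugrad oU su gu)//.
  have g0 := enorm_grad_gt0 oU su gu Ux0.
  have [[_ _]] := dP _ x0d.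
  by move=> /= nN; field; rewrite !gt_eqF.
exact: is_deriveD.
Unshelve. all: by end_near. Qed.

End Chart.

(** * First derivative tests *)

Section DerivativeSign.
Variable R : realType.

Lemma is_derive_gt0 (f : R -> R) (t d : R) : is_derive t (1 : R) f d -> 0 < d ->
  exists2 e : R, 0 < e & forall h, 0 < h -> h < e -> f (t - h) < f t /\ f t < f (t + h).
Proof.
move=> [fd fE] d0.
have C : h^-1 *: ((f \o shift t) (h *: (1 : R)) - f t) @[h --> 0^'] --> d.
  by rewrite -fE; exact: fd.
have := cvgr_gt _ C _ d0 => /= H.
have : \forall h \near (0 : R), h != 0 -> 0 < h^-1 *: ((f \o shift t) (h *: (1 : R)) - f t).
  exact: H.
move=> /nbhs_ballP[e /= e0 eP]; exists e => // h h0 he.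
have q (s : R) : s != 0 -> `|s| < e -> 0 < s^-1 * (f (t + s) - f t).
  move=> s0 se; have := eP s; rewrite -ball_normE /ball_/= sub0r normrN => /(_ se s0).
  by rewrite [s *: 1]/GRing.scale/= mulr1 [s + t]addrC.
split.
  have := q (- h); rewrite oppr_eq0 gt_eqF// normrN gtr0_norm// => /(_ isT he).
  by rewrite invrN mulNr oppr_gt0 pmulr_rlt0 ?invr_gt0// subr_lt0.
by have := q h; rewrite gt_eqF// gtr0_norm// => /(_ isT he); rewrite pmulr_rgt0 ?invr_gt0// subr_gt0.
Qed.

Lemma is_derive_local_min (f : R -> R) (t d : R) : is_derive t (1 : R) f d ->
  (\forall s \near t, f t <= f s) -> d = 0.
Proof.
move=> fd /nbhs_ballP[e /= e0 eP].
have b h : `|h| < e -> f t <= f (t + h).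
  by move=> he; apply: eP; rewrite -ball_normE /ball_/= opprD addNKr normrN.
have half e' : 0 < e' -> exists h, [/\ 0 < h, `|h| < e & h < e'].
  move=> e'0; have m0 : 0 < Num.min e e' by rewrite lt_min e0.
  exists (Num.min e e' / 2); split; first by rewrite divr_gt0.
    rewrite gtr0_norm ?divr_gt0//.
    by apply: (@lt_le_trans _ _ (Num.min e e')); [lra|rewrite ge_min lexx].
  by apply: (@lt_le_trans _ _ (Num.min e e')); [lra|rewrite ge_min lexx orbT].
have [d0|d0|//] := ltgtP d 0.
  have fN : is_derive t (1 : R) (- f) (- d) by exact: is_deriveN.
  have [|e' e'0 e'P] := is_derive_gt0 fN; first by rewrite oppr_gt0.
  have [h [h0 he he']] := half _ e'0.
  by have [_] := e'P h h0 he'; rewrite !fctE/= ltrN2 ltNge b.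
have [e' e'0 e'P] := is_derive_gt0 fd d0.
have [h [h0 he he']] := half _ e'0.
by have [+ _] := e'P h h0 he'; rewrite ltNge b// normrN.
Qed.

End DerivativeSign.

(** * Local defining functions, curves and normals of a hypersurface *)

Section LevelFun.
Variables (R : realType) (n : nat).
Local Notation V := 'rV[R]_n.+1.
Implicit Types (x y z w v N eta : V) (Z : set V).

Record level_fun Z (U : set V) (u : V -> R) : Prop := LevelFun {
  lf_open : open U;
  lf_smooth : smooth_on U u;
  lf_reg : forall q, U q -> exists v, 'D_v u q != 0;
  lf_zero : forall q, U q -> (Z q <-> u q = 0) }.

Lemma hypersurface_level_fun Z z : hypersurface Z -> Z z ->
  exists U u, level_fun Z U u /\ U z.
Proof. by move=> hZ /hZ[U [u [oU Uz su gu zu]]]; exists U, u. Qed.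

Section ChartOfLevel.
Variables (Z U : set V) (u : V -> R) (z : V) (r eps : R) (k : V -> R).
Hypotheses (lf : level_fun Z U u) (Uz : U z) (C : level_chart U u z r eps k).
Local Notation N := (ugrad u z).
Let NN : dot N N = 1 := dot_ugrad (lf_open lf) (lf_smooth lf) (lf_reg lf) Uz.

Lemma level_chart_coord x : Z x -> cylinder z N r eps x ->
  disc N r (tproj N (x - z)) /\ x = chart z N k (tproj N (x - z)).
Proof.
move=> Zx cx; have [d e] := cylinder_disc NN cx; split => //.
have ux : u x = 0 by apply/(lf_zero lf (lc_sub C cx)).
have := lc_uniq C d (h := dot N (x - z)); rewrite -e => /(_ cx.2 ux) ek.
by rewrite /chart -ek.
Qed.

Lemma level_chart_mem xi : disc N r xi -> Z (chart z N k xi) /\ cylinder z N r eps (chart z N k xi).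
Proof.
move=> d; have cx := cylinder_coord z NN d (lc_lt C d); split => //.
by apply/(lf_zero lf (lc_sub C cx)); exact: (lc_root C d).
Qed.

End ChartOfLevel.

Section Theta.
Variables (Z : set V) (U : set V) (u : V -> R).
Hypothesis lf : level_fun Z U u.
Local Notation nu := (ugrad u).
Let oU := lf_open lf.
Let su := lf_smooth lf.
Let gu := lf_reg lf.

Lemma theta_normal N eta x : dot (nu x) N != 0 -> dot (nu x) (theta u N eta x) = 0.
Proof. by move=> h; rewrite /theta dotBr dotZr divfK// subrr. Qed.

Lemma theta_base z eta : U z -> dot (nu z) eta = 0 -> theta u (nu z) eta z = eta.
Proof. by move=> Uz h; rewrite /theta h mul0r scale0r subr0. Qed.

Lemma theta_ge N eta x : dot N eta = 0 -> dot eta eta <= dot (theta u N eta x) (theta u N eta x).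
Proof.
move=> h; rewrite /theta; set q := _ / _; rewrite !dotE (dotC eta N) h.
rewrite !(mulr0, oppr0, addr0, add0r) lerDl mulrN opprK.
by rewrite mulrA -expr2 mulr_ge0 ?sqr_ge0 ?dotvv_ge0.
Qed.

Lemma theta_differentiable N eta x : U x -> dot (nu x) N != 0 ->
  differentiable (theta u N eta) x.
Proof.
move=> Ux h; rewrite /theta.
have dn := differentiable_ugrad oU su gu Ux.
apply: differentiableB; first exact: differentiable_cst.
apply: differentiableZl; apply: differentiableM.
  by apply: differentiable_dot => //; exact: differentiable_cst.
by apply: differentiableV => //; apply: differentiable_dot => //; exact: differentiable_cst.
Qed.

(** With [eta] and [N] constant, the derivative of [theta] is a multiple of [N]. The multiple is
    read off by differentiating [dot nu theta = 0], which brings in the second fundamental form. *)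
Lemma theta_derive N eta x v w : U x -> dot (nu x) N != 0 ->
  dot ('D_v (theta u N eta) x) w =
  - (dot ('D_v nu x) (theta u N eta x) / dot (nu x) N) * dot N w.
Proof.
move=> Ux h.
have dn := differentiable_ugrad oU su gu Ux.
have hn : is_derive x v nu ('D_v nu x) by apply: derivableP; exact: diff_derivable.
have dN e : differentiable (fun y => dot (nu y) e) x.
  by apply: differentiable_dot => //; exact: differentiable_cst.
pose q y := dot (nu y) eta / dot (nu y) N.
have dq : differentiable q x by apply: differentiableM => //; exact: differentiableV.
have E : 'D_v (theta u N eta) x = - 'D_v q x *: N.
  have hq : is_derive x v (fun y => q y *: N) ('D_v q x *: N).
    have dphi r' : is_diff r' (fun r : R => r *: N) (fun r : R => r *: N) by exact: is_diff_scalel.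
    have := is_derive_outer (phi := fun r : R => r *: N) (derivableP (@diff_derivable _ _ _ q x v dq)).
    by rewrite deriveE// diff_val; exact.
  have hc : is_derive x v (cst eta) (0 : V) by exact: is_derive_cst.
  have [_] := is_deriveB hc hq.
  by rewrite sub0r -scaleNr => <-.
rewrite E dotZl; congr (_ * _); congr (- _).
have ht : is_derive x v (theta u N eta) ('D_v (theta u N eta) x).
  by apply: derivableP; apply: diff_derivable; exact: theta_differentiable.
have hz : \forall y \near x, 0 = dot (nu y) (theta u N eta y).
  have cN : {for x, continuous (fun y => dot (nu y) N)} by exact: differentiable_continuous.
  have : \forall y \near x, dot (nu y) N != 0.
    by move: h; rewrite neq_lt => /orP[/(near_lt cN)|/(near_gt cN)]; apply: filterS => y hy;
       rewrite neq_lt hy ?orbT.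
  by apply: filterS => y hy; rewrite theta_normal.
have [_] := is_derive_dot hn ht.
rewrite -(near_eq_derive _ hz) derive_cst E dotZr => /esym/eqP.
rewrite mulNr subr_eq0 => /eqP ->.
by rewrite mulfK.
Qed.

(* 'D_(theta x) nu x, written as a sum to make it differentiable in x. *)
Definition shape_op N eta x : V :=
  \sum_(i < n.+1) theta u N eta x 0 i *: 'D_(delta_mx 0 i) nu x.

Lemma shape_opE N eta x : U x -> shape_op N eta x = 'D_(theta u N eta x) nu x.
Proof. by move=> Ux; rewrite derive_dir_sum//; exact: (differentiable_ugrad oU su gu). Qed.

Lemma shape_op_differentiable N eta x : U x -> dot (nu x) N != 0 ->
  differentiable (shape_op N eta) x.
Proof.
move=> Ux h.
have -> : shape_op N eta = \sum_(i < n.+1) (fun y => theta u N eta y 0 i *: 'D_(delta_mx 0 i) nu y).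
  by apply/funext => y; rewrite fct_sumE.
apply: differentiable_sum => i; apply: differentiable_rV => j.
have -> : (fun y => (theta u N eta y 0 i *: 'D_(delta_mx 0 i) nu y) 0 j) =
   (fun y => theta u N eta y 0 i) * (fun y => ('D_(delta_mx 0 i) nu y) 0 j).
  by apply/funext => y; rewrite mxE.
apply: differentiableM; apply: differentiable_coordr; first exact: theta_differentiable.
exact: (@differentiable_derive_ugrad _ _ U u oU su gu x _ Ux).
Qed.

(** Coordinate lines of a chart. The velocity is given by [theta] at all small times, not only at 0,
    which is what allows a second differentiation along the curve. *)
Lemma curve_exists z eta : U z -> Z z -> dot (nu z) eta = 0 ->
  exists g : R -> V, [/\ g 0 = z, theta u (nu z) eta z = eta &
    \forall s \near (0 : R), [/\ U (g s), Z (g s), 0 < dot (nu (g s)) (nu z) &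
      is_derive s (1 : R) g (theta u (nu z) eta (g s))]].
Proof.
move=> Uz Zz ne.
have [r [eps [k [C _]]]] := level_chart_exists oU su gu Uz ((lf_zero lf Uz).1 Zz) filterT.
have NN := dot_ugrad oU su gu Uz.
exists (fun s => chart z (nu z) k (0 + s *: eta)).
have D0 : disc (nu z) r 0 by exact: (disc0 _ (lc_r0 C)).
have k0 : k 0 = 0.
  by rewrite -(lc_uniq C D0 (h := 0))// ?normr0 ?(lc_eps0 C)// scale0r !addr0; exact: (lf_zero lf Uz).1.
split; [by rewrite scale0r addr0 /chart k0 scale0r !addr0|exact: theta_base|].
have D0' : disc (nu z) r (0 + 0 *: eta) by rewrite scale0r addr0.
apply: filterS (disc_open ne D0') => s Ds.
have cyl := cylinder_coord z NN Ds (lc_lt C Ds).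
have Us := lc_sub C cyl.
split => //; first by apply/(lf_zero lf Us); exact: (lc_root C Ds).
  exact: (lc_pos C cyl).
exact: (lc_derive C ne Ds).
Qed.

End Theta.

(** One defining function suffices: at a point of [Z] any two have parallel gradients, by
    [level_fun_parallel], and [normal_toE] passes from one to another. *)
Definition normal_to Z z w : Prop := exists U u,
  [/\ level_fun Z U u, U z & w = dot w (ugrad u z) *: ugrad u z].

Lemma tproj_dot_self N w : dot N N = 1 -> dot w (tproj N w) = dot (tproj N w) (tproj N w).
Proof. by move=> NN; rewrite /tproj !dotE NN (dotC w N); ring. Qed.

Lemma normal_of_tangents N w : dot N N = 1 ->
  (forall eta, dot N eta = 0 -> dot w eta = 0) -> w = dot w N *: N.
Proof.
move=> NN H; have : dot w (tproj N w) = 0 by apply: H; rewrite /tproj !dotE NN mulr1 subrr.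
rewrite tproj_dot_self// => /eqP; rewrite dotvv_eq0 /tproj subr_eq0 => /eqP {1}->.
by rewrite dotC.
Qed.

(** Curves in [Z] obtained from the first function also lie in the zero set of the second, so both
    gradients annihilate the same tangent vectors. *)
Lemma level_fun_parallel Z U u U' u' z : level_fun Z U u -> level_fun Z U' u' ->
  U z -> U' z -> Z z -> ugrad u' z = dot (ugrad u' z) (ugrad u z) *: ugrad u z.
Proof.
move=> lf lf' Uz U'z Zz.
have NN := dot_ugrad (lf_open lf) (lf_smooth lf) (lf_reg lf) Uz.
apply: normal_of_tangents => // eta ne.
have [g [g0 t0 gP]] := curve_exists lf Uz Zz ne.
have [_ _ _] := nbhs_singleton gP; rewrite g0 t0 => g'.
have cg : {for 0, continuous g} by apply: differentiable_continuous; apply/derivable1_diffP; case: g'.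
have hU' : \forall s \near (0 : R), U' (g s).
  have h0 : nbhs (g 0) U' by rewrite g0; apply: open_nbhs_nbhs; split => //; exact: lf_open lf'.
  exact: (cg _ h0).
have hz : \forall s \near (0 : R), 0 = (u' \o g) s.
  by apply: filterS2 gP hU' => s [_ Zs _ _] U's /=; apply/esym/(lf_zero lf').
have du' : differentiable u' (g 0) by rewrite g0; exact: (level_differentiable (lf_open lf') (lf_smooth lf')).
have [_] := is_derive_comp g' du'.
rewrite -(near_eq_derive _ hz) derive_cst g0.
rewrite (derive_ugrad (lf_open lf') (lf_smooth lf') (lf_reg lf'))// => /esym/eqP.
by rewrite mulf_eq0 gt_eqF ?(enorm_grad_gt0 (lf_open lf') (lf_smooth lf') (lf_reg lf'))//= => /eqP.
Qed.

(** The two unit normals differ by a sign at most; the absolute value makes the support function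
    [|dot nu (x - y)|] independent of the defining function. *)
Lemma level_fun_dot_abs Z U u U' u' z v : level_fun Z U u -> level_fun Z U' u' ->
  U z -> U' z -> Z z -> `|dot (ugrad u' z) v| = `|dot (ugrad u z) v|.
Proof.
move=> lf lf' Uz U'z Zz; have E := level_fun_parallel lf lf' Uz U'z Zz.
have n1 := dot_ugrad (lf_open lf) (lf_smooth lf) (lf_reg lf) Uz.
have n2 := dot_ugrad (lf_open lf') (lf_smooth lf') (lf_reg lf') U'z.
set c := dot (ugrad u' z) (ugrad u z) in E.
move: n2; rewrite E !dotE n1 mulr1 => cc.
have c2 : c ^+ 2 = 1 by rewrite expr2.
have := sqrf_eq1 c; rewrite c2 eqxx normrM => /esym/orP[]/eqP ->; rewrite ?normrN normr1 mul1r//.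
Qed.

Lemma normal_toE Z U u z w : level_fun Z U u -> U z -> Z z -> normal_to Z z w ->
  w = dot w (ugrad u z) *: ugrad u z.
Proof.
move=> lf Uz Zz [U' [u' [lf' U'z ->]]].
have E := level_fun_parallel lf lf' Uz U'z Zz.
have n1 := dot_ugrad (lf_open lf) (lf_smooth lf) (lf_reg lf) Uz.
set a := dot w _; set c := dot (ugrad u' z) (ugrad u z) in E.
by rewrite E !dotZl n1 mulr1 scalerA.
Qed.

Lemma normal_to_ugrad Z U u z a : level_fun Z U u -> U z -> normal_to Z z (a *: ugrad u z).
Proof.
move=> lf Uz; exists U, u; split => //.
by rewrite dotZl (dot_ugrad (lf_open lf) (lf_smooth lf) (lf_reg lf))// mulr1.
Qed.

Lemma local_min_normal Z z y : hypersurface Z -> Z z ->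
  (\forall x \near z, Z x -> dot (y - z) (y - z) <= dot (y - x) (y - x)) ->
  normal_to Z z (y - z).
Proof.
move=> hZ Zz hmin; have [U [u [lf Uz]]] := hypersurface_level_fun hZ Zz.
exists U, u; split => //.
have NN := dot_ugrad (lf_open lf) (lf_smooth lf) (lf_reg lf) Uz.
apply: normal_of_tangents => // eta ne.
have [g [g0 t0 gP]] := curve_exists lf Uz Zz ne.
have [_ _ _] := nbhs_singleton gP; rewrite g0 t0 => g'.
have cg : {for 0, continuous g} by apply: differentiable_continuous; apply/derivable1_diffP; case: g'.
have hm : \forall s \near (0 : R), Z (g s) ->
    dot (y - z) (y - z) <= dot (y - g s) (y - g s).
  have h0 : nbhs (g 0) [set x | Z x -> dot (y - z) (y - z) <= dot (y - x) (y - x)] by rewrite g0.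
  exact: (cg _ h0).
have hmn : \forall s \near (0 : R), dot (y - g 0) (y - g 0) <= dot (y - g s) (y - g s).
  by apply: filterS2 gP hm => s [_ Zs _ _]; rewrite g0; exact.
have hd : is_derive (0 : R) (1 : R) (fun s => y - g s) (0 - eta).
  have hc : is_derive (0 : R) (1 : R) (cst y) (0 : V) by exact: is_derive_cst.
  exact: (is_deriveB hc g').
have := is_derive_local_min (is_derive_dot hd hd) hmn.
by rewrite g0 sub0r dotNl dotNr (dotC eta) -opprD => /eqP; rewrite oppr_eq0 -mulr2n mulrn_eq0/= => /eqP.
Qed.

End LevelFun.

(** * The squared distance on a hypersurface of bounded curvature *)

Section Convex1D.
Variable R : realType.
Variables (F F' : R -> R).
Hypothesis dF : forall s : R, 0 <= s -> s <= 1 -> is_derive s (1 : R) F (F' s).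

Let MVTF (a b : R) : 0 <= a -> a < b -> b <= 1 ->
  exists2 c, a < c < b & F b - F a = F' c * (b - a).
Proof.
move=> a0 ab b1.
have h (c : R) : a <= c -> c <= b -> is_derive c (1 : R) F (F' c).
  by move=> ac cb; apply: dF; [exact: le_trans ac|exact: le_trans b1].
have cf : {within `[a, b], continuous F}.
  by apply: derivable_within_continuous => c; rewrite in_itv/= => /andP[ac cb]; case: (h c ac cb).
have h' (c : R) : c \in `]a, b[ -> is_derive c (1 : R) F (F' c).
  by rewrite in_itv/= => /andP[ac cb]; apply: h; exact: ltW.
by have [c cab e] := MVT ab h' cf; exists c.
Qed.

(** Mean slopes over [[0, s]] and [[s, 1]] are values of [F'] at ordered points. *)
Lemma monotone_derive_convex (s : R) :
  (forall a b : R, 0 <= a -> a < b -> b <= 1 -> F' a <= F' b) ->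
  0 <= s -> s <= 1 -> F s <= (1 - s) * F 0 + s * F 1.
Proof.
move=> mF s0 s1.
have [->|sn0] := eqVneq s 0; first by rewrite subr0 mul1r mul0r addr0.
have [->|sn1] := eqVneq s 1; first by rewrite subrr mul1r mul0r add0r.
have sp : 0 < s by rewrite lt_def sn0.
have sl : s < 1 by rewrite lt_neqAle sn1.
have [c1 /andP[c10 c1s] e1] := MVTF (lexx 0) sp s1.
have [c2 /andP[c2s c21] e2] := MVTF s0 sl (lexx 1).
have := mF c1 c2 (ltW c10) (lt_trans c1s c2s) (ltW c21).
rewrite subr0 in e1.
move=> h; have : F' c1 * s * (1 - s) <= F' c2 * (1 - s) * s.
  by rewrite -!mulrA (mulrC (1 - s)) ler_wpM2r// mulr_ge0// subr_ge0.
rewrite -e1 -e2; lra.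
Qed.

Lemma strict_derive_lt : F' 0 = 0 -> (forall b : R, 0 < b -> b <= 1 -> F' 0 < F' b) -> F 0 < F 1.
Proof.
move=> F0 mF; have [c /andP[c0 c1]] := MVTF (lexx 0) ltr01 (lexx 1).
rewrite subr0 mulr1 => e; rewrite -subr_gt0 e.
by have := mF c c0 (ltW c1); rewrite F0.
Qed.

End Convex1D.

Section LocalGeometry.
Variables (R : realType) (n : nat).
Local Notation V := 'rV[R]_n.+1.
Implicit Types (x z w v N eta xi : V) (Z : set V).

Definition sqdist (y x : V) : R := dot (x - y) (x - y).

Lemma sqdist_ge0 y x : 0 <= sqdist y x.
Proof. exact: dotvv_ge0. Qed.

Lemma sqdistE y x : sqdist y x = enorm (x - y) ^+ 2.
Proof. by rewrite sqr_enorm. Qed.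

Lemma sqdist_continuous y (T : topologicalType) (g : T -> V) (t : T) :
  {for t, continuous g} -> {for t, continuous (fun s => sqdist y (g s))}.
Proof.
move=> cg; have c : {for t, continuous (fun s => g s - y)}.
  by apply: continuousB => //; exact: cst_continuous.
exact: dot_continuous.
Qed.

Lemma sqdist_derive y (g : R -> V) (s : R) v : is_derive s (1 : R) g v ->
  is_derive s (1 : R) (fun t => sqdist y (g t)) (2 * dot v (g s - y)).
Proof.
move=> dg; have hc : is_derive s (1 : R) (cst y) (0 : V) by exact: is_derive_cst.
have h := is_deriveB dg hc; rewrite subr0 in h.
apply: is_derive_eq; first exact: (is_derive_dot h h).
by rewrite (dotC _ v) -mulr2n mulr_natl.
Qed.

Lemma sff_tangent_le Z U u kap x v w : level_fun Z U u -> sff_le Z kap -> U x -> Z x ->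
  dot (ugrad u x) v = 0 -> dot (ugrad u x) w = 0 ->
  `|dot ('D_v (ugrad u) x) w| <= kap * (enorm v * enorm w).
Proof.
move=> [oU su gu zu] hk Ux Zx nv nw; apply: sff_bound => //.
  exact: (differentiable_ugrad oU su gu).
by apply: hk => //; exact: (unit_normal_near_ugrad oU su gu zu).
Qed.

Variables (Z : set V) (kap : R) (y : V).
Hypothesis kap0 : 0 < kap.
Hypothesis hk : sff_le Z kap.

Section Base.
Variables (U : set V) (u : V -> R) (z : V).
Hypothesis lf : level_fun Z U u.
Hypotheses (Uz : U z) (Zz : Z z).
Local Notation nu := (ugrad u).
Local Notation N := (ugrad u z).
Let oU := lf_open lf.
Let su := lf_smooth lf.
Let gu := lf_reg lf.
Let NN : dot N N = 1 := dot_ugrad oU su gu Uz.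
Hypothesis hz : kap * `|dot N (z - y)| <= 85 / 100.

Let F k xi eta s := sqdist y (chart z N k (xi + s *: eta)).
Let F' k xi eta s :=
  2 * dot (theta u N eta (chart z N k (xi + s *: eta))) (chart z N k (xi + s *: eta) - y).

Let disc_seg r xi eta (s : R) : disc N r xi -> disc N r (xi + eta) -> 0 <= s -> s <= 1 ->
  disc N r (xi + s *: eta).
Proof.
move=> d1 d2 s0 s1; have := @disc_convex _ _ N r xi (xi + eta) s.
by rewrite addrAC subrr add0r s0 s1; exact.
Qed.

(* In the chart the Hessian of the squared distance to [y] is
   2 (|theta|^2 - A(theta, theta) <N, x - y> / <nu, N>), which is positive
   because |A| |<N, x - y>| < 1 near [z]. *)
Lemma convex_chart O : nbhs z O -> exists r eps k,
  [/\ level_chart U u z r eps k, cylinder z N r eps `<=` O &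
   forall xi eta, dot N eta = 0 -> disc N r xi -> disc N r (xi + eta) ->
   [/\ forall s : R, 0 <= s -> s <= 1 -> is_derive s (1 : R) (F k xi eta) (F' k xi eta s),
       forall a b : R, 0 <= a -> a < b -> b <= 1 -> F' k xi eta a <= F' k xi eta b &
       eta != 0 -> forall a b : R, 0 <= a -> a < b -> b <= 1 -> F' k xi eta a < F' k xi eta b]].
Proof.
move=> Oz.
have cN : {for z, continuous (fun x => dot (nu x) N)}.
  apply: dot_continuous; last exact: cst_continuous.
  exact: (differentiable_continuous (differentiable_ugrad oU su gu Uz)).
have cy : {for z, continuous (fun x => kap * `|dot N (x - y)|)}.
  apply: continuousM; first exact: cst_continuous.
  apply: (@continuous_comp _ _ _ (fun x => dot N (x - y)) Num.Def.normr); last exact: norm_continuous.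
  apply: dot_continuous; first exact: cst_continuous.
  by apply: continuousB; [exact: cvg_id|exact: cst_continuous].
(* The curvature term is then at most [0.9 / 0.95 < 0.95] times [|theta|^2], which leaves a positive
   Hessian; the bound [85 / 100] at [z] leaves room for a neighbourhood where [9 / 10] holds. *)
have h1 : \forall x \near z, 95 / 100 < dot (nu x) N by apply: (near_gt cN); rewrite NN; lra.
have h2 : \forall x \near z, kap * `|dot N (x - y)| < 9 / 10 by apply: (near_lt cy); apply: le_lt_trans hz _; lra.
have h12 : nbhs z (O `&` [set x | 95 / 100 < dot (nu x) N /\ kap * `|dot N (x - y)| < 9 / 10]).
  by apply: filterI => //; exact: filterI h1 h2.
have [r [eps [k [C CO]]]] := level_chart_exists oU su gu Uz ((lf_zero lf Uz).1 Zz) h12.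
exists r, eps, k; split => //; first by move=> x /CO[].
move=> xi eta ne d1 d2.
have dF (s : R) : 0 <= s -> s <= 1 -> is_derive s (1 : R) (F k xi eta) (F' k xi eta s).
  by move=> s0 s1; apply: sqdist_derive; apply: (lc_derive C ne); exact: disc_seg.
pose g (s : R) := chart z N k (xi + s *: eta).
pose th (s : R) := theta u N eta (g s).
pose F2 (s : R) := 2 * (dot (th s) (th s) -
   dot ('D_(th s) nu (g s)) (th s) / dot (nu (g s)) N * dot N (g s - y)).
have inC (s : R) : 0 <= s -> s <= 1 -> cylinder z N r eps (g s).
  by move=> s0 s1; have D := disc_seg d1 d2 s0 s1; exact: (cylinder_coord z NN D (lc_lt C D)).
have Zg (s : R) : 0 <= s -> s <= 1 -> U (g s) /\ Z (g s).
  move=> s0 s1; have Ug := lc_sub C (inC s s0 s1); split => //.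
  by apply/(lf_zero lf Ug); apply: (lc_root C); exact: disc_seg.
have nN (s : R) : 0 <= s -> s <= 1 -> dot (nu (g s)) N != 0.
  by move=> s0 s1; rewrite gt_eqF//; apply: (lc_pos C); exact: inC.
have dF' (s : R) : 0 <= s -> s <= 1 -> is_derive s (1 : R) (F' k xi eta) (F2 s).
  move=> s0 s1; have D := disc_seg d1 d2 s0 s1; have [Ug _] := Zg s s0 s1.
  have dg := lc_derive C ne D.
  have dt := theta_differentiable lf eta Ug (nN s s0 s1).
  have h3 := is_derive_comp dg dt.
  have hc : is_derive s (1 : R) (cst y) (0 : V) by exact: is_derive_cst.
  have h4 := is_deriveB dg hc; rewrite subr0 in h4.
  have h5 := is_deriveZ 2 (is_derive_dot h3 h4).
  apply: (is_derive_eq h5).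
  rewrite /F2 [in LHS]/GRing.scale/=; congr (2 * _).
  rewrite (theta_derive lf _ _ _ Ug (nN s s0 s1)) mulNr addrC; congr (_ - _).
have F2ge (s : R) : 0 <= s -> s <= 1 -> dot eta eta / 100 <= F2 s.
  move=> s0 s1; have [Ug Zgs] := Zg s s0 s1.
  have [_ [p1 p2]] := CO _ (inC s s0 s1).
  have tt : dot (nu (g s)) (th s) = 0 by apply: theta_normal; exact: nN.
  have := sff_tangent_le lf hk Ug Zgs tt tt; rewrite -expr2 sqr_enorm => b1.
  have b0 : dot eta eta <= dot (th s) (th s) by exact: theta_ge.
  have b00 := dotvv_ge0 (th s).
  rewrite /F2; set A := dot ('D__ _ _) _ in b1 *; set T := dot (th s) (th s) in b0 b00 b1 *.
  set q := dot (nu (g s)) N in p1 *; set l := dot N _ in p2 *.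
  have q0 : 0 < q by lra.
  have : `|A / q * l| <= 95 / 100 * T.
    rewrite normrM normrM normfV (gtr0_norm q0) mulrAC ler_pdivrMr//.
    apply: (@le_trans _ _ (kap * T * `|l|)); first by rewrite ler_wpM2r.
    rewrite mulrAC; apply: (@le_trans _ _ (9 / 10 * T)).
      by rewrite ler_wpM2r// ltW.
    have : 95 / 100 * T * (95 / 100) <= 95 / 100 * T * q by rewrite ler_wpM2l ?mulr_ge0// ltW.
    lra.
  by rewrite ler_norml => /andP[_]; lra.
have key (a b : R) : 0 <= a -> a < b -> b <= 1 -> exists2 c, dot eta eta / 100 <= c & F' k xi eta b - F' k xi eta a = c * (b - a).
  move=> a0 ab b1.
  have h (c : R) : a <= c -> c <= b -> is_derive c (1 : R) (F' k xi eta) (F2 c).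
    by move=> ac cb; apply: dF'; [exact: le_trans ac|exact: le_trans b1].
  have cf : {within `[a, b], continuous (F' k xi eta)}.
    by apply: derivable_within_continuous => c; rewrite in_itv/= => /andP[ac cb]; case: (h c ac cb).
  have h' (c : R) : c \in `]a, b[ -> is_derive c (1 : R) (F' k xi eta) (F2 c).
    by rewrite in_itv/= => /andP[ac cb]; apply: h; exact: ltW.
  have [c cab e] := MVT ab h' cf; exists (F2 c) => //.
  move: cab; rewrite in_itv/= => /andP[ac cb].
  by apply: F2ge; [exact: le_trans (ltW ac)|exact: le_trans (ltW cb) b1].
split => //.
- move=> a b a0 ab b1; have [c c0 e] := key a b a0 ab b1.
  rewrite -subr_ge0 e mulr_ge0 ?subr_ge0 ?(ltW ab)//.
  by apply: le_trans c0; rewrite divr_ge0// dotvv_ge0.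
- move=> e0 a b a0 ab b1; have [c c0 e] := key a b a0 ab b1.
  rewrite -subr_gt0 e mulr_gt0 ?subr_gt0//.
  by apply: lt_le_trans c0; rewrite divr_gt0// dotvv_gt0.
Qed.

End Base.
End LocalGeometry.

Section LocalGeometry.
Variables (R : realType) (n : nat).
Local Notation V := 'rV[R]_n.+1.
Implicit Types (x z w v N eta xi : V) (Z : set V).

Lemma path_connected_sublevel (T : topologicalType) (S : set T) (p0 : T)
    (gam : T -> R -> T) : S p0 ->
  (forall p, S p -> [/\ gam p 0 = p0, gam p 1 = p,
     forall s : R, 0 <= s -> s <= 1 -> S (gam p s) &
     {within `[0, 1], continuous (gam p)}]) -> connected S.
Proof.
move=> S0 H.
have -> : S = \bigcup_(p in S) (gam p @` `[0, 1]).
  apply/seteqP; split => [p Sp|q [p Sp [s]]].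
    by exists p => //; have [_ g1 _ _] := H p Sp; exists 1 => //; rewrite /= in_itv/= ler01 lexx.
  by rewrite /= in_itv/= => /andP[s0 s1] <-; have [_ _ h _] := H p Sp; exact: h.
apply: bigcup_connected.
  exists p0 => p Sp; have [g0 _ _ _] := H p Sp; exists 0 => //.
  by rewrite /= in_itv/= lexx ler01.
move=> p Sp; have [_ _ _ c] := H p Sp.
by apply: connected_continuous_connected => //; exact: segment_connected.
Qed.

Variables (Z : set V) (kap : R) (y : V).
Hypothesis kap0 : 0 < kap.
Hypothesis hk : sff_le Z kap.

Section Base.
Variables (U : set V) (u : V -> R) (z : V).
Hypothesis lf : level_fun Z U u.
Hypotheses (Uz : U z) (Zz : Z z).
Local Notation nu := (ugrad u).
Local Notation N := (ugrad u z).
Let oU := lf_open lf.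
Let su := lf_smooth lf.
Let gu := lf_reg lf.
Let NN : dot N N = 1 := dot_ugrad oU su gu Uz.
Hypothesis hz : kap * `|dot N (z - y)| <= 85 / 100.
Local Notation f := (sqdist y).
Local Notation E x := (kap * `|dot (nu x) (x - y)| - 6 / 10 * kap ^+ 2 * f x).

(* Along the curves of initial direction -(z - y)^T both kap^2 f/2 and
   6/10 kap^2 f +- kap <nu, x - y> decrease, since the derivative of
   <nu, x - y> is A applied to the tangential part of x - y. *)
Let descent_nbhs eta : eta = - tproj N (z - y) -> eta != 0 ->
  \forall x \near z, [/\ U x &
   forall sg : R, `|sg| = 1 ->
   6 / 10 * kap ^+ 2 * (2 * dot (theta u N eta x) (x - y)) +
     sg * kap * dot (shape_op u N eta x) (x - y) < 0].
Proof.
move=> Ee e0.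
have ne : dot N eta = 0 by rewrite Ee dotNr dot_tproj ?oppr0.
have N0 : dot N N != 0 by rewrite NN oner_neq0.
have ct : {for z, continuous (theta u N eta)}.
  exact: (differentiable_continuous (theta_differentiable lf _ Uz N0)).
have cs : {for z, continuous (shape_op u N eta)}.
  exact: (differentiable_continuous (shape_op_differentiable lf _ Uz N0)).
have cx : {for z, continuous (fun x => x - y)}.
  by apply: continuousB; [exact: cvg_id|exact: cst_continuous].
have tz : theta u N eta z = eta by exact: theta_base.
have dey : dot eta (z - y) = - dot eta eta.
  by rewrite {1 2 3}Ee dotNl dotNr dotNl opprK (dotC (tproj _ _)) tproj_dot_self.
have bs : `|dot (shape_op u N eta z) (z - y)| <= kap * dot eta eta.
  rewrite (shape_opE lf)// tz.
  have -> : dot ('D_eta nu z) (z - y) = dot ('D_eta nu z) (- eta).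
    have dN : dot ('D_eta nu z) N = 0 by apply: dot_derive_ugrad oU su gu _ _ _.
    by move: dN; set d := 'D_eta nu z => dN; rewrite Ee opprK /tproj (dotBr d (z - y)) dotZr dN mulr0 subr0.
  have := sff_tangent_le lf hk Uz Zz ne (w := - eta).
  by rewrite dotNr ne oppr0 enormN -expr2 sqr_enorm; exact.
have ee : 0 < dot eta eta by rewrite dotvv_gt0.
have k2 : 0 < kap ^+ 2 by rewrite exprn_gt0.
have Hs (sg : R) : `|sg| = 1 -> \forall x \near z,
   6 / 10 * kap ^+ 2 * (2 * dot (theta u N eta x) (x - y)) +
     sg * kap * dot (shape_op u N eta x) (x - y) < 0.
  move=> s1; apply: near_lt.
    apply: continuousD; apply: continuousM; try exact: cst_continuous.
      by apply: continuousM; [exact: cst_continuous|exact: dot_continuous].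
    exact: dot_continuous.
  rewrite tz dey.
  have : `|sg * kap * dot (shape_op u N eta z) (z - y)| <= kap ^+ 2 * dot eta eta.
    rewrite normrM normrM s1 mul1r (gtr0_norm kap0) expr2 -mulrA.
    by rewrite ler_wpM2l// ltW.
  rewrite ler_norml => /andP[_ b].
  have : 0 < kap ^+ 2 * dot eta eta by rewrite mulr_gt0.
  move: b; set A := kap ^+ 2 in k2 *; set B := dot eta eta; set D := dot (shape_op _ _ _ _) _; lra.
have H1 := Hs 1 (normr1 R).
have H2 : \forall x \near z,
   6 / 10 * kap ^+ 2 * (2 * dot (theta u N eta x) (x - y)) +
     (-1) * kap * dot (shape_op u N eta x) (x - y) < 0 by apply: Hs; rewrite normrN normr1.
have HU : \forall x \near z, U x by exact: open_nbhs_nbhs.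
apply: filterS3 HU H1 H2 => x Ux x1 x2; split => // sg s1.
have : sg ^+ 2 = 1 by rewrite -real_normK ?num_real// s1 expr1n.
by move/eqP; rewrite sqrf_eq1 => /orP[]/eqP ->.
Qed.

(** Local input of the induction over levels. Convexity in the chart gives the first three clauses.
    The last one transports [E] upwards: curves of direction [- tproj N (z - y)] lead from every
    point near [z] to a point below the level of [z], and [E] does not decrease on the way. The
    weight [6 / 10] makes this work: at [z] the distance term contributes [- 1.2 kap^2 |eta|^2], the
    second fundamental form at most [kap^2 |eta|^2]. *)
Lemma local_structure O : nbhs z O -> exists V' : set V,
  [/\ open V', V' z, V' `<=` O `&` U &
  [/\ forall c : R, connected (Z `&` V' `&` [set x | f x < c]),
      forall p q, Z p -> V' p -> Z q -> V' q -> f q < f p ->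
        closure (Z `&` V' `&` [set x | f x < f p]) p,
      normal_to Z z (y - z) -> forall x, Z x -> V' x -> x != z -> f z < f x &
      (exists q, [/\ Z q, V' q & f q < f z]) ->
      exists V1 : set V, [/\ open V1, V1 z, V1 `<=` V' &
        forall x, Z x -> V1 x -> exists q, [/\ Z q, V' q, f q < f z & E x <= E q]]]].
Proof.
move=> Oz; pose w := tproj N (z - y).
(* If [w = 0] there is no descent direction, and any neighbourhood serves as [Q]. *)
have [Q Qz QP] : exists2 Q : set V, nbhs z Q & - w != 0 -> forall x, Q x ->
    forall sg : R, `|sg| = 1 ->
   6 / 10 * kap ^+ 2 * (2 * dot (theta u N (- w) x) (x - y)) +
     sg * kap * dot (shape_op u N (- w) x) (x - y) < 0.
  have [->|w0] := eqVneq (- w) 0; first by exists setT; [exact: filterT|].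
  by exists [set x | U x /\ forall sg : R, `|sg| = 1 ->
   6 / 10 * kap ^+ 2 * (2 * dot (theta u N (- w) x) (x - y)) +
     sg * kap * dot (shape_op u N (- w) x) (x - y) < 0];
    [apply: filterS (descent_nbhs erefl w0) => x []|move=> _ x []].
have OQ : nbhs z (O `&` Q) by exact: filterI.
have [r [eps [k [C CO CV]]]] := convex_chart hk lf Uz Zz hz OQ.
have r0 := lc_r0 C.
pose g xi eta (s : R) := chart z N k (xi + s *: eta).
have coordP := level_chart_coord lf Uz C; have chartP := level_chart_mem lf Uz C.
have seg xi xi' (s : R) : disc N r xi -> disc N r xi' -> 0 <= s -> s <= 1 -> disc N r (xi + s *: (xi' - xi)).
  by move=> d1 d2 s0 s1; apply: disc_convex => //; rewrite s0.
have gder xi eta (s : R) : dot N eta = 0 -> disc N r (xi + s *: eta) -> {for s, continuous (g xi eta)}.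
  move=> ne d; apply: differentiable_continuous; apply/derivable1_diffP.
  by case: (lc_derive C ne d).
have cvx xi xi' (s : R) : disc N r xi -> disc N r xi' -> 0 <= s -> s <= 1 ->
    f (g xi (xi' - xi) s) <= (1 - s) * f (chart z N k xi) + s * f (chart z N k xi').
  move=> d1 d2 s0 s1.
  have ne : dot N (xi' - xi) = 0 by rewrite dotBr d1.1 d2.1 subrr.
  have d2' : disc N r (xi + (xi' - xi)) by rewrite addrC subrK.
  have [dF mF _] := CV xi (xi' - xi) ne d1 d2'.
  have := monotone_derive_convex dF mF s0 s1.
  by rewrite scale0r addr0 scale1r [xi + (xi' - xi)]addrC subrK.
have k00 : chart z N k 0 = z.
  have := coordP z Zz (cylinder_center _ _ r0 (lc_eps0 C)).
  by rewrite subrr /tproj dot0r scale0r subrr => -[].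
have V4 : normal_to Z z (y - z) -> forall x, Z x -> cylinder z N r eps x -> x != z -> f z < f x.
  move=> nz x Zx cx xz; have [d e] := coordP x Zx cx.
  set xi := tproj N (x - z) in d e.
  have xi0 : xi != 0 by apply: contraNneq xz => x0; rewrite e x0 k00.
  have d' : disc N r (0 + xi) by rewrite add0r.
  have [dF _ sF] := CV 0 xi d.1 (disc0 _ r0) d'.
  have := strict_derive_lt dF _ (fun b b0 b1 => sF xi0 0 b (lexx 0) b0 b1).
  rewrite scale0r addr0 k00 scale1r add0r -e; apply.
  have -> : theta u N xi z = xi by apply: theta_base => //; exact: d.1.
  have := normal_toE lf Uz Zz nz; rewrite -(opprB y z) => ->.
  by rewrite dotNr dotZr (dotC xi) d.1 mulr0 oppr0 mulr0.
exists (cylinder z N r eps); split.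
- exact: cylinder_open.
- exact: (cylinder_center _ _ r0 (lc_eps0 C)).
- by move=> x cx; split; [have [] := CO x cx|exact: (lc_sub C cx)].
split.
- move=> c; have [->|/set0P[p0 [[Z0 c0] l0]]] := eqVneq (Z `&` cylinder z N r eps `&` [set x | f x < c]) set0.
    exact: connected0.
  have [d0 e0] := coordP p0 Z0 c0.
  apply: (@path_connected_sublevel _ _ p0 (fun p s =>
     g (tproj N (p0 - z)) (tproj N (p - z) - tproj N (p0 - z)) s)) => [|p [[Zp cp] lp]].
    by split.
  have [d e] := coordP p Zp cp.
  split.
  + by rewrite /g scale0r addr0 -e0.
  + by rewrite /g scale1r addrC subrK -e.
  + move=> s s0 s1; have [? ?] := chartP _ (seg _ _ s d0 d s0 s1); split => //.
    apply: (le_lt_trans (cvx _ _ s d0 d s0 s1)); rewrite -e0 -e /=.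
    have sp : 0 <= 1 - s by rewrite subr_ge0.
    have [h|h] := leP (f p0) (f p).
      apply: le_lt_trans lp; have := ler_wpM2l sp h; lra.
    apply: le_lt_trans l0; have := ler_wpM2l s0 (ltW h); lra.
  + apply: continuous_in_subspaceT => s; rewrite inE/= in_itv/= => /andP[s0 s1].
    by apply: gder; [rewrite dotBr d0.1 d.1 subrr|exact: seg].
- move=> p q Zp cp Zq cq qp; have [d1 e1] := coordP p Zp cp; have [d2 e2] := coordP q Zq cq.
  move=> B Bp; set xi := tproj N (p - z) in d1 e1; set xi' := tproj N (q - z) in d2 e2.
  have ne : dot N (xi' - xi) = 0 by rewrite dotBr d1.1 d2.1 subrr.
  have c0 : {for 0, continuous (g xi (xi' - xi))} by apply: gder => //; rewrite scale0r addr0.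
  have g0 : g xi (xi' - xi) 0 = p by rewrite /g scale0r addr0 -e1.
  have B0 : nbhs (g xi (xi' - xi) 0) B by rewrite g0.
  have /nbhs_ballP[e /= e0 eB] := c0 _ B0.
  have m0 : 0 < Num.min e 1 by rewrite lt_min e0 ltr01.
  pose s := Num.min e 1 / 2.
  have s0 : 0 < s by rewrite divr_gt0.
  have [se s1] : s < e /\ s < 1.
    have h : s < Num.min e 1 by rewrite /s; lra.
    by move: h; rewrite lt_min => /andP.
  exists (g xi (xi' - xi) s); split.
    have [? ?] := chartP _ (seg _ _ s d1 d2 (ltW s0) (ltW s1)); split => //.
    apply: (le_lt_trans (cvx _ _ s d1 d2 (ltW s0) (ltW s1))); rewrite -e1 -e2 /=.
    have : s * f q < s * f p by rewrite ltr_pM2l.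
    lra.
  by apply: eB; rewrite -ball_normE /ball_/= sub0r normrN gtr0_norm.
- exact: V4.
move=> [q0 [Zq0 cq0 q0z]].
(* A vanishing tangential part would make [z] a normal foot point, hence a strict minimum by [V4],
   against the lower point [q0]. *)
have w0 : - w != 0.
  apply/eqP => w0; have q0n : q0 != z by apply: contraTneq q0z => ->; rewrite ltxx.
  have nz : normal_to Z z (y - z).
    exists U, u; split => //; move/eqP: w0; rewrite oppr_eq0 /w /tproj subr_eq0 => /eqP w0.
    by rewrite -(opprB z y) {1}w0 dotNl scaleNr (dotC (z - y)).
  by have := V4 nz q0 Zq0 cq0 q0n; rewrite ltNge ltW.
pose eta := - w; have ne : dot N eta = 0 by rewrite /eta dotNr dot_tproj// oppr0.
have en : 0 < enorm eta by rewrite enorm_gt0.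
(* Curves that start in the half-size disc and run for this time cover [r / 2] in the disc, so they
   do not leave the chart. *)
pose s1 := r / 2 / enorm eta.
have s10 : 0 < s1 by rewrite !divr_gt0.
have s1e : s1 * enorm eta = r / 2 by rewrite /s1 divfK// gt_eqF.
have dsk xi (s : R) : disc N (r / 2) xi -> 0 <= s -> s <= s1 -> disc N r (xi + s *: eta).
  move=> [nx xr] s0 ss; split; first by rewrite dotDr dotZr ne mulr0 nx addr0.
  apply: (le_lt_trans (enormD _ _)); rewrite enormZ (ger0_norm s0).
  have : s * enorm eta <= s1 * enorm eta by rewrite ler_wpM2r ?enorm_ge0.
  rewrite s1e; lra.
have dh xi : disc N (r / 2) xi -> disc N r xi.
  by move=> [? h]; split => //; lra.
have r20 : 0 < r / 2 by rewrite divr_gt0.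
have dec xi (sg s : R) : disc N (r / 2) xi -> `|sg| = 1 -> 0 < s -> s <= s1 ->
   6 / 10 * kap ^+ 2 * f (g xi eta s) + sg * kap * dot (nu (g xi eta s)) (g xi eta s - y) <
   6 / 10 * kap ^+ 2 * f (g xi eta 0) + sg * kap * dot (nu (g xi eta 0)) (g xi eta 0 - y).
  move=> d sg1 s0 ss.
  pose G (t : R) := 6 / 10 * kap ^+ 2 * f (g xi eta t) + sg * kap * dot (nu (g xi eta t)) (g xi eta t - y).
  pose G' (t : R) := 6 / 10 * kap ^+ 2 * (2 * dot (theta u N eta (g xi eta t)) (g xi eta t - y)) +
     sg * kap * dot (shape_op u N eta (g xi eta t)) (g xi eta t - y).
  have dG (t : R) : 0 <= t -> t <= s -> is_derive t (1 : R) G (G' t).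
    move=> t0 ts; have D := dsk xi t d t0 (le_trans ts ss).
    have [Zg cg] := chartP _ D; have Ug := lc_sub C cg.
    have dg := lc_derive C ne D.
    have dn := is_derive_comp dg (differentiable_ugrad oU su gu Ug).
    have hc : is_derive t (1 : R) (cst y) (0 : V) by exact: is_derive_cst.
    have h4 := is_deriveB dg hc; rewrite subr0 in h4.
    have h5 := is_derive_dot dn h4.
    have h6 := is_deriveZ (6 / 10 * kap ^+ 2) (sqdist_derive y dg).
    have h7 := is_deriveZ (sg * kap) h5.
    apply: (is_derive_eq (is_deriveD h6 h7)).
    rewrite /G' (shape_opE lf)// theta_normal ?addr0//.
    by rewrite gt_eqF//; exact: (lc_pos C).
  have cf : {within `[0, s], continuous G}.
    by apply: derivable_within_continuous => t; rewrite in_itv/= => /andP[t0 ts]; case: (dG t t0 ts).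
  have dG' (t : R) : t \in `]0, s[ -> is_derive t (1 : R) G (G' t).
    by rewrite in_itv/= => /andP[/ltW t0 /ltW ts]; exact: dG.
  have [t] := MVT s0 dG' cf; rewrite in_itv/= => /andP[t0 ts] e.
  rewrite -subr_lt0 -[ltLHS]/(G s - G 0) e subr0 pmulr_llt0//.
  have D := dsk xi t d (ltW t0) (le_trans (ltW ts) ss).
  by have [Zg /CO[_ Qg]] := chartP _ D; exact: (QP w0 _ Qg sg sg1).
have fdec xi (s : R) : disc N (r / 2) xi -> 0 < s -> s <= s1 -> f (g xi eta s) < f (g xi eta 0).
  (* Adding the inequalities for the two signs cancels the normal component and leaves the decrease
     of [f]. *)
  move=> d s0 ss; have a1 := dec xi 1 s d (normr1 R) s0 ss.
  have a2 := dec xi (-1) s d _ s0 ss; rewrite normrN normr1 in a2.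
  have k2 : 0 < 6 / 10 * kap ^+ 2 by rewrite mulr_gt0// exprn_gt0.
  by rewrite -(ltr_pM2l k2); have := a2 erefl; lra.
have g00 : g 0 eta 0 = z by rewrite /g scale0r addr0 k00.
have D20 : disc N (r / 2) 0 by exact: disc0.
have fz1 := fdec 0 s1 D20 s10 (lexx s1); rewrite g00 in fz1.
have Ds1 : disc N r (s1 *: eta) by have := dsk 0 s1 D20 (ltW s10) (lexx s1); rewrite add0r.
(* the endpoint s1 *: eta of the central curve lies below level f z, hence so
   do the endpoints of the neighbouring curves *)
have near1 : \forall xi \near (0 : V), disc N (r / 2) xi -> f (g xi eta s1) < f z.
  have fz1' : f (chart z N k (s1 *: eta)) < f z by move: fz1; rewrite /g add0r.
  have cF : {for (s1 *: eta, k (s1 *: eta)),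
      continuous (fun p : V * R => f (z + p.1 + p.2 *: N))}.
    apply: sqdist_continuous; apply: continuousD.
      by apply: continuousD; [exact: cst_continuous|exact: cvg_fst].
    by apply: continuousZr_tmp; exact: cvg_snd.
  have [[A B]/= [nA nB] AB] := near_lt cF fz1'.
  have /nbhs_ballP[e /= e0 eB] := nB.
  have h1 := lc_cont C Ds1 e0.
  have sh : {for (0 : V), continuous (fun xi : V => xi + s1 *: eta)}.
    by apply: continuousD; [exact: cvg_id|exact: cst_continuous].
  have nA' : nbhs (0 + s1 *: eta) A by rewrite add0r.
  have h1' : nbhs (0 + s1 *: eta) [set xi' | disc N r xi' -> `|k xi' - k (s1 *: eta)| < e].
    by rewrite add0r.
  have H1 : \forall xi \near (0 : V), A (xi + s1 *: eta) by exact: (sh _ nA').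
  have H2 : \forall xi \near (0 : V), disc N r (xi + s1 *: eta) ->
      `|k (xi + s1 *: eta) - k (s1 *: eta)| < e by exact: (sh _ h1').
  apply: filterS2 H1 H2 => xi Axi kxi d.
  apply: (AB (_, _)); split => //=; apply: eB; rewrite -ball_normE /ball_/= distrC.
  by apply: kxi; apply: dsk => //; exact: ltW.
have /nbhs_enormP[r1 r10 r1P] := near1.
pose r2 := Num.min r1 (r / 2).
have r20' : 0 < r2 by rewrite lt_min r10.
have r2r : r2 <= r / 2 by rewrite ge_min lexx orbT.
exists (cylinder z N r2 eps); split.
- exact: cylinder_open.
- exact: (cylinder_center _ _ r20' (lc_eps0 C)).
- by move=> x [h ?]; split => //; apply: lt_trans h _; lra.
move=> x Zx [xr xe].
have cx : cylinder z N r eps x by split => //; apply: lt_trans xr _; lra.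
have [d e] := coordP x Zx cx; set xi := tproj N (x - z) in xr d e.
have d2 : disc N (r / 2) xi by split; [exact: d.1|exact: lt_le_trans xr r2r].
have D := dsk xi s1 d2 (ltW s10) (lexx s1).
have [Zq cq] := chartP _ D.
exists (g xi eta s1); split => //.
  by apply: r1P => //; rewrite subr0; apply: lt_le_trans xr _; rewrite ge_min lexx.
have ex : g xi eta 0 = x by rewrite /g scale0r addr0.
have a1 := dec xi 1 s1 d2 (normr1 R) s10 (lexx s1).
have a2 := dec xi (-1) s1 d2 _ s10 (lexx s1); rewrite normrN normr1 in a2.
rewrite ex in a1 a2; have {}a2 := a2 erefl.
set q := g xi eta s1 in a1 a2 *.
set ax := dot (nu x) (x - y) in a1 a2 *; set aq := dot (nu q) (q - y) in a1 a2 *.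
have k1 : kap * aq <= kap * `|aq| by rewrite ler_pM2l// ler_norm.
have k2 : - (kap * aq) <= kap * `|aq| by rewrite -mulrN ler_pM2l// -normrN ler_norm.
by have [ax0|ax0] := leP 0 ax; [rewrite (ger0_norm ax0)|rewrite (ltr0_norm ax0)]; lra.
Qed.

End Base.
End LocalGeometry.

(** * Propagation of a property through rising sublevel components *)

Section LevelInduction.
Variables (R : realType) (n : nat).
Local Notation V := 'rV[R]_n.+1.

(** On [G] the sets [O], [A] and [F] coincide, so their trace is relatively open and closed. *)
Lemma connected_clopen_sub (T : topologicalType) (G A O F : set T) (x : T) :
  connected G -> open O -> closed F -> G x -> O x ->
  (forall p, G p -> O p -> A p) -> (forall p, G p -> A p -> F p) ->
  (forall p, G p -> F p -> O p) -> G `<=` A.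
Proof.
move=> cG oO cF Gx Ox h1 h2 h3.
have <- : G `&` A = G; last by move=> p [].
apply: cG.
- by exists x; split => //; exact: h1.
- exists O => //; apply/seteqP; split => p [Gp Ap]; split => //; last exact: h1.
  by apply: h3 => //; exact: h2.
- exists F => //; apply/seteqP; split => p [Gp Ap]; split => //; first exact: h2.
  by apply: h1 => //; exact: h3.
Qed.

(** A Lebesgue number: the admissible radius at a point is halved, which leaves it valid nearby, and
    compactness makes it uniform. *)
Lemma compact_sub_open_radius (K W : set V) : compact K -> open W -> K `<=` W ->
  exists2 e : R, 0 < e & forall x y, K x -> enorm (y - x) < e -> W y.
Proof.
move=> cK oW KW.
have /compact_near_coveringP h := cK.
have H : \forall e \near (0 : R)^'+, K `<=` [set x | forall y, enorm (y - x) < e -> W y].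
  apply: h => x Kx.
  have /nbhs_enormP[d d0 dW] : nbhs x W by apply: open_nbhs_nbhs; split => //; exact: KW.
  have d20 : 0 < d / 2 by rewrite divr_gt0.
  exists ([set x' | enorm (x' - x) < d / 2], [set e | e < d / 2]).
    split => /=; first by apply/nbhs_enormP; exists (d / 2).
    exact: nbhs_right_lt.
  move=> [x' e] /= [x'x ed] y yx'; apply: dW.
  by have := enormDB y x' x; lra.
have [e [e0 He]] : exists e : R, 0 < e /\ K `<=` [set x | forall y, enorm (y - x) < e -> W y].
  have H0 : \forall e \near (0 : R)^'+, 0 < e by exact: nbhs_right_gt.
  by have [e []] := filter_ex (filterI H0 H); exists e.
by exists e => // x y Kx; exact: He.
Qed.

Lemma compact_min_gt (F : set V) (f : V -> R) (a : R) : compact F -> continuous f ->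
  (forall x, F x -> a < f x) -> exists2 b, a < b & forall x, F x -> b <= f x.
Proof.
move=> cF cf aF; have [->|F0] := eqVneq F set0.
  by exists (a + 1) => //; rewrite ltrDl.
have cw : {within F, continuous f} by exact: continuous_subspaceT.
have [c cFc hc] := EVT_min_rV ((set0P F).1 F0) cF cw.
rewrite inE in cFc; exists (f c); first exact: aF.
by move=> x Fx; apply: hc; rewrite inE.
Qed.

Variables (Z : set V) (f : V -> R) (P : set V) (z1 : V) (b0 b1 : R).
Hypothesis cZ : compact Z.
Hypothesis cf : continuous f.
Hypothesis Pcl : forall z, Z z -> closure (Z `&` P) z -> P z.
Hypotheses (Zz1 : Z z1) (fz1 : f z1 < b0).
Local Notation C b := (connected_component (Z `&` [set x | f x < b]) z1).
Hypothesis H0 : C b0 `<=` P.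
(** The last clause extends [P] from the strict sublevel to a full neighbourhood. It supposes that
    [z] has lower points nearby, so nothing is asserted about new components that are born at local
    minima. *)
Hypothesis HL : forall z (O : set V), Z z -> P z -> f z < b1 -> nbhs z O ->
  exists V' : set V, [/\ open V', V' z, V' `<=` O &
  [/\ forall c : R, connected (Z `&` V' `&` [set x | f x < c]),
      forall p q, Z p -> V' p -> Z q -> V' q -> f q < f p ->
        closure (Z `&` V' `&` [set x | f x < f p]) p &
      b0 <= f z -> (exists q, [/\ Z q, V' q & f q < f z]) ->
      (forall x, Z x -> V' x -> f x < f z -> P x) ->
      exists V1 : set V, [/\ open V1, V1 z, V1 `<=` V' & forall x, Z x -> V1 x -> P x]]].

(* The set of levels b for which the component of z1 in Z /\ {f < b} satisfies
   P is closed under suprema and cannot have a supremum below b1. *)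
Lemma level_induction G : connected G -> G z1 ->
  (forall x, G x -> Z x /\ f x < b1) -> forall x, G x -> P x.
Proof.
move=> cG Gz1 GZ.
have cfor (x : V) : {for x, continuous f} by exact: cf.
have Zcl : closed Z by apply: compact_closed => //; exact: norm_hausdorff.
have opl (c : R) : open [set x | f x < c] by move: cf => /continuousP/(_ _ (@open_lt R c)).
have mono b b' : b <= b' -> f z1 < b -> C b `<=` C b'.
  move=> bb fb; apply: connected_component_max; last exact: component_connected.
    by apply: connected_component_refl.
  by move=> x /(@connected_component_sub _ _ _ _)[Zx xb]; split => //; exact: lt_le_trans bb.
have [b10|b01] := leP b1 b0.
  move=> x Gx; apply: H0; apply: (@connected_component_max _ _ G) => // p Gp.
  by have [Zp fp] := GZ p Gp; split => //; exact: lt_le_trans b10.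
pose A := [set b | b0 <= b <= b1 /\ C b `<=` P].
have A0 : A b0 by split => //; rewrite lexx ltW.
have supA : has_sup A.
  by split; [exists b0|exists b1 => b [/andP[]]].
pose bs := sup A.
have Abs b : A b -> b <= bs by move=> Ab; exact: sup_upper_bound.
have b0s : b0 <= bs := Abs _ A0.
have bs1 : bs <= b1 by apply: ge_sup; [exists b0|move=> b [/andP[]]].
have Alt b : A b -> f z1 < b by move=> [/andP[h _] _]; exact: lt_le_trans h.
(* The components over all admissible levels together; by [step] below, [Q] absorbs every connected
   set through [z1] below the supremum level [bs]. *)
pose Q := [set x | exists2 b, A b & C b x].
have QZ x : Q x -> [/\ Z x, f x < bs & P x].
  move=> [b Ab Cbx]; have [Zx xb] := connected_component_sub Cbx.
  by split => //; [exact: lt_le_trans (Abs _ Ab)|have [_] := Ab; exact].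
have absorb b (S : set V) q : connected S -> (forall x, S x -> Z x /\ f x < b) ->
    f z1 < b -> C b q -> S q -> S `<=` C b.
  move=> cS SZ fb Cq Sq; apply: subset_trans (@subsetUr _ (C b) S) _.
  apply: connected_component_max.
  - by left; exact: connected_component_refl.
  - by move=> x [/(@connected_component_sub _ _ _ _)//|/SZ[]].
  - by apply: connectedU; [exists q|exact: component_connected|].
have Qop x : Q x -> exists V', [/\ open V', V' x & forall p, Z p -> V' p -> Q p].
  move=> Qx; have [Zx xs Px] := QZ x Qx; have [b Ab Cbx] := Qx.
  have [_ xb] := connected_component_sub Cbx.
  have [V' [oV Vx VO [V1 _ _]]] := HL Zx Px (lt_le_trans xs bs1) (open_nbhs_nbhs (conj (opl b) xb)).
  exists V'; split => // p Zp Vp; exists b => //.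
  apply: (absorb b _ x (V1 b)) => //; last by split => //; exact: VO.
  - by move=> q [[]].
  - exact: Alt.
have Qcl x : Z x -> f x < bs -> closure Q x -> Q x.
  move=> Zx xs Qx.
  have Px : P x by apply: Pcl => //; apply: closureS Qx => p /QZ[? _ ?].
  have [b Ab xb] : exists2 b, A b & f x < b.
    have e0 : 0 < bs - f x by rewrite subr_gt0.
    by have [b Ab] := sup_adherent e0 supA; rewrite opprB addrC subrK; exists b.
  have [V' [oV Vx VO [V1 _ _]]] := HL Zx Px (lt_le_trans xs bs1) (open_nbhs_nbhs (conj (opl b) xb)).
  have [q [[b' Ab' Cq] Vq]] := Qx _ (open_nbhs_nbhs (conj oV Vx)).
  pose b2 := Num.max b b'.
  have Ab2 : A b2 by rewrite /b2; case: leP.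
  have Cq2 : C b2 q by apply: (mono b') => //; [rewrite le_max lexx orbT|exact: Alt].
  have bb2 : b <= b2 by rewrite le_max lexx.
  exists b2 => //; apply: (absorb b2 _ q (V1 b2)) => //.
  - by move=> p [[]].
  - exact: Alt.
  - by split; [have [Zq _ _] := QZ q (ex_intro2 _ _ b' Ab' Cq); split|exact: lt_le_trans (VO _ Vq) bb2].
  - by split; [split|exact: lt_le_trans bb2].
have Qz1 : Q z1 by exists b0 => //; apply: connected_component_refl.
have step S : connected S -> S z1 -> (forall x, S x -> Z x /\ f x < bs) -> S `<=` Q.
  move=> cS Sz1 SZ.
  pose O := [set x | exists V', [/\ open V', V' x & forall p, Z p -> V' p -> Q p]].
  have oO : open O.
    rewrite openE => x [V' [oV Vx VQ]]; apply: filterS (open_nbhs_nbhs (conj oV Vx)) => p Vp.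
    by exists V'.
  apply: (@connected_clopen_sub _ S Q O (closure Q) z1) => //.
  - exact: closed_closure.
  - exact: Qop.
  - by move=> p /SZ[Zp _] [V' [_ Vp]]; exact.
  - by move=> p _; exact: subset_closure.
  - by move=> p /SZ[Zp fp] h; apply: Qop; exact: Qcl.
have [bsb1|bsb1] := leP b1 bs.
  have GQ : G `<=` Q.
    by apply: step => // p Gp; have [Zp fp] := GZ p Gp; split => //; exact: lt_le_trans bsb1.
  by move=> x /GQ /QZ[].
(* Suppose [bs < b1]. The closure of [Q] is compact, and a small neighbourhood [O] of it meets [Z]
   on its frontier only strictly above [bs]. At a slightly higher level the component of [z1] is
   therefore still confined to [O], where [P] holds, against the choice of [bs]. *)
exfalso; pose K := closure Q.
have KZ x : K x -> Z x by move=> h; apply: Zcl; apply: closureS h => p /QZ[].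
have Kf x : K x -> f x <= bs.
  move=> Kx; rewrite leNgt; apply/negP => h.
  have [p [/QZ[_ pb _]]] := Kx _ (near_gt (cfor x) h).
  by rewrite /= ltNge ltW.
have KP x : K x -> P x.
  by move=> Kx; apply: Pcl; [exact: KZ|apply: closureS Kx => p /QZ[? _ ?]].
have cK : compact K by apply: subclosed_compact cZ KZ; exact: closed_closure.
(* Near a point of [W] the part of [Z] up to level [bs] lies in [K]; this is what lifts the frontier
   of [O] strictly above [bs]. *)
pose W := [set x | exists V', [/\ open V', V' x, forall p, Z p -> V' p -> P p &
   forall p, Z p -> V' p -> f p <= bs -> K p]].
have oW : open W.
  rewrite openE => x [V' [oV Vx VQ VK]]; apply: filterS (open_nbhs_nbhs (conj oV Vx)) => p Vp.
  by exists V'.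
have KW : K `<=` W.
  move=> x Kx; have [xs|xs] := ltP (f x) bs.
    have [V' [oV Vx VQ]] := Qop x (Qcl x (KZ x Kx) xs Kx).
    exists V'; split => // p Zp Vp; first by have [] := QZ p (VQ p Zp Vp).
    by move=> _; apply: subset_closure; exact: VQ.
  have fx : f x = bs by apply/eqP; rewrite eq_le Kf.
  have xb1 : f x < b1 by rewrite fx.
  have [V' [oV Vx _ [V1 V2 V3]]] := HL (KZ x Kx) (KP x Kx) xb1 filterT.
  have [q [Qq Vq]] := Kx _ (open_nbhs_nbhs (conj oV Vx)).
  have [Zq qs Pq] := QZ q Qq.
  have SQ : Z `&` V' `&` [set p | f p < bs] `<=` Q.
    have [b Ab Cq] := Qq.
    apply: subset_trans (@subsetUr _ (C b) _) _; apply: step.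
    - by apply: connectedU; [exists q; split|exact: component_connected|exact: V1].
    - by left; apply: connected_component_refl; split => //; exact: Alt.
    - move=> p [/(@connected_component_sub _ _ _ _)[Zp pb]|[[Zp _] pb]]; split => //.
      exact: lt_le_trans (Abs _ Ab).
  have [||| W1 [oW1 W1x W1V W1P]] := V3.
  - by rewrite fx.
  - by exists q; split => //; rewrite fx.
  - by move=> p Zp Vp; rewrite fx => ps; have [] := QZ p (SQ p (conj (conj Zp Vp) ps)).
  exists W1; split => // p Zp /W1V Vp pb; have [ps|ps] := ltP (f p) bs.
    by apply: subset_closure; exact: SQ.
  have fp : f p = bs by apply/eqP; rewrite eq_le pb.
  have := V2 p q Zp Vp Zq Vq; rewrite fp => /(_ qs); exact: closureS.
have [e e0 eW] := compact_sub_open_radius cK oW KW.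
have e20 : 0 < e / 2 by rewrite divr_gt0.
pose O := [set y | exists2 x, K x & enorm (y - x) < e / 2].
have oO : open O.
  rewrite openE => y [x Kx yx]; apply: filterS (nbhs_enorm_lt yx) => p px.
  by exists x.
have clO y : closure O y -> W y.
  move=> h; have [p [[x Kx px] yp]] := h _ (near_enorm y e20).
  apply: (eW x) => //; have := enormDB y p x; rewrite enormB in yp; move: px yp; lra.
pose F := Z `&` (closure O `&` ~` O).
have cF : compact F.
  apply: compact_closedI => //; apply: closedI; [exact: closed_closure|exact: open_closedC].
have KO x : K x -> O x by move=> Kx; exists x => //; rewrite subrr enorm0.
have [|b bsb bF] := @compact_min_gt F f bs cF cf.
  move=> x [Zx [/clO[V' [_ Vx _ VK]] nO]]; rewrite ltNge; apply/negP => h.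
  by apply: nO; apply: KO; exact: VK.
pose b' := Num.min b b1.
have bsb' : bs < b' by rewrite lt_min bsb.
have z1b' : f z1 < b' by apply: lt_trans bsb'; exact: lt_le_trans fz1 b0s.
have CO : C b' `<=` O.
  apply: (@connected_clopen_sub _ (C b') O O (closure O) z1) => //.
  - exact: component_connected.
  - exact: closed_closure.
  - by apply: connected_component_refl.
  - by apply: KO; exact: subset_closure.
  - by move=> p _; exact: subset_closure.
  - move=> p /(@connected_component_sub _ _ _ _)[Zp pb] clp; apply: contrapT => nO.
    have := bF p (conj Zp (conj clp nO)); rewrite leNgt.
    by rewrite (lt_le_trans pb)// ge_min lexx.
have : A b'.
  split; first by rewrite ltW ?(le_lt_trans b0s)//= ge_min lexx orbT.
  move=> p Cp; have [Zp _] := connected_component_sub Cp.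
  have [V' [_ Vp VP _]] := clO p (subset_closure (CO p Cp)); exact: VP.
by move/Abs; rewrite leNgt bsb'.
Qed.

End LevelInduction.

(** * Normal foot points minimise the distance on their sheet *)

Section SheetMinimality.
Variables (R : realType) (n : nat).
Local Notation V := 'rV[R]_n.+1.

(** The propagated property is [kap |<nu, x - y>| <= 1/10 + 6/10 kap^2 |x - y|^2]. It holds with
    room at [z1], where the left side is at most [1/20]. Within [1.1 / kap] of [y] its right side is
    below [0.1 + 0.6 * 1.21 < 0.85], so [local_structure] applies and carries the property past the
    current level. *)
Lemma sheet_strict_min (Z : set V) (kap : R) (y z1 z2 : V) (G : set V) :
  0 < kap -> compact_hypersurface Z -> sff_le Z kap -> Z z1 ->
  normal_to Z z1 (y - z1) -> kap * enorm (y - z1) <= 5 / 100 ->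
  connected G -> (forall x, G x -> Z x /\ kap * enorm (x - y) < 11 / 10) ->
  G z1 -> G z2 -> z2 != z1 -> sqdist y z1 < sqdist y z2.
Proof.
move=> kap0 [cZ hZ] hk Zz1 nz1 kz1 cG GZ Gz1 Gz2 z21.
have k2 : 0 < kap ^+ 2 by rewrite exprn_gt0.
pose f := sqdist y.
have cf : continuous f by move=> x; apply: sqdist_continuous; exact: cvg_id.
pose E x := forall U u, level_fun Z U u -> U x ->
  kap * `|dot (ugrad u x) (x - y)| <= 1 / 10 + 6 / 10 * kap ^+ 2 * f x.
have [U [u [lf Uz1]]] := hypersurface_level_fun hZ Zz1.
have cdot U' u' x : level_fun Z U' u' -> U' x ->
    {for x, continuous (fun x => kap * `|dot (ugrad u' x) (x - y)|)}.
  move=> lf' U'x; apply: continuousM; first exact: cst_continuous.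
  apply: (@continuous_comp _ _ _ (fun x => dot (ugrad u' x) (x - y)) Num.Def.normr); last exact: norm_continuous.
  apply: dot_continuous.
    exact: (differentiable_continuous (differentiable_ugrad (lf_open lf') (lf_smooth lf') (lf_reg lf') U'x)).
  by apply: continuousB; [exact: cvg_id|exact: cst_continuous].
have N1 : enorm (ugrad u z1) = 1 by exact: (enorm_ugrad (lf_open lf) (lf_smooth lf) (lf_reg lf)).
have a1 : kap * `|dot (ugrad u z1) (z1 - y)| <= 5 / 100.
  apply: le_trans kz1; rewrite ler_pM2l//; apply: (le_trans (dot_le _ _)).
  by rewrite N1 mul1r enormB.
have a1' : kap * `|dot (ugrad u z1) (z1 - y)| <= 85 / 100 by lra.
have a1'' : kap * `|dot (ugrad u z1) (z1 - y)| < 1 / 10 by lra.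
have O1 := near_lt (cdot U u z1 lf Uz1) a1''.
have [V1 [oV1 V1z V1O [_ _ V14 _]]] := local_structure kap0 hk lf Uz1 Zz1 a1' O1.
have {}V14 := V14 nz1.
have /nbhs_enormP[d d0 dV] := open_nbhs_nbhs (conj oV1 V1z).
(* On the sphere of radius [rho] about [z1] the function [f] is at least some [b0 > f z1], so the
   component of [z1] below [b0] cannot leave the ball, where [E] and strict minimality are already
   known. This starts the induction. *)
pose rho := d / 2; have rho0 : 0 < rho by rewrite divr_gt0.
have rV x : enorm (x - z1) <= rho -> V1 x by move=> h; apply: dV; rewrite /rho in h; lra.
have cn : continuous (fun x : V => enorm (x - z1)).
  by move=> x; apply: (@enorm_continuous R n V (fun x => x - z1) x); apply: continuousB; [exact: cvg_id|exact: cst_continuous].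
have cnfor (x : V) : {for x, continuous (fun x : V => enorm (x - z1))} by exact: cn.
have cfor (x : V) : {for x, continuous f} by exact: cf.
pose F := Z `&` [set x | enorm (x - z1) = rho].
have cF : compact F.
  apply: compact_closedI => //.
  by move: cn => /continuous_closedP/(_ _ (@closed_eq R rho)).
have [|b0 zb0 bF] := @compact_min_gt R n F f (f z1) cF cf.
  move=> x [Zx /= xr]; apply: V14 => //; first by apply: rV; rewrite xr.
  by apply/eqP => xz; move: rho0; rewrite -xr xz subrr enorm0 ltxx.
(* The disjunction is the actual goal in disguise: either alternative at [z2] gives the strict
   inequality. *)
pose P := [set x | E x /\ (b0 <= f x \/ enorm (x - z1) <= rho)].
have P1 x : Z x -> V1 x -> E x.
  move=> Zx /V1O[xO Ux] U' u' lf' U'x.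
  rewrite (level_fun_dot_abs _ lf lf' Ux U'x Zx) (le_trans (ltW xO))//.
  by rewrite lerDl mulr_ge0 ?sqdist_ge0// mulr_ge0// ltW.
have opn : open [set x | enorm (x - z1) < rho] by move: cn => /continuousP/(_ _ (@open_lt R rho)).
have cln : closed [set x | enorm (x - z1) <= rho] by move: cn => /continuous_closedP/(_ _ (@closed_le R rho)).
have H0 : connected_component (Z `&` [set x | f x < b0]) z1 `<=` P.
  have CO : connected_component (Z `&` [set x | f x < b0]) z1 `<=` [set x | enorm (x - z1) <= rho].
    apply: (@connected_clopen_sub _ _ _ [set x | enorm (x - z1) < rho] [set x | enorm (x - z1) <= rho] z1) => //.
    - exact: component_connected.
    - by apply: connected_component_refl.
    - by rewrite /= subrr enorm0.
    - by move=> p _ /= /ltW.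
    - move=> p /(@connected_component_sub _ _ _ _)[Zp pb] /=; rewrite le_eqVlt => /orP[/eqP e|//].
      by have := bF p (conj Zp e); rewrite leNgt pb.
  move=> x Cx; have [Zx _] := connected_component_sub Cx.
  by split; [apply: P1 => //; apply: rV; exact: CO|right; exact: CO].
pose b1 := 121 / 100 / kap ^+ 2.
have Gb1 x : G x -> Z x /\ f x < b1.
  move=> /GZ[Zx kx]; split => //; rewrite /f sqdistE /b1 ltr_pdivlMr// -exprMn mulrC.
  have := enorm_ge0 (x - y); set t := enorm _ in kx *; move=> t0.
  have kt : 0 <= kap * t by rewrite mulr_ge0// ltW.
  have : (kap * t) ^+ 2 < (11 / 10) ^+ 2 by rewrite ltr_pXn2r ?nnegrE.
  rewrite [in ltRHS]expr2; lra.
have Pcl z : Z z -> closure (Z `&` P) z -> P z.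
  move=> Zz clz; split; last first.
    apply: contrapT => /not_orP[/negP + /negP]; rewrite -!ltNge => h1 h2.
    have [p [[_ [_ [q1|q2]]] /=]] := clz _ (filterI (near_lt (cfor z) h1) (near_gt (cnfor z) h2)).
      by move=> [+ _]; rewrite ltNge q1.
    by move=> [_]; rewrite ltNge q2.
  move=> U' u' lf' U'z; rewrite leNgt; apply/negP => h.
  have c : {for z, continuous (fun x => 1 / 10 + 6 / 10 * kap ^+ 2 * f x - kap * `|dot (ugrad u' x) (x - y)|)}.
    apply: continuousB; last exact: cdot lf' U'z.
    apply: continuousD; first exact: cst_continuous.
    by apply: continuousM; [exact: cst_continuous|exact: cf].
  have h' : 1 / 10 + 6 / 10 * kap ^+ 2 * f z - kap * `|dot (ugrad u' z) (z - y)| < 0 by rewrite subr_lt0.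
  have [p [[_ [Ep _]] [/= U'p]]] := clz _ (filterI (open_nbhs_nbhs (conj (lf_open lf') U'z)) (near_lt c h')).
  by rewrite subr_lt0 ltNge (Ep _ _ lf' U'p).
have HL : forall z (O : set V), Z z -> P z -> f z < b1 -> nbhs z O ->
  exists V' : set V, [/\ open V', V' z, V' `<=` O &
  [/\ forall c : R, connected (Z `&` V' `&` [set x | f x < c]),
      forall p q, Z p -> V' p -> Z q -> V' q -> f q < f p ->
        closure (Z `&` V' `&` [set x | f x < f p]) p &
      b0 <= f z -> (exists q, [/\ Z q, V' q & f q < f z]) ->
      (forall x, Z x -> V' x -> f x < f z -> P x) ->
      exists V1 : set V, [/\ open V1, V1 z, V1 `<=` V' & forall x, Z x -> V1 x -> P x]]].
  move=> z O Zz [Ez _] zb1 Oz.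
  have [U' [u' [lf' U'z]]] := hypersurface_level_fun hZ Zz.
  have hz : kap * `|dot (ugrad u' z) (z - y)| <= 85 / 100.
    have : kap ^+ 2 * f z < 121 / 100.
      by move: zb1; rewrite /b1 ltr_pdivlMr// mulrC.
    by have := Ez U' u' lf' U'z; rewrite -mulrA; lra.
  have [V' [oV Vz VO [v1 v2 _ v3]]] := local_structure kap0 hk lf' U'z Zz hz Oz.
  exists V'; split => //; first by move=> x /VO[].
  split => // bz exq SP; have [W [oW Wz WV Wq]] := v3 exq.
  exists W; split => // x Zx Wx; have Vx := WV x Wx; have [xz|xz] := ltP (f x) (f z); first exact: SP.
  split; last by left; exact: le_trans xz.
  have [q [Zq Vq qz Exq]] := Wq x Zx Wx.
  move=> U2 u2 lf2 U2x; have [_ U'x] := VO x Vx; have [_ U'q] := VO q Vq.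
  rewrite (level_fun_dot_abs _ lf' lf2 U'x U2x Zx).
  have [Eq _] := SP q Zq Vq qz; have := Eq U' u' lf' U'q; rewrite -/f in Exq; lra.
have [_ [zb|zb]] := level_induction cZ cf Pcl Zz1 zb0 H0 HL cG Gz1 Gb1 Gz2.
  exact: lt_le_trans zb.
by apply: V14 => //; [have [] := GZ z2 Gz2|exact: rV].
Qed.

End SheetMinimality.

(** * The maximum principle for normal pairs *)

Section RealAnalysis.
Variable R : realType.

Lemma IVT_root (f : R -> R) (a b : R) : a <= b ->
  (forall x, a <= x -> x <= b -> {for x, continuous f}) -> f a * f b <= 0 ->
  exists c, [/\ a <= c, c <= b & f c = 0].
Proof.
move=> ab cf fab.
have cw : {within `[a, b], continuous f}.
  apply: continuous_in_subspaceT => x; rewrite inE/= in_itv/= => /andP[ax xb].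
  exact: cf.
have h : Num.min (f a) (f b) <= 0 <= Num.max (f a) (f b).
  rewrite ge_min le_max; apply/andP; split; apply/negPn/negP;
    rewrite negb_or -!ltNge => /andP[pa pb]; move: fab; rewrite leNgt.
    by rewrite mulr_gt0.
  by rewrite nmulr_rgt0// pb.
have [c] := IVT ab cw h; rewrite in_itv/= => /andP[ac cb] fc.
by exists c.
Qed.

(** Since [m] vanishes at the minimum, the positive factor [g] only rescales. In the application [g]
    is the length of a gradient, and this form avoids differentiating it. *)
Lemma second_order_min (f g m : R -> R) (m2 : R) :
  (\forall s \near (0 : R), [/\ f 0 <= f s, 0 < g s & is_derive s (1 : R) f (g s * m s)]) ->
  is_derive (0 : R) (1 : R) m m2 -> 0 <= m2.
Proof.
move=> H dm; rewrite leNgt; apply/negP => m20.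
have [f0 g0 df0] := nbhs_singleton H.
have fmin : \forall s \near (0 : R), f 0 <= f s by apply: filterS H => s [].
have /eqP := is_derive_local_min df0 fmin; rewrite mulf_eq0 gt_eqF//= => /eqP m0.
have dmN : is_derive (0 : R) (1 : R) (- m) (- m2) by exact: is_deriveN.
have [|e e0 eP] := is_derive_gt0 dmN; first by rewrite oppr_gt0.
have /nbhs_ballP[e' /= e'0 e'P] := H.
have {}e'P s : `|s| < e' -> [/\ f 0 <= f s, 0 < g s & is_derive s (1 : R) f (g s * m s)].
  by move=> se; apply: e'P; rewrite -ball_normE /ball_/= sub0r normrN.
have mn0 : 0 < Num.min e e' by rewrite lt_min e0.
pose h := Num.min e e' / 2; have h0 : 0 < h by rewrite divr_gt0.
have hm : h < Num.min e e' by rewrite /h; lra.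
have [he he'] : h < e /\ h < e' by move: hm; rewrite lt_min => /andP.
have df c : 0 <= c -> c <= h -> is_derive c (1 : R) f (g c * m c).
  by move=> c0 ch; have [] := e'P c; rewrite ?ger0_norm//; exact: le_lt_trans he'.
have cf : {within `[0, h], continuous f}.
  by apply: derivable_within_continuous => c; rewrite in_itv/= => /andP[c0 ch]; case: (df c c0 ch).
have df' c : c \in `]0, h[ -> is_derive c (1 : R) f (g c * m c).
  by rewrite in_itv/= => /andP[/ltW c0 /ltW ch]; exact: df.
have [c] := MVT h0 df' cf; rewrite in_itv/= subr0 => /andP[c0 ch] e1.
have [_ gc _] : [/\ f 0 <= f c, 0 < g c & is_derive c (1 : R) f (g c * m c)].
  by apply: e'P; rewrite gtr0_norm//; exact: lt_trans he'.
have [_] := eP c c0 (lt_trans ch he); rewrite !fctE/= add0r m0 oppr0 oppr_gt0 => mc.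
have [fh _ _] : [/\ f 0 <= f h, 0 < g h & is_derive h (1 : R) f (g h * m h)].
  by apply: e'P; rewrite gtr0_norm.
have : f h - f 0 < 0 by rewrite e1 pmulr_llt0// pmulr_rlt0.
by rewrite subr_lt0 ltNge fh.
Qed.

End RealAnalysis.

Lemma sum_amgm (R : realFieldType) (m n : nat) (a l : 'I_m -> 'I_n -> R) :
  `|\sum_i \sum_j a i j * l i j| <=
    (\sum_i \sum_j a i j ^+ 2 + \sum_i \sum_j l i j ^+ 2) / 2.
Proof.
have amgm (x y : R) : `|x * y| <= x ^+ 2 / 2 + y ^+ 2 / 2.
  have := sqr_ge0 (`|x| - `|y|); rewrite sqrrB normrM !real_normK ?num_real// -mulr_natr.
  lra.
apply: (le_trans (ler_norm_sum _ _ _)).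
rewrite mulrDl !mulr_suml -big_split/=; apply: ler_sum => i _.
apply: (le_trans (ler_norm_sum _ _ _)).
by rewrite !mulr_suml -big_split/=; apply: ler_sum => j _; exact: amgm.
Qed.

(** * First and second variation at an extremal normal pair *)

Section Comparison.
Variables (R : realType) (n : nat).
Local Notation V := 'rV[R]_n.+1.
Variables (Y Z : set V) (kap d sg : R) (ys zs : V).
Variables (UZ UY : set V) (u v : V -> R).
Hypothesis lfZ : level_fun Z UZ u.
Hypothesis lfY : level_fun Y UY v.
Hypotheses (Uzs : UZ zs) (Uys : UY ys) (Zzs : Z zs) (Yys : Y ys).
Hypotheses (kY : sff_le Y kap) (kZ : sff_le Z kap).
Local Notation nu := (ugrad u).
Local Notation mu := (ugrad v).
Local Notation N := (ugrad u zs).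
Hypothesis yszs : ys = zs + d *: N.
Hypotheses (kap0 : 0 < kap) (kd : kap * `|d| <= 1 / 20).
Hypothesis sg1 : `|sg| = 1.
(** Extremality in terms of the signed height along the normals of [Z]: [sg = 1] is a local maximum,
    [sg = -1] a local minimum. *)
Hypothesis hloc : exists2 del : R, 0 < del & forall (r : R) z, Z z -> UZ z ->
  Y (z + r *: nu z) -> enorm (z - zs) < del -> `|r - d| < del -> sg * (r - d) <= 0.

Let oZ := lf_open lfZ.
Let sZ := lf_smooth lfZ.
Let gZ := lf_reg lfZ.
Let oY := lf_open lfY.
Let sY := lf_smooth lfY.
Let gY := lf_reg lfY.
Let NN : dot N N = 1 := dot_ugrad oZ sZ gZ Uzs.
Let sg2 : sg * sg = 1.
Proof. by rewrite -expr2 -real_normK ?num_real// sg1 expr1n. Qed.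

Section OneDirection.
Variables (zeta : V) (g : R -> V).
Hypothesis Nz : dot N zeta = 0.
Hypothesis g0 : g 0 = zs.
Hypothesis t0 : theta u N zeta zs = zeta.
Hypothesis gP : \forall s \near (0 : R), [/\ UZ (g s), Z (g s), 0 < dot (nu (g s)) N &
      is_derive s (1 : R) g (theta u N zeta (g s))].
Let B := 'D_zeta nu zs.
(** The parallel curve at height [r] over the curve [g] in [Z]; [Xi] evaluated along [g] is its
    velocity at height [d]. *)
Let c r s := g s + r *: nu (g s).
Let Xi x := theta u N zeta x + d *: shape_op u N zeta x.

Let c0E : c d 0 = ys.
Proof. by rewrite /c g0 yszs. Qed.

Let BE : shape_op u N zeta zs = B.
Proof.
have -> : shape_op u N zeta zs = 'D_(theta u N zeta zs) nu zs by apply: (shape_opE lfZ).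
by rewrite t0.
Qed.

Let NB : dot N B = 0.
Proof. by rewrite dotC; apply: dot_derive_ugrad oZ sZ gZ _ _ _. Qed.

Lemma normal_curve_derive r s : UZ (g s) ->
  is_derive s (1 : R) g (theta u N zeta (g s)) ->
  is_derive s (1 : R) (c r) (theta u N zeta (g s) + r *: shape_op u N zeta (g s)).
Proof.
move=> Ug dg; rewrite (shape_opE lfZ)//.
have dn := is_derive_comp dg (differentiable_ugrad oZ sZ gZ Ug).
exact: (is_deriveD dg (is_deriveZ r dn)).
Qed.

Let box : exists2 h0 : R, 0 < h0 & forall s r : R, `|s| < h0 -> `|r - d| < h0 ->
  [/\ [/\ UZ (g s), 0 < dot (nu (g s)) N & is_derive s (1 : R) g (theta u N zeta (g s))], UY (c r s) &
      v (c r s) = 0 -> sg * (r - d) <= 0].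
Proof.
have [del del0 hl] := hloc.
have [_ _ _ dg0] := nbhs_singleton gP.
have cg : {for 0, continuous g} by apply: differentiable_continuous; apply/derivable1_diffP; case: dg0.
have Ug0 : UZ (g 0) by rewrite g0.
have cn : {for 0, continuous (fun s => nu (g s))}.
  by apply: (@continuous_comp _ _ _ g nu) => //; apply: differentiable_continuous; exact: (differentiable_ugrad oZ sZ gZ).
have cc : {for ((0 : R), d), continuous (fun p : R * R => c p.2 p.1)}.
  apply: continuousD; first by apply: (@continuous_comp _ _ _ fst g); [exact: cvg_fst|exact: cg].
  apply: continuousZ; first exact: cvg_snd.
  by apply: (@continuous_comp _ _ _ fst (fun s => nu (g s))); [exact: cvg_fst|exact: cn].
have nU : nbhs (c d 0) UY by rewrite c0E; exact: open_nbhs_nbhs.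
have [[A1 A2]/= [nA1 nA2] AU] := cc _ nU.
have ng : \forall s \near (0 : R), enorm (g s - zs) < del.
  have h0 : nbhs (g 0) [set x | enorm (x - zs) < del] by rewrite g0; exact: near_enorm.
  exact: (cg _ h0).
have H3 : \forall s \near (0 : R), ([/\ UZ (g s), Z (g s), 0 < dot (nu (g s)) N &
      is_derive s (1 : R) g (theta u N zeta (g s))] /\ enorm (g s - zs) < del) /\ A1 s.
  by apply: filterI => //; exact: filterI.
have /nbhs_ballP[e1 /= e10 e1P] := H3.
have /nbhs_ballP[e2 /= e20 e2P] := nA2.
exists (Num.min e1 (Num.min e2 del)); first by rewrite !lt_min e10 e20.
move=> s r; rewrite !lt_min => /and3P[s1 _ _] /and3P[_ r2 r3].
have bs : ball (0 : R) e1 s by rewrite -ball_normE /ball_/= sub0r normrN.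
have [[[Us Zs ps ds] gs] As] := e1P s bs.
have Ar : A2 r by apply: e2P; rewrite -ball_normE /ball_/= distrC.
have UYc : UY (c r s) by apply: (AU (s, r)).
split => // vc; apply: (hl r (g s)) => //.
by apply/(lf_zero lfY).
Qed.

Let vdiff x : UY x -> differentiable v x.
Proof. by move=> Ux; exact: (level_differentiable oY sY). Qed.

Let v0 : v ys = 0.
Proof. by apply/(lf_zero lfY). Qed.

Let cont_r s r : UY (c r s) -> {for r, continuous (fun r => v (c r s))}.
Proof.
move=> U1; apply: (@continuous_comp _ _ _ (fun r => c r s) v); last exact/differentiable_continuous/vdiff.
exact: line_continuous.
Qed.

Let cont_s s r : UY (c r s) -> UZ (g s) -> is_derive s (1 : R) g (theta u N zeta (g s)) ->
  {for s, continuous (fun s => v (c r s))}.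
Proof.
move=> U1 U2 dg; apply: (@continuous_comp _ _ _ (c r) v); last exact/differentiable_continuous/vdiff.
apply: differentiable_continuous; apply/derivable1_diffP.
by case: (normal_curve_derive r U2 dg).
Qed.

Let B_bound w : dot N w = 0 -> `|dot B w| <= kap * (enorm zeta * enorm w).
Proof. by move=> Nw; apply: (sff_tangent_le lfZ kZ Uzs Zzs Nz Nw). Qed.

(* Otherwise Y would cross the normal lines at heights on both sides of d. *)
Lemma transversal : zeta = tproj N (mu ys) -> zeta = 0.
Proof.
move=> ze; apply/eqP/negPn/negP => z0.
have [h0 h00 hb] := box.
have hh0 : `|0 : R| < h0 by rewrite normr0.
have dd0 : `|d - d| < h0 by rewrite subrr normr0.
have [[Ug _ dg] Uc _] := hb 0 d hh0 dd0.
have dv : is_derive (0 : R) (1 : R) (v \o c d) ('D_(zeta + d *: B) v ys).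
  have h := normal_curve_derive d Ug dg; rewrite g0 t0 BE in h.
  by rewrite -c0E; apply: is_derive_comp => //; rewrite c0E; exact: vdiff.
have zz : 0 < dot zeta zeta by rewrite dotvv_gt0.
have pos : 0 < 'D_(zeta + d *: B) v ys.
  rewrite (derive_ugrad oY sY gY)// mulr_gt0 ?(enorm_grad_gt0 oY sY gY)//.
  have mz : dot (mu ys) zeta = dot zeta zeta by rewrite ze tproj_dot_self.
  have mB : dot (mu ys) B = dot zeta B by rewrite ze /tproj dotBl dotZl NB mulr0 subr0.
  rewrite dotDr dotZr mz mB (dotC zeta B).
  have := B_bound Nz; rewrite -expr2 sqr_enorm => bB.
  have : `|d * dot B zeta| <= 1 / 20 * dot zeta zeta.
    rewrite normrM (le_trans (ler_wpM2l (normr_ge0 d) bB))// mulrA (mulrC `|d|).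
    by rewrite ler_wpM2r// ltW.
  rewrite ler_norml => /andP[+ _]; lra.
have [e e0 eP] := is_derive_gt0 dv pos.
pose h := Num.min e h0 / 2; have mn0 : 0 < Num.min e h0 by rewrite lt_min e0.
have hp : 0 < h by rewrite divr_gt0.
have [he hh] : h < e /\ h < h0.
  have : h < Num.min e h0 by rewrite /h; lra.
  by rewrite lt_min => /andP.
have := eP h hp he; rewrite sub0r add0r /= c0E v0 => -[vm vp].
have hhp : `|h| < h0 by rewrite gtr0_norm.
have hhm : `|- h| < h0 by rewrite normrN.
have [_ Up _] := hb h d hhp dd0.
have [_ Um _] := hb (- h) d hhm dd0.
have n1 := near_gt (cont_r Up) vp.
have n2 := near_lt (cont_r Um) vm.
have n12 : \forall r \near d, 0 < v (c r h) /\ v (c r (- h)) < 0 by exact: filterI.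
have /nbhs_ballP[e' /= e'0 e'P] := n12.
pose t := Num.min e' h0 / 2; have mn1 : 0 < Num.min e' h0 by rewrite lt_min e'0.
have tp : 0 < t by rewrite divr_gt0.
have [te th] : t < e' /\ t < h0.
  have : t < Num.min e' h0 by rewrite /t gtr_pMr// invf_lt1// ltr1n.
  by rewrite lt_min => /andP.
pose r := d + sg * t.
have rd : `|r - d| = t by rewrite /r addrC addKr normrM sg1 mul1r gtr0_norm.
have [vp' vm'] : 0 < v (c r h) /\ v (c r (- h)) < 0.
  by apply: (e'P r); rewrite -ball_normE /ball_/= distrC rd.
have rh0 : `|r - d| < h0 by rewrite rd.
have [|x x1 x2||s [s1 s2 vs]] := @IVT_root R (fun s => v (c r s)) (- h) h.
- by rewrite -subr_ge0 opprK addr_ge0// ltW.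
- have xh0 : `|x| < h0 by apply: le_lt_trans hh; rewrite ler_norml x1.
  by have [[? _ ?] ? _] := hb x r xh0 rh0; exact: cont_s.
- by rewrite ltW// nmulr_rlt0.
have sh0 : `|s| < h0 by apply: le_lt_trans hh; rewrite ler_norml s1.
have [_ _ K] := hb s r sh0 rh0.
have := K vs; rewrite /r addrC addKr mulrA sg2 mul1r leNgt tp//.
Qed.

Variable e : R.
Hypothesis muN : mu ys = e *: N.
Hypothesis e1 : e * e = 1.

(** The parallel curve at height [d] touches [Y] at [ys] from one side, so [w * v] has a minimum
    along it and [second_order_min] applies. The two terms without the derivative of [mu] come from
    the normal part of the derivative of [Xi], found by differentiating [<nu, theta> = 0] and
    [<nu, shape_op> = 0]. *)
Lemma second_order_direction :
  0 <= sg * (e * dot ('D_(zeta + d *: B) mu ys) (zeta + d *: B) - dot B zeta - d * dot B B).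
Proof.
have [h0 h00 hb] := box.
have hh0 : `|0 : R| < h0 by rewrite normr0.
have dd0 : `|d - d| < h0 by rewrite subrr normr0.
have [[Ug _ dg] Uc _] := hb 0 d hh0 dd0.
pose w := sg * e.
have ww : w * w = 1 by rewrite /w mulrACA sg2 e1 mulr1.
(* Above zs the function v has the sign of w just beyond height d. *)
have [t [tp th wt]] : exists t, [/\ 0 < t, t < h0 & 0 < w * v (c (d + sg * t) 0)].
  have dl : is_derive (0 : R) (1 : R) (fun t => c (d + sg * t) 0) (sg *: N).
    have -> : (fun t => c (d + sg * t) 0) = (fun t => ys + t *: (sg *: N)).
      by apply/funext => t; rewrite -c0E /c g0 scalerDl addrA scalerA (mulrC t).
    exact: is_derive_line.
  have dw : is_derive (0 : R) (1 : R) (fun t => w * v (c (d + sg * t) 0)) (w * 'D_(sg *: N) v ys).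
    have E : c (d + sg * 0) 0 = ys by rewrite mulr0 addr0 c0E.
    have := is_derive_comp dl (f := v); rewrite E => /(_ (vdiff Uys)) h.
    exact: (is_deriveZ w h).
  have [|e' e'0 e'P] := is_derive_gt0 dw.
    rewrite (derive_ugrad oY sY gY)// muN dotZl dotZr NN mulr1 mulrCA (_ : w * (e * sg) = w * w); last by rewrite /w (mulrC e).
    by rewrite ww mulr1 (enorm_grad_gt0 oY sY gY).
  have mn0 : 0 < Num.min e' h0 by rewrite lt_min e'0.
  have : Num.min e' h0 / 2 < Num.min e' h0 by lra.
  rewrite lt_min => /andP[h1 h2]; exists (Num.min e' h0 / 2).
  have tp : 0 < Num.min e' h0 / 2 by rewrite divr_gt0.
  split => //; have [_] := e'P _ tp h1.
  by rewrite add0r mulr0 addr0 c0E v0 mulr0.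
have rdt t' : 0 <= t' -> t' <= t -> `|d + sg * t' - d| < h0.
  by move=> t'0 t't; rewrite addrC addKr normrM sg1 mul1r ger0_norm//; exact: le_lt_trans th.
have [[_ _ _] Ut _] := hb 0 (d + sg * t) hh0 (rdt t (ltW tp) (lexx t)).
have near_t : \forall s \near (0 : R), 0 < w * v (c (d + sg * t) s).
  have cc : {for 0, continuous (fun s => w * v (c (d + sg * t) s))}.
    by apply: continuousM; [exact: cst_continuous|exact: cont_s].
  exact: (near_gt cc wt).
have near_h : \forall s \near (0 : R), `|s| < h0.
  by apply/nbhs_ballP; exists h0 => // s; rewrite -ball_normE /ball_/= sub0r normrN.
(* A wrong sign at height [d] yields a zero of [v], thus a point of [Y], at height [d + sg * t']
   with [0 <= t']. Extremality leaves only [t' = 0], where [v] would be nonzero. *)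
have psi0 : \forall s \near (0 : R), 0 <= w * v (c d s).
  apply: filterS2 near_t near_h => s st sh; rewrite leNgt; apply/negP => sn.
  have [|t' t'0 t't||t' [t'0 t't vt']] := @IVT_root R (fun t' => w * v (c (d + sg * t') s)) 0 t.
  - exact: ltW.
  - have [_ Us _] := hb s (d + sg * t') sh (rdt t' t'0 t't).
    apply: continuousM; first exact: cst_continuous.
    apply: (@continuous_comp _ _ _ (fun t' => d + sg * t') (fun r => v (c r s))); last exact: cont_r.
    apply: continuousD; first exact: cst_continuous.
    by apply: continuousM; [exact: cst_continuous|exact: cvg_id].
  - by rewrite mulr0 addr0 ltW// nmulr_rlt0.
  have [_ _ K] := hb s (d + sg * t') sh (rdt t' t'0 t't).
  have w0 : w != 0 by apply/eqP => w0; move: ww; rewrite w0 mul0r => /esym/eqP; rewrite oner_eq0.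
  have vz : v (c (d + sg * t') s) = 0 by apply/eqP; move/eqP: vt'; rewrite mulf_eq0 (negbTE w0).
  have := K vz; rewrite addrC addKr mulrA sg2 mul1r => t'n.
  have t'e : t' = 0 by apply/eqP; rewrite eq_le t'n.
  by move: sn; rewrite t'e mulr0 addr0 in vz; rewrite vz mulr0 ltxx.
have main : \forall s \near (0 : R), [/\ w * v (c d 0) <= w * v (c d s),
    0 < enorm (grad v (c d s)) &
    is_derive s (1 : R) (fun s => w * v (c d s))
      (enorm (grad v (c d s)) * (w * dot (mu (c d s)) (Xi (g s))))].
  apply: filterS2 psi0 near_h => s sp sh; have [[U1 _ d1] U2 _] := hb s d sh dd0.
  split; first by rewrite c0E v0 mulr0.
    exact: (enorm_grad_gt0 oY sY gY).
  have hc := normal_curve_derive d U1 d1.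
  have h := is_deriveZ w (is_derive_comp hc (vdiff U2)).
  by apply: (is_derive_eq h); rewrite (derive_ugrad oY sY gY)// mulrCA.
have N1 : dot (nu zs) N != 0 by rewrite NN oner_neq0.
have dth := theta_differentiable lfZ zeta Uzs N1.
have dsh := shape_op_differentiable lfZ zeta Uzs N1.
have dXi : differentiable Xi zs.
  by apply: differentiableD => //; exact: differentiableZ.
have h1 : is_derive (0 : R) (1 : R) (fun s => mu (c d s)) ('D_(zeta + d *: B) mu ys).
  have h := normal_curve_derive d Ug dg; rewrite g0 t0 BE in h.
  by rewrite -c0E; apply: is_derive_comp => //; rewrite c0E; exact: (differentiable_ugrad oY sY gY).
have h2 : is_derive (0 : R) (1 : R) (fun s => Xi (g s)) ('D_zeta Xi zs).
  have dX0 : differentiable Xi (g 0) by rewrite g0.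
  by have := is_derive_comp dg dX0; rewrite g0 t0.
have := second_order_min main (is_deriveZ w (is_derive_dot h1 h2)).
rewrite c0E g0 muN /Xi t0 BE dotZl.
have -> : dot N ('D_zeta (fun x => theta u N zeta x + d *: shape_op u N zeta x) zs) =
    - dot B zeta - d * dot B B.
  have i1 : is_derive zs zeta (theta u N zeta) ('D_zeta (theta u N zeta) zs).
    by apply: derivableP; exact: diff_derivable.
  have i2 : is_derive zs zeta (shape_op u N zeta) ('D_zeta (shape_op u N zeta) zs).
    by apply: derivableP; exact: diff_derivable.
  have [_ ->] := is_deriveD i1 (is_deriveZ d i2).
  rewrite dotDr dotZr; congr (_ + _).
    by rewrite dotC (theta_derive lfZ) // t0 NN divr1 mulr1.
  rewrite -mulrN; congr (_ * _).
  have i3 : is_derive zs zeta nu B.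
    by apply: derivableP; apply: diff_derivable; exact: (differentiable_ugrad oZ sZ gZ).
  have hz : \forall y \near zs, 0 = dot (nu y) (shape_op u N zeta y).
    apply: filterS (open_nbhs_nbhs (conj oZ Uzs)) => y Uy.
    have -> : shape_op u N zeta y = 'D_(theta u N zeta y) nu y by apply: (shape_opE lfZ).
    by rewrite dotC; apply/esym; apply: dot_derive_ugrad oZ sZ gZ _ _ _.
  have [_] := is_derive_dot i3 i2.
  rewrite -(near_eq_derive _ hz) derive_cst BE => /esym/eqP.
  by rewrite addrC addr_eq0 => /eqP.
rewrite /w [_ *: _]/GRing.scale/= => h.
have E (D p q : R) : sg * (e * D - p - q) = sg * e * (D + e * (- p - q)).
  have -> : sg * e * (D + e * (- p - q)) = sg * e * D + sg * (e * e) * (- p - q) by ring.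
  by rewrite e1; ring.
by rewrite E; exact: h.
Qed.

End OneDirection.

Let dN := differentiable_ugrad oZ sZ gZ Uzs.
Let dM := differentiable_ugrad oY sY gY Uys.
Let MM : dot (mu ys) (mu ys) = 1 := dot_ugrad oY sY gY Uys.

Lemma normals_parallel : exists2 e, mu ys = e *: N & e * e = 1.
Proof.
pose zeta := tproj N (mu ys).
have Nz : dot N zeta = 0 by exact: dot_tproj.
have [g [g0 t0 gP]] := curve_exists lfZ Uzs Zzs Nz.
have z0 := transversal Nz g0 t0 gP erefl.
have muE : mu ys = dot N (mu ys) *: N.
  by apply/eqP; rewrite -subr_eq0; apply/eqP; exact: z0.
exists (dot N (mu ys)) => //.
by move: MM; rewrite {1 2}muE dotZl dotZr NN mulr1.
Qed.

(** [second_order_direction] is summed over the projected basis [zeta i]. Apart from the two mean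
    curvatures there are four terms, three linear in [d] and one quadratic; each is at most
    [kap^2 |d|], the quadratic one because [kap |d| <= 1/20]. *)
Lemma trace_comparison e : mu ys = e *: N -> e * e = 1 ->
  - (4 * kap ^+ 2 * `|d|) <= sg * (e * (\sum_(i < n.+1) sff mu ys (delta_mx 0 i) (delta_mx 0 i))
       - \sum_(i < n.+1) sff nu zs (delta_mx 0 i) (delta_mx 0 i)).
Proof.
move=> muE ee.
pose zeta i : V := tproj N (delta_mx 0 i).
pose B i : V := 'D_(zeta i) nu zs.
pose a i j := sff nu zs (delta_mx 0 i) (delta_mx 0 j).
pose l i j := sff mu ys (delta_mx 0 i) (delta_mx 0 j).
pose L x y := dot ('d mu ys x) y.
have Nz i : dot N (zeta i) = 0 by exact: dot_tproj.
have NBi i : dot N (B i) = 0 by rewrite dotC; apply: dot_derive_ugrad oZ sZ gZ _ _ _.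
have tpE x : tproj (mu ys) x = tproj N x.
  by rewrite /tproj muE dotZl scalerA mulrAC ee mul1r.
have muz x : dot N x = 0 -> dot (mu ys) x = 0 by move=> h; rewrite muE dotZl h mulr0.
have LE x y : dot ('D_x mu ys) y = L x y by rewrite /L deriveE.
have Bz i j : dot (B i) (zeta j) = a i j by [].
have Lz i j : L (zeta i) (zeta j) = l i j by rewrite -LE /l /sff !tpE.
have BE i : B i = \sum_j a i j *: zeta j.
  rewrite {1}(tproj_sum (NBi i)); apply: eq_bigr => j _; congr (_ *: _).
  rewrite -Bz /zeta /tproj dotBr dotZr (dotC (B i) N) NBi mulr0 subr0.
  by rewrite dot_delta.
have LD1 x y w : L (x + y) w = L x w + L y w by rewrite /L linearD dotDl.
have LZ1 k x w : L (k *: x) w = k * L x w by rewrite /L linearZ/= dotZl.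
have LzB i : L (zeta i) (B i) = \sum_j a i j * l i j.
  by rewrite BE /L dot_sumr; apply: eq_bigr => j _; rewrite dotZr -/(L _ _) Lz.
have LBz i : L (B i) (zeta i) = \sum_j a i j * l j i.
  rewrite BE /L linear_sum dotC dot_sumr; apply: eq_bigr => j _.
  by rewrite linearZ/= dotZr dotC -/(L _ _) Lz.
have BB i : dot (B i) (B i) = \sum_j a i j ^+ 2.
  by rewrite {2}BE dot_sumr; apply: eq_bigr => j _; rewrite dotZr Bz expr2.
have sq_le nu' p : Num.sqrt (\sum_(i < n.+1) \sum_(j < n.+1)
    sff nu' p (delta_mx 0 i) (delta_mx 0 j) ^+ 2) <= kap ->
    \sum_(i < n.+1) \sum_(j < n.+1) sff nu' p (delta_mx 0 i) (delta_mx 0 j) ^+ 2 <= kap ^+ 2.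
  move=> h; set A := \sum_i _ in h *.
  have A0 : 0 <= A by apply: sumr_ge0 => i _; apply: sumr_ge0 => j _; exact: sqr_ge0.
  rewrite -(sqr_sqrtr A0) lerXn2r// nnegrE ?sqrtr_ge0//; exact: ltW.
have Sa : \sum_i \sum_j a i j ^+ 2 <= kap ^+ 2.
  by apply: sq_le; apply: kZ => //; exact: (unit_normal_near_ugrad oZ sZ gZ (@lf_zero _ _ _ _ _ lfZ)).
have Sl : \sum_i \sum_j l i j ^+ 2 <= kap ^+ 2.
  by apply: sq_le; apply: kY => //; exact: (unit_normal_near_ugrad oY sY gY (@lf_zero _ _ _ _ _ lfY)).
have H : 0 <= sg * (e * (\sum_i L (zeta i + d *: B i) (zeta i + d *: B i)) - \sum_i a i i -
    d * \sum_i dot (B i) (B i)).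
  rewrite !mulr_sumr -!sumrB mulr_sumr; apply: sumr_ge0 => i _.
  have [g [g0 t0 gP]] := curve_exists lfZ Uzs Zzs (Nz i).
  have h : 0 <= sg * (e * dot ('D_(zeta i + d *: B i) mu ys) (zeta i + d *: B i)
    - a i i - d * dot (B i) (B i)) := second_order_direction g0 t0 gP muE ee.
  exact: (eq_ind _ (fun D => 0 <= sg * (e * D - a i i - d * dot (B i) (B i))) h _ (LE _ _)).
have E : \sum_i L (zeta i + d *: B i) (zeta i + d *: B i) = \sum_i l i i +
   d * \sum_i L (zeta i) (B i) + d * \sum_i L (B i) (zeta i) + d ^+ 2 * \sum_i L (B i) (B i).
  rewrite !mulr_sumr -!big_split/=; apply: eq_bigr => i _.
  rewrite LD1 LZ1 -Lz /L !dotDr !dotZr; ring.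
have LBB i : `|L (B i) (B i)| <= kap * dot (B i) (B i).
  have h : `|dot ('D_(B i) mu ys) (B i)| <= kap * (enorm (B i) * enorm (B i)) :=
    sff_tangent_le lfY kY Uys Yys (muz _ (NBi i)) (muz _ (NBi i)).
  have eB : enorm (B i) * enorm (B i) = dot (B i) (B i) by rewrite -expr2 sqr_enorm.
  exact: (eq_ind _ (fun D => `|D| <= kap * dot (B i) (B i))
    (eq_ind _ (fun D => _ <= kap * D) h _ eB) _ (LE _ _)).
have {}H := eq_ind _ (fun D => 0 <= sg * (e * D - \sum_i a i i -
    d * \sum_i dot (B i) (B i))) H _ E.
suff : - (4 * kap ^+ 2 * `|d|) <= sg * (e * (\sum_i l i i) - \sum_i a i i) by exact.
clear E LE Lz Bz BE LD1 LZ1 tpE; clearbody a l L B.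
have cross (m : 'I_n.+1 -> 'I_n.+1 -> R) : \sum_i \sum_j m i j ^+ 2 <= kap ^+ 2 ->
    `|\sum_i \sum_j a i j * m i j| <= kap ^+ 2.
  by move=> Sm; have := sum_amgm a m; lra.
have X1 : `|\sum_i L (zeta i) (B i)| <= kap ^+ 2.
  by under eq_bigr do rewrite LzB; exact: cross.
have X2 : `|\sum_i L (B i) (zeta i)| <= kap ^+ 2.
  by under eq_bigr do rewrite LBz; apply: (cross (fun i j => l j i)); rewrite exchange_big.
have X3 : \sum_i dot (B i) (B i) <= kap ^+ 2 by under eq_bigr do rewrite BB.
have X30 : 0 <= \sum_i dot (B i) (B i) by apply: sumr_ge0 => i _; exact: dotvv_ge0.
have X4 : `|\sum_i L (B i) (B i)| <= kap * kap ^+ 2.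
  apply: (le_trans (ler_norm_sum _ _ _)); apply: (@le_trans _ _ (\sum_i kap * dot (B i) (B i))).
    by apply: ler_sum => i _; exact: LBB.
  by rewrite -mulr_sumr ler_wpM2l// ltW.
move: H; set x1 := \sum_i L (zeta i) (B i); set x2 := \sum_i L (B i) (zeta i).
set x3 := \sum_i dot (B i) (B i); set x4 := \sum_i L (B i) (B i).
set tl := \sum_i l i i; set ta := \sum_i a i i => H.
have en : `|e| = 1.
  have : `|e| ^+ 2 = 1 by rewrite real_normK ?num_real// expr2.
  by move=> /eqP; rewrite sqrp_eq1 ?normr_ge0// => /eqP.
have b1 : `|sg * (e * (d * x1))| <= `|d| * kap ^+ 2.
  by rewrite !normrM sg1 en !mul1r ler_wpM2l.
have b2 : `|sg * (e * (d * x2))| <= `|d| * kap ^+ 2.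
  by rewrite !normrM sg1 en !mul1r ler_wpM2l.
have b3 : `|sg * (d * x3)| <= `|d| * kap ^+ 2.
  by rewrite !normrM sg1 !mul1r ler_wpM2l// ger0_norm.
have b4 : `|sg * (e * (d ^+ 2 * x4))| <= `|d| * kap ^+ 2.
  rewrite !normrM sg1 en !mul1r -expr2.
  apply: (@le_trans _ _ (`|d| ^+ 2 * (kap * kap ^+ 2))); first by rewrite ler_wpM2l// exprn_ge0.
  have -> : `|d| ^+ 2 * (kap * kap ^+ 2) = (kap * `|d|) * (`|d| * kap ^+ 2) by ring.
  have p0 : 0 <= `|d| * kap ^+ 2 by rewrite mulr_ge0// sqr_ge0.
  by rewrite ler_piMl//; apply: (le_trans kd); lra.
have : sg * (e * (tl + d * x1 + d * x2 + d ^+ 2 * x4) - ta - d * x3) =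
  sg * (e * tl - ta) + sg * (e * (d * x1)) + sg * (e * (d * x2)) + sg * (e * (d ^+ 2 * x4)) - sg * (d * x3) by ring.
move=> E; rewrite {}E in H.
move: b1 b2 b3 b4; rewrite !ler_norml => /andP[b1 b1'] /andP[b2 b2'] /andP[b3 b3'] /andP[b4 b4'].
lra.
Qed.

End Comparison.

Lemma dot_mean_curvature (R : realType) (n : nat) nu (p w : 'rV[R]_n.+1) :
  dot (mean_curvature_vector nu p) w =
  - (\sum_(i < n.+1) sff nu p (delta_mx 0 i) (delta_mx 0 i)) * dot (nu p) w.
Proof. by rewrite /mean_curvature_vector dotZl. Qed.

Lemma max_principle (R : realType) (n : nat) (Y Z : set 'rV[R]_n.+1) kap sg ys zs :
  hypersurface Y -> hypersurface Z -> sff_le Y kap -> sff_le Z kap -> 0 < kap ->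
  Y ys -> Z zs -> normal_to Z zs (ys - zs) -> ys != zs -> kap * enorm (ys - zs) <= 1 / 20 ->
  `|sg| = 1 ->
  (exists2 del : R, 0 < del & forall y z, Y y -> Z z -> enorm (y - ys) < del -> enorm (z - zs) < del ->
    normal_to Z z (y - z) -> sg * (enorm (y - z) - enorm (ys - zs)) <= 0) ->
  exists mu nu, [/\ unit_normal_near Y ys mu, unit_normal_near Z zs nu &
    sg * dot (mean_curvature_vector mu ys - mean_curvature_vector nu zs) (ys - zs) <=
      4 * kap ^+ 2 * sqdist ys zs].
Proof.
move=> hY hZ kY kZ k0 Yys Zzs nz yz kd sg1 [del del0 hl].
have [UZ [u [lfZ Uzs]]] := hypersurface_level_fun hZ Zzs.
have [UY [v [lfY Uys]]] := hypersurface_level_fun hY Yys.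
have NN := dot_ugrad (lf_open lfZ) (lf_smooth lfZ) (lf_reg lfZ) Uzs.
set N := ugrad u zs in NN.
set d := dot (ys - zs) N.
have dE : ys - zs = d *: N by exact: (normal_toE lfZ Uzs Zzs nz).
have dd : enorm (ys - zs) = `|d| by rewrite dE enormZ (enorm_ugrad (lf_open lfZ) (lf_smooth lfZ) (lf_reg lfZ))// mulr1.
have d0 : d != 0 by apply: contra_neq yz => d0; apply/eqP; rewrite -subr_eq0 dE d0 scale0r.
have ysE : ys = zs + d *: N by rewrite -dE addrC subrK.
rewrite dd in kd.
(* Near [d] one has [|r| - |d| = Num.sg d * (r - d)], so an extremum of the distance is one of the
   signed height with the sign corrected by that of [d]. *)
pose sg' := sg * Num.sg d.
have sg'1 : `|sg'| = 1 by rewrite normrM sg1 mul1r normr_sg d0.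
have hloc : exists2 del : R, 0 < del & forall (r : R) z, Z z -> UZ z ->
  Y (z + r *: ugrad u z) -> enorm (z - zs) < del -> `|r - d| < del -> sg' * (r - d) <= 0.
  have cn : {for zs, continuous (ugrad u)}.
    by apply: differentiable_continuous; exact: (differentiable_ugrad (lf_open lfZ) (lf_smooth lfZ) (lf_reg lfZ)).
  have cc : {for (zs, d), continuous (fun p : 'rV[R]_n.+1 * R => p.1 + p.2 *: ugrad u p.1)}.
    apply: continuousD; first exact: cvg_fst.
    apply: continuousZ; first exact: cvg_snd.
    by apply: (@continuous_comp _ _ _ fst (ugrad u)); [exact: cvg_fst|exact: cn].
  have nb : nbhs (zs + d *: N) [set x | enorm (x - ys) < del] by rewrite ysE; exact: near_enorm.
  have [[A1 A2]/= [nA1 nA2] AU] := cc _ nb.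
  have /nbhs_enormP[e1 e10 e1P] := nA1.
  have /nbhs_ballP[e2 /= e20 e2P] := nA2.
  exists (Num.min (Num.min e1 del) (Num.min e2 `|d|)).
    by rewrite !lt_min e10 del0 e20 normr_gt0.
  move=> r z Zz Uz Yr; rewrite !lt_min => /andP[/andP[z1 z2] _] /andP[_ /andP[r1 r2]].
  have A1z : A1 z by exact: e1P.
  have A2r : A2 r by apply: e2P; rewrite -ball_normE /ball_/= distrC.
  have yn : enorm (z + r *: ugrad u z - ys) < del by exact: (AU (z, r)).
  have := hl _ _ Yr Zz yn z2; rewrite addrC addKr => /(_ (normal_to_ugrad _ lfZ Uz)).
  rewrite dd enormZ (enorm_ugrad (lf_open lfZ) (lf_smooth lfZ) (lf_reg lfZ))// mulr1 => K.
  rewrite /sg' -mulrA; suff -> : Num.sg d * (r - d) = `|r| - `|d| by [].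
  case: (ltgtP d 0) d0 => // ds _.
    move: r2; rewrite (ltr0_norm ds) ltr_norml => /andP[_ r2].
    have r0 : r < 0 by lra.
    by rewrite ltr0_sg// ltr0_norm//; ring.
  move: r2; rewrite (gtr0_norm ds) ltr_norml => /andP[r2 _].
  have r0 : 0 < r by lra.
  by rewrite gtr0_sg// gtr0_norm//; ring.
have [e muE ee] := normals_parallel lfZ lfY Uzs Uys Zzs Yys kZ ysE kd sg'1 hloc.
have T := trace_comparison lfZ lfY Uzs Uys Zzs Yys kY kZ ysE k0 kd sg'1 hloc muE ee.
exists (ugrad v), (ugrad u); split.
- exact: (unit_normal_near_ugrad (lf_open lfY) (lf_smooth lfY) (lf_reg lfY) (@lf_zero _ _ _ _ _ lfY)).
- exact: (unit_normal_near_ugrad (lf_open lfZ) (lf_smooth lfZ) (lf_reg lfZ) (@lf_zero _ _ _ _ _ lfZ)).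
have f1 : dot N (ys - zs) = d by rewrite dotC.
have f2 : dot (ugrad v ys) (ys - zs) = e * d by rewrite muE dotZl f1.
have f3 : sqdist ys zs = d * d by rewrite /sqdist -(opprB ys) dE dotNl dotNr opprK dotZl dotZr NN mulr1.
have K (tl ta : R) : - (4 * kap ^+ 2 * `|d|) <= sg' * (e * tl - ta) ->
    sg * (- tl * (e * d) - - ta * d) <= 4 * kap ^+ 2 * (d * d).
  move=> {}T.
  have -> : sg * (- tl * (e * d) - - ta * d) = - `|d| * (sg' * (e * tl - ta)).
    by rewrite /sg' {1 2}(numEsg d); ring.
  have -> : 4 * kap ^+ 2 * (d * d) = - `|d| * - (4 * kap ^+ 2 * `|d|).
    have -> : d * d = `|d| * `|d| by rewrite -!expr2 real_normK ?num_real.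
    ring.
  by rewrite !mulNr lerN2 ler_wpM2l.
rewrite dotBl !dot_mean_curvature f1 f2 f3; exact: K T.
Qed.

(** * Pairs of mean curvature flows *)

Section Topology.
Variables (R : realType) (n : nat).
Local Notation V := 'rV[R]_n.+1.

(** Used on the parameter manifold of a flow: the image of a small connected neighbourhood is a
    connected sheet of the slice. *)
Lemma hypersurface_locally_connected (N : set V) q (A : set V) :
  hypersurface N -> N q -> nbhs q A ->
  exists C, [/\ connected C, forall x, C x -> N x /\ A x & \forall x \near q, N x -> C x].
Proof.
move=> hN Nq nA; have [U [u [lf Uq]]] := hypersurface_level_fun hN Nq.
have [oU su gu _] := lf.
have [r [eps [k [C CA]]]] := level_chart_exists oU su gu Uq ((lf_zero lf Uq).1 Nq) nA.
set m := ugrad u q in C CA.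
have r0 := lc_r0 C.
have coordP := level_chart_coord lf Uq C; have chartP := level_chart_mem lf Uq C.
have cq : cylinder q m r eps q := cylinder_center _ _ r0 (lc_eps0 C).
exists (N `&` cylinder q m r eps); split.
- apply: (@path_connected_sublevel _ _ _ q (fun x s => chart q m k (0 + s *: tproj m (x - q)))) => [//|x [Nx cx]].
  have [d e] := coordP x Nx cx.
  have ds s : 0 <= s -> s <= 1 -> disc m r (0 + s *: tproj m (x - q)).
    move=> s0 s1; have s01 : 0 <= s <= 1 by rewrite s0.
    by have := disc_convex s01 (disc0 m r0) d; rewrite subr0.
  split.
  + have [_] := coordP q Nq cq.
    by rewrite subrr /tproj dot0r scale0r subrr scale0r addr0 => <-.
  + by rewrite scale1r add0r -e.
  + by move=> s s0 s1; exact: (chartP _ (ds s s0 s1)).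
  + apply: continuous_in_subspaceT => s; rewrite inE/= in_itv/= => /andP[s0 s1].
    apply: differentiable_continuous; apply/derivable1_diffP.
    by case: (lc_derive C d.1 (ds s s0 s1)).
- by move=> x [Nx cx]; split => //; exact: CA.
- by apply: filterS (open_nbhs_nbhs (conj (@cylinder_open _ _ q m r eps) cq)) => x cx Nx; split.
Qed.

(** The part of [M] away from [p] is compact, and its image is closed and misses [f p]. This turns a
    local minimum in the parameter into a local minimum on the slice. *)
Lemma injective_image_nbhs (M A : set V) (f : V -> V) p : compact M ->
  (forall p, M p -> {for p, continuous f}) ->
  (forall p q, M p -> M q -> f p = f q -> p = q) -> M p -> nbhs p A ->
  \forall y \near f p, forall q, M q -> f q = y -> A q.
Proof.
move=> cM cf injf Mp nA.
have cK : compact (M `&` ~` A^°).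
  by apply: compact_closedI => //; apply: open_closedC; exact: open_interior.
have cfK : closed (f @` (M `&` ~` A^°)).
  apply: compact_closed; first exact: norm_hausdorff.
  apply: continuous_compact => //; apply: continuous_in_subspaceT => x.
  by rewrite inE => -[Mx _]; exact: cf.
have nb : nbhs (f p) (~` (f @` (M `&` ~` A^°))).
  apply: open_nbhs_nbhs; split; first exact: closed_openC.
  by move=> [q [Mq Aq] fq]; apply: Aq; rewrite (injf q p).
apply: filterS nb => y ny q Mq fq; apply: contrapT => Aq; apply: ny.
by exists q => //; split => // /interior_subset.
Qed.

Lemma compact_tube (K : set V) (t0 : R) (P : R -> V -> Prop) : compact K ->
  (forall x, K x -> \forall z \near (t0, x), P z.1 z.2) ->
  \forall t \near t0, forall x, K x -> P t x.
Proof.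
move=> /compact_near_coveringP cK H; apply: (cK R (nbhs t0) P) => x Kx.
have [[A B]/= [nA nB] AB] := H x Kx.
by exists (B, A) => //= -[x' t] [/= Bx At]; exact: (AB (t, x')).
Qed.

Lemma near_prod (t0 : R) (p0 : V) (A : set (R * V)) : nbhs (t0, p0) A ->
  exists2 e : R, 0 < e & forall t p, `|t - t0| < e -> enorm (p - p0) < e -> A (t, p).
Proof.
move=> [[B C]/= [/nbhs_ballP[e1 /= e10 eB] /nbhs_enormP[e2 e20 eC]] BC].
exists (Num.min e1 e2); first by rewrite lt_min e10.
move=> t p; rewrite !lt_min => /andP[t1 _] /andP[_ p2].
by apply: (BC (t, p)); split; [apply: eB; rewrite -ball_normE /ball_/= distrC|exact: eC].
Qed.

Lemma near_prod3 (t0 : R) (p0 q0 : V) (A : set (R * V * V)) : nbhs (t0, p0, q0) A ->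
  exists2 e : R, 0 < e &
  forall t p q, `|t - t0| < e -> enorm (p - p0) < e -> enorm (q - q0) < e -> A (t, p, q).
Proof.
move=> [[B C]/= [nB /nbhs_enormP[e2 e20 eC]] BC].
have [e1 e10 eB] := near_prod nB.
exists (Num.min e1 e2); first by rewrite lt_min e10.
move=> t p q; rewrite !lt_min => /andP[t1 _] /andP[p1 _] /andP[_ q2].
by apply: (BC (t, p, q)); split; [exact: eB|exact: eC].
Qed.

Lemma nbhs_prod3 (t0 : R) (p0 q0 : V) (e : R) : 0 < e ->
  nbhs (t0, p0, q0) [set z : R * V * V |
    [/\ `|z.1.1 - t0| < e, enorm (z.1.2 - p0) < e & enorm (z.2 - q0) < e]].
Proof.
move=> e0; exists ([set x : R * V | `|x.1 - t0| < e /\ enorm (x.2 - p0) < e], [set x | enorm (x - q0) < e]).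
  split => /=; last exact: near_enorm.
  exists ([set x | `|x - t0| < e], [set x | enorm (x - p0) < e]).
    split => /=; last exact: near_enorm.
    by apply/nbhs_ballP; exists e => // x; rewrite -ball_normE /ball_/= distrC.
  by move=> [x y].
by move=> [[x y] w] /= [[]].
Qed.

Lemma continuous_pair (T U W : topologicalType) (f : T -> U) (g : T -> W) x :
  {for x, continuous f} -> {for x, continuous g} -> {for x, continuous (fun x => (f x, g x))}.
Proof. by move=> cf cg; exact: (cvg_pair cf cg). Qed.

(** The consequences of [smooth_mcf] on which the comparison rests. The time derivative is
    continuous jointly in time and point, so it can be bounded for all nearby points at once. *)
Record mcf_on (I : set R) (Y : R -> set V) (M : set V) (F : R -> V -> V) : Prop := McfOn {
  mcf_compact : compact M;
  mcf_hyp : hypersurface M;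
  mcf_slice : forall t, I t -> compact_hypersurface (Y t);
  mcf_image : forall t, I t -> Y t = F t @` M;
  mcf_inj : forall t p q, I t -> M p -> M q -> F t p = F t q -> p = q;
  mcf_cont : forall t p, I t -> M p -> {for (t, p), continuous (fun z : R * V => F z.1 z.2)};
  mcf_derive : forall t p, I t -> M p -> is_derive t (1 : R) (F ^~ p) ('D_1 (F ^~ p) t);
  mcf_dcont : forall t p, I t -> M p ->
    {for (t, p), continuous (fun z : R * V => 'D_1 (F ^~ z.2) z.1)};
  mcf_velocity : forall t p nu, I t -> M p -> unit_normal_near (Y t) (F t p) nu ->
    'D_1 (F ^~ p) t = mean_curvature_vector nu (F t p) }.

Lemma smooth_mcf_on I Y : @smooth_mcf R n I Y -> exists M F, mcf_on I Y M F.
Proof.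
move=> [hY [M [F [W [[cM hM] oW IW sF fF]]]]]; exists M, F.
have WI t p : I t -> M p -> W (t, p) by move=> It Mp; exact: IW.
have cf := Ck_on_continuous (sF 0).
have [_ dF] := sF 1.
have [dF1 dF2] := dF (1, 0).
(* The joint directional derivative along [(1, 0)] is the time derivative at a fixed parameter. *)
have E (z : R * V) : 'D_(1, 0) (fun z : R * V => F z.1 z.2) z = 'D_1 (F ^~ z.2) z.1.
  rewrite /derive; set f := fun h => _; set g := fun h => _.
  suff -> : f = g by [].
  by apply/funext => h; rewrite /f /g /= scaler0 add0r.
have dd (z : R * V) : derivable (fun z : R * V => F z.1 z.2) z (1, 0) -> derivable (F ^~ z.2) z.1 1.
  rewrite /derivable; set f := fun h => _; set g := fun h => _.
  suff -> : f = g by [].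
  by apply/funext => h; rewrite /f /g /= scaler0 add0r.
split => //.
- by move=> t It; have [] := fF t It.
- by move=> t p q It; have [_ h _ _] := fF t It; exact: h.
- by move=> t p It Mp; apply: cf; exact: WI.
- by move=> t p It Mp; apply/derivableP; exact: (dd (t, p) (dF1 _ (WI _ _ It Mp))).
- move=> t p It Mp; have := dF2.1 _ (WI _ _ It Mp).
  have -> // : (fun z : R * V => 'D_(1, 0) (fun z : R * V => F z.1 z.2) z) =
    (fun z : R * V => 'D_1 (F ^~ z.2) z.1) by exact/funext.
- by move=> t p nu It Mp un; have [_ _ _ h] := fF t It; rewrite -derive1E; exact: h.
Qed.

End Topology.

Section TwoFlows.
Variables (R : realType) (n : nat).
Local Notation V := 'rV[R]_n.+1.
Variables (I : set R) (Y Z : R -> set V) (M N : set V) (F G : R -> V -> V).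
Hypotheses (fY : mcf_on I Y M F) (fZ : mcf_on I Z N G).

(** Pairs are labelled by parameters, so that one pair can be followed through time. *)
Let h t p q := sqdist (F t p) (G t q).

Let h3_continuous t p q : I t -> M p -> N q ->
  {for (t, p, q), continuous (fun z : R * V * V => h z.1.1 z.1.2 z.2)}.
Proof.
move=> It Mp Nq.
have cF : {for (t, p, q), continuous (fun z : R * V * V => F z.1.1 z.1.2)}.
  apply: (@continuous_comp _ _ _ fst (fun z : R * V => F z.1 z.2)); first exact: cvg_fst.
  exact: (mcf_cont fY It Mp).
have cG : {for (t, p, q), continuous (fun z : R * V * V => G z.1.1 z.2)}.
  apply: (@continuous_comp _ _ _ (fun z : R * V * V => (z.1.1, z.2)) (fun z : R * V => G z.1 z.2)).
    apply: continuous_pair; last exact: cvg_snd.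
    apply: (@continuous_comp _ _ _ (fun z : R * V * V => z.1) fst); [exact: cvg_fst|exact: cvg_fst].
  exact: (mcf_cont fZ It Nq).
by apply: dot_continuous; apply: continuousB.
Qed.

Let slice_cont t q : I t -> N q -> {for q, continuous (G t)}.
Proof.
move=> It Nq; apply: (@continuous_comp _ _ _ (fun x : V => (t, x)) (fun z : R * V => G z.1 z.2)).
  by apply: continuous_pair; [exact: cst_continuous|exact: cvg_id].
exact: (mcf_cont fZ It Nq).
Qed.

Lemma slice_min_normal t p q : I t -> N q ->
  (\forall x \near q, N x -> h t p q <= h t p x) ->
  normal_to (Z t) (G t q) (F t p - G t q).
Proof.
move=> It Nq hmin; have [cZ hZ] := mcf_slice fZ It.
have Zq : Z t (G t q) by rewrite (mcf_image fZ It); exists q.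
apply: local_min_normal => //.
have := injective_image_nbhs (mcf_compact fZ) (fun x Nx => slice_cont It Nx)
  (fun x y Nx Ny => mcf_inj fZ It Nx Ny) Nq hmin.
apply: filterS => z H; rewrite (mcf_image fZ It) => -[x Nx xz].
have := H x Nx xz Nx; rewrite /h xz /sqdist -(opprB (F t p)) -(opprB (F t p) z).
by rewrite !dotNl !dotNr !opprK.
Qed.

(** A single connected [C] serves all nearby times and points: its images stay within [1.1 / kap t]
    of [F t p], as [sheet_strict_min] requires. This uniformity is what permits limits of critical
    pairs and minimisation at earlier times. *)
Lemma local_sheet (kap : R -> R) (ta tb t0 : R) p0 q0 (A : set V) :
  (forall t, ta <= t -> t <= tb -> [/\ I t, 0 < kap t, sff_le (Z t) (kap t) &
     {for t, continuous kap}]) ->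
  ta <= t0 -> t0 <= tb -> M p0 -> N q0 -> nbhs q0 A ->
  kap t0 * enorm (G t0 q0 - F t0 p0) < 11 / 10 ->
  exists C (e : R), [/\ 0 < e, forall x, C x -> N x /\ A x,
    forall x, N x -> enorm (x - q0) < e -> C x &
    forall t p q, ta <= t -> t <= tb -> `|t - t0| < e -> M p -> enorm (p - p0) < e -> C q ->
      normal_to (Z t) (G t q) (F t p - G t q) -> kap t * enorm (F t p - G t q) <= 5 / 100 ->
      forall x, C x -> x != q -> h t p q < h t p x].
Proof.
move=> hk at0 t0b Mp0 Nq0 nA k0.
have [I0 _ _ ck] := hk t0 at0 t0b.
have cK : {for (t0, p0, q0), continuous (fun z : R * V * V => kap z.1.1 * enorm (G z.1.1 z.2 - F z.1.1 z.1.2))}.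
  apply: continuousM.
    apply: (@continuous_comp _ _ _ (fun z : R * V * V => z.1.1) kap) => //.
    by apply: (@continuous_comp _ _ _ (fun z : R * V * V => z.1) fst); [exact: cvg_fst|exact: cvg_fst].
  have -> : (fun z : R * V * V => enorm (G z.1.1 z.2 - F z.1.1 z.1.2)) =
            (fun z => Num.sqrt (h z.1.1 z.1.2 z.2)) by [].
  apply: (@continuous_comp _ _ _ (fun z : R * V * V => h z.1.1 z.1.2 z.2) Num.sqrt); first exact: h3_continuous.
  exact: sqrt_continuous.
have /near_prod3[e1 e10 e1P] := near_lt cK k0.
have nB : nbhs q0 (A `&` [set x | enorm (x - q0) < e1]) by apply: filterI => //; exact: near_enorm.
have [C [cC CN nC]] := hypersurface_locally_connected (mcf_hyp fZ) Nq0 nB.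
have /nbhs_enormP[e2 e20 e2P] := nC.
exists C, (Num.min e1 e2); split.
- by rewrite lt_min e10.
- by move=> x /CN[Nx [Ax _]].
- by move=> x Nx; rewrite lt_min => /andP[_ x2]; exact: e2P.
move=> t p q ta_t t_tb; rewrite !lt_min => /andP[te _] Mp /andP[pe _] Cq nq kq x Cx xq.
have [It kt st _] := hk t ta_t t_tb.
have Nq : N q by have [] := CN q Cq.
have Nx : N x by have [] := CN x Cx.
apply: (@sheet_strict_min _ _ (Z t) (kap t) (F t p) (G t q) (G t x) (G t @` C)) => //.
- exact: (mcf_slice fZ It).
- by rewrite (mcf_image fZ It); exists q.
- apply: connected_continuous_connected => //; apply: continuous_in_subspaceT => y.
  by rewrite inE => /CN[Ny _]; exact: slice_cont.
- move=> _ [y Cy <-]; have [Ny [_ ye]] := CN y Cy; split.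
    by rewrite (mcf_image fZ It); exists y.
  exact: (e1P t p y).
- by apply: contra_neq xq; exact: (mcf_inj fZ It).
Qed.


(** * Windows of distances free of normal pairs *)

Section Gap.
Variables (ta tb : R) (kap phi cc : R -> R).
Hypothesis slices : forall t, ta <= t -> t <= tb ->
  [/\ I t, 0 < kap t, sff_le (Y t) (kap t), sff_le (Z t) (kap t) & {for t, continuous kap}].
(** The bound [1 / 400] is the square of the [1 / 20] that the minimality lemma and the maximum
    principle demand of [kap |y - z|]. *)
Hypothesis window : forall t, ta <= t -> t <= tb ->
  [/\ 0 < phi t, phi t < cc t, kap t ^+ 2 * cc t <= 1 / 400,
      {for t, continuous phi} & {for t, continuous cc}].

(* y - z normal to Z_t and |y - z|^2 in the window [phi, cc] that is to stay free. *)
Definition critical t p q :=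
  [/\ M p, N q, normal_to (Z t) (G t q) (F t p - G t q), phi t <= h t p q & h t p q <= cc t].

Let hE t p q : h t p q = enorm (F t p - G t q) ^+ 2.
Proof. by rewrite /h sqdistE -enormN opprB. Qed.

Let small t p q : ta <= t -> t <= tb -> h t p q <= cc t ->
  kap t * enorm (F t p - G t q) <= 5 / 100.
Proof.
move=> a b hc; have [_ k0 _ _ _] := slices a b; have [_ _ kc _ _] := window a b.
have p5 : (0 : R) <= 5 / 100 by lra.
rewrite -(@ler_pXn2r _ 2)// ?nnegrE ?mulr_ge0 ?enorm_ge0//; last exact: ltW.
rewrite exprMn -hE; apply: (le_trans (ler_wpM2l (sqr_ge0 _) hc)).
by apply: (le_trans kc); lra.
Qed.

Let sheet t0 p0 q0 : ta <= t0 -> t0 <= tb -> M p0 -> N q0 -> h t0 p0 q0 <= cc t0 ->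
  exists C (e : R), [/\ 0 < e, forall x, C x -> N x,
    forall x, N x -> enorm (x - q0) < e -> C x &
    forall t p q, ta <= t -> t <= tb -> `|t - t0| < e -> enorm (p - p0) < e -> C q ->
      critical t p q -> forall x, C x -> x != q -> h t p q < h t p x].
Proof.
move=> a b Mp Nq hc.
have kk : kap t0 * enorm (G t0 q0 - F t0 p0) < 11 / 10.
  by rewrite -enormN opprB; apply: (le_lt_trans (small a b hc)); lra.
have data t : ta <= t -> t <= tb -> [/\ I t, 0 < kap t, sff_le (Z t) (kap t) &
     {for t, continuous kap}] by move=> at_ tb_; have [] := slices at_ tb_.
have [C [e [e0 CN NC H]]] := local_sheet data a b Mp Nq filterT kk.
exists C, e; split => // [x /CN[]//|t p q a' b' te pe Cq [Mp' Nq' nn _ hc'] x Cx xq].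
by apply: (H t p q) => //; exact: small.
Qed.

(* Minimising over a small neighbourhood of the strict minimum q produces normal
   pairs with the same p at slightly earlier times. *)
Lemma critical_persists t0 p q (e : R) : ta < t0 -> t0 <= tb -> critical t0 p q -> 0 < e ->
  (forall t x, ta <= t -> t0 - e < t -> t < t0 -> N x -> enorm (x - q) < e ->
     h t0 p q <= h t0 p x -> phi t <= h t p x) ->
  (forall t, ta <= t -> t0 - e < t -> t < t0 -> h t p q <= cc t) ->
  exists t x, [/\ ta <= t, t < t0 & critical t p x].
Proof.
move=> at0 t0b cr e0 HL HU; have [Mp Nq nq pq qc] := cr.
have [It0 _ _ _ _] := slices (ltW at0) t0b.
have [C [e1 [e10 CN NC HC]]] := sheet (ltW at0) t0b Mp Nq qc.
have Cq : C q by apply: NC => //; rewrite subrr enorm0.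
have smin x : C x -> x != q -> h t0 p q < h t0 p x.
  by apply: (HC t0 p q) => //; rewrite ?subrr ?enorm0 ?normr0// ltW.
pose e2 := Num.min e e1 / 2.
have m0 : 0 < Num.min e e1 by rewrite lt_min e0.
have e20 : 0 < e2 by rewrite divr_gt0.
have [e2e e2e1] : e2 < e /\ e2 < e1.
  by apply/andP; rewrite -lt_min /e2 gtr_pMr// invf_lt1// ltr1n.
have cn : continuous (fun x : V => enorm (x - q)).
  move=> x; have c : {for x, continuous (fun y : V => y - q)}.
    by apply: continuousB; [exact: cvg_id|exact: cst_continuous].
  exact: (enorm_continuous c).
have cK' : compact (N `&` [set x | enorm (x - q) <= e2]).
  apply: compact_closedI; first exact: (mcf_compact fZ).
  apply: (@closed_comp _ _ (fun x : V => enorm (x - q)) [set y | y <= e2]); last exact: closed_le.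
  by move=> x _; exact: cn.
(* On this shell strict minimality at [t0] persists for nearby times by compactness. The minimiser
   over the ball at time [t] therefore lies inside the shell and is a local minimum on [N]. *)
have cK : compact (N `&` [set x | enorm (x - q) <= e2] `&` [set x | e2 / 2 <= enorm (x - q)]).
  apply: compact_closedI => //.
  apply: (@closed_comp _ _ (fun x : V => enorm (x - q)) [set y | e2 / 2 <= y]); last exact: closed_ge.
  by move=> x _; exact: cn.
have tube : \forall t \near t0, forall x,
    (N `&` [set x | enorm (x - q) <= e2] `&` [set x | e2 / 2 <= enorm (x - q)]) x ->
    h t p q < h t p x.
  apply: (compact_tube cK) => x [[Nx xe] xe'].
  have Cx : C x by apply: NC => //; exact: le_lt_trans e2e1.
  have xq : x != q by apply: contraTneq xe' => ->; rewrite subrr enorm0 -ltNge divr_gt0.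
  have c (y : V) : N y -> {for (t0, x), continuous (fun z : R * V => (z.1, p, y))}.
    move=> Ny; apply: continuous_pair; last exact: cst_continuous.
    by apply: continuous_pair; [exact: cvg_fst|exact: cst_continuous].
  apply: (@near_ltC _ _ (fun z : R * V => h z.1 p q) (fun z : R * V => h z.1 p z.2)); last exact: smin.
    by apply: (@continuous_comp _ _ _ (fun z : R * V => (z.1, p, q)) (fun z : R * V * V => h z.1.1 z.1.2 z.2)); [exact: c|exact: h3_continuous].
  apply: (@continuous_comp _ _ _ (fun z : R * V => (z.1, p, z.2)) (fun z : R * V * V => h z.1.1 z.1.2 z.2)); last exact: h3_continuous.
  apply: continuous_pair; last exact: cvg_snd.
  by apply: continuous_pair; [exact: cvg_fst|exact: cst_continuous].
have /nbhs_ballP[e3 /= e30 e3P] := tube.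
have m1 : 0 < Num.min e e3 by rewrite lt_min e0.
pose d := Num.min e e3 / 2.
have d0 : 0 < d by rewrite divr_gt0.
have [de de3] : d < e /\ d < e3.
  by apply/andP; rewrite -lt_min /d gtr_pMr// invf_lt1// ltr1n.
pose t := Num.max ta (t0 - d).
have at_ : ta <= t by rewrite le_max lexx.
have tt0 : t < t0 by rewrite gt_max at0 ltrBlDr ltrDl.
have td : t0 - d <= t by rewrite le_max lexx orbT.
have tb_ : t <= tb by apply: ltW; exact: lt_le_trans t0b.
have tet : t0 - e < t by apply: lt_le_trans td; rewrite ltrD2l ltrN2.
have [It _ _ _ _] := slices at_ tb_.
have bt : ball t0 e3 t.
  by rewrite -ball_normE /ball_/= gtr0_norm ?subr_gt0//; apply: le_lt_trans de3; rewrite lerBlDl -lerBlDr.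
have cw : {within N `&` [set x | enorm (x - q) <= e2], continuous (fun x => h t p x)}.
  apply: continuous_in_subspaceT => x; rewrite inE => -[Nx _].
  apply: (@continuous_comp _ _ _ (fun x : V => (t, p, x)) (fun z : R * V * V => h z.1.1 z.1.2 z.2)); last exact: h3_continuous.
  by apply: continuous_pair; [exact: cst_continuous|exact: cvg_id].
have K'q : (N `&` [set x | enorm (x - q) <= e2]) q by split => //=; rewrite subrr enorm0 ltW.
have [x] := compact_EVT_min (ex_intro _ q K'q) cK' cw.
rewrite inE => -[Nx xe] xmin.
have xq : h t p x <= h t p q by apply: xmin; rewrite inE.
have xe2 : enorm (x - q) < e2 / 2.
  rewrite ltNge; apply/negP => xe'.
  by have := e3P t bt x (conj (conj Nx xe) xe'); rewrite ltNge xq.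
have xltq : enorm (x - q) < e2 by apply: lt_trans xe2 _; rewrite gtr_pMr// invf_lt1// ltr1n.
exists t, x; split => //; split => //.
- apply: slice_min_normal => //.
  have := nbhs_enorm_lt xltq; apply: filterS => y yq Ny; apply: xmin.
  by rewrite inE; split => //; exact: ltW.
- apply: HL => //; first exact: lt_trans e2e.
  have [->//|xnq] := eqVneq x q; apply: ltW; apply: smin => //; apply: NC => //.
  exact: lt_trans e2e1.
- by apply: (le_trans xq); exact: HU.
Qed.


Let c1 t0 (p0 q0 : V) (f : R -> R) : {for t0, continuous f} ->
  {for (t0, p0, q0), continuous (fun z : R * V * V => f z.1.1)}.
Proof.
move=> cf; apply: (@continuous_comp _ _ _ (fun z : R * V * V => z.1.1) f) => //.
by apply: (@continuous_comp _ _ _ (fun z : R * V * V => z.1) fst); [exact: cvg_fst|exact: cvg_fst].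
Qed.

Let near_h t0 p0 q0 f : ta <= t0 -> t0 <= tb -> M p0 -> N q0 -> {for t0, continuous f} ->
  (f t0 < h t0 p0 q0 -> \forall z \near (t0, p0, q0), f z.1.1 < h z.1.1 z.1.2 z.2) /\
  (h t0 p0 q0 < f t0 -> \forall z \near (t0, p0, q0), h z.1.1 z.1.2 z.2 < f z.1.1).
Proof.
move=> a b Mp Nq cf; have [It0 _ _ _ _] := slices a b.
have cf3 : {for (t0, p0, q0), continuous (fun z : R * V * V => f z.1.1)} by exact: c1.
have ch := h3_continuous It0 Mp Nq.
by split=> lt; [exact: (near_ltC cf3 ch lt)|exact: (near_ltC ch cf3 lt)].
Qed.

Let tball t t0 (e : R) : t0 - e < t -> t < t0 -> `|t - t0| < e.
Proof. by move=> a b; rewrite ltr0_norm ?subr_lt0// opprB ltrBlDl -ltrBlDr. Qed.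

Lemma critical_interior_persists t0 p q : ta < t0 -> t0 <= tb -> critical t0 p q ->
  phi t0 < h t0 p q -> h t0 p q < cc t0 ->
  exists t x, [/\ ta <= t, t < t0 & critical t p x].
Proof.
move=> at0 t0b cr ph hc; have [Mp Nq _ _ _] := cr.
have [_ _ _ cphi ccc] := window (ltW at0) t0b.
have [e1 e10 e1P] := near_prod3 ((near_h (ltW at0) t0b Mp Nq cphi).1 ph).
have [e2 e20 e2P] := near_prod3 ((near_h (ltW at0) t0b Mp Nq ccc).2 hc).
have pp : enorm (p - p) = 0 by rewrite subrr enorm0.
have qq : enorm (q - q) = 0 by rewrite subrr enorm0.
apply: (@critical_persists t0 p q (Num.min e1 e2)) => //; first by rewrite lt_min e10.
  move=> t x _ te tt0 Nx; rewrite lt_min => /andP[xe _] _.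
  apply: ltW; apply: (e1P t p x); rewrite ?pp//; apply: tball => //.
  by apply: le_lt_trans te; rewrite lerD2l lerN2 ge_min lexx.
move=> t _ te tt0; apply: ltW; apply: (e2P t p q); rewrite ?pp ?qq//; apply: tball => //.
by apply: le_lt_trans te; rewrite lerD2l lerN2 ge_min lexx orbT.
Qed.

Let D t p q := 2 * dot ('D_1 (F ^~ p) t - 'D_1 (G ^~ q) t) (F t p - G t q).

Let h_derive t p q : I t -> M p -> N q -> is_derive t (1 : R) (fun s => h s p q) (D t p q).
Proof.
move=> It Mp Nq.
have d1 : is_derive t (1 : R) (fun s => F s p - G s q) ('D_1 (F ^~ p) t - 'D_1 (G ^~ q) t).
  exact: (is_deriveB (mcf_derive fY It Mp) (mcf_derive fZ It Nq)).
have -> : (fun s => h s p q) = (fun s => dot (F s p - G s q) (F s p - G s q)).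
  by apply/funext => s; rewrite hE sqr_enorm.
by apply: (is_derive_eq (is_derive_dot d1 d1)); rewrite /D dotC -mulr2n mulr_natl.
Qed.

Let D_continuous t p q : I t -> M p -> N q -> {for (t, q), continuous (fun z : R * V => D z.1 p z.2)}.
Proof.
move=> It Mp Nq; rewrite /D; apply: continuousM; first exact: cst_continuous.
have cp : {for (t, q), continuous (fun z : R * V => (z.1, p))}.
  by apply: continuous_pair; [exact: cvg_fst|exact: cst_continuous].
apply: dot_continuous; apply: continuousB.
- by apply: (@continuous_comp _ _ _ (fun z : R * V => (z.1, p)) (fun z : R * V => 'D_1 (F ^~ z.2) z.1)); [exact: cp|exact: (mcf_dcont fY)].
- exact: (mcf_dcont fZ It Nq).
- by apply: (@continuous_comp _ _ _ (fun z : R * V => (z.1, p)) (fun z : R * V => F z.1 z.2)); [exact: cp|exact: (mcf_cont fY)].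
- exact: (mcf_cont fZ It Nq).
Qed.

Definition first_critical t0 p q := [/\ ta < t0, t0 <= tb, critical t0 p q &
  forall t x y, ta <= t -> t < t0 -> ~ critical t x y].

(** At a first critical time nothing critical lies strictly inside the window, as it would persist
    to earlier times. If nearby pairs on the [sg] side are strictly inside, the given pair is
    extremal among normal pairs. The constant 8 is the 4 of [max_principle] times the 2 from
    differentiating a square. *)
Lemma critical_derivative t0 p q sg : first_critical t0 p q -> `|sg| = 1 ->
  (exists2 del : R, 0 < del & forall s w, Y t0 s -> Z t0 w -> enorm (s - F t0 p) < del ->
     enorm (w - G t0 q) < del -> 0 < sg * (enorm (s - w) - enorm (F t0 p - G t0 q)) ->
     phi t0 < sqdist s w /\ sqdist s w < cc t0) ->
  sg * D t0 p q <= 8 * kap t0 ^+ 2 * h t0 p q.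
Proof.
move=> [at0 t0b cr first] sg1 [del del0 H2]; have [Mp Nq nq ph hc] := cr.
have [It0 k0 kY kZ _] := slices (ltW at0) t0b.
have [ph0 _ _ _ _] := window (ltW at0) t0b.
have [_ hY] := mcf_slice fY It0; have [_ hZ] := mcf_slice fZ It0.
have Yp : Y t0 (F t0 p) by rewrite (mcf_image fY It0); exists p.
have Zq : Z t0 (G t0 q) by rewrite (mcf_image fZ It0); exists q.
have ne : F t0 p != G t0 q.
  apply: contraTneq ph => e; rewrite -ltNge hE e subrr enorm0 expr0n/=.
  exact: ph0.
have kd : kap t0 * enorm (F t0 p - G t0 q) <= 1 / 20.
  by apply: (le_trans (small (ltW at0) t0b hc)); lra.
have hl : exists2 del : R, 0 < del & forall y z, Y t0 y -> Z t0 z -> enorm (y - F t0 p) < del ->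
    enorm (z - G t0 q) < del -> normal_to (Z t0) z (y - z) ->
    sg * (enorm (y - z) - enorm (F t0 p - G t0 q)) <= 0.
  exists del => // y z Yy Zz yd zd nz; rewrite leNgt; apply/negP => pos.
  have [a b] := H2 y z Yy Zz yd zd pos.
  move: Yy Zz; rewrite (mcf_image fY It0) (mcf_image fZ It0) => -[p' Mp' ep] [q' Nq' eq].
  have hh : h t0 p' q' = sqdist y z by rewrite /h ep eq.
  have cr' : critical t0 p' q' by split => //; rewrite ?ep ?eq// hh ltW.
  have [||t [x [at_ tt0 crt]]] := critical_interior_persists at0 t0b cr'; rewrite ?hh//.
  exact: (first t p' x).
have [mu [nu [uY uZ]]] := max_principle hY hZ kY kZ k0 Yp Zq nq ne kd sg1 hl.
rewrite -(mcf_velocity fY It0 Mp uY) -(mcf_velocity fZ It0 Nq uZ) => T.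
rewrite /D mulrCA (_ : 8 * _ * _ = 2 * (4 * kap t0 ^+ 2 * h t0 p q)); last by ring.
by rewrite ler_wpM2l.
Qed.

(** The critical triples form a compact set, so a first time is attained. Normality survives limits
    because strict minimality on a common sheet passes to the limit as minimality, which implies
    normality again. *)
Lemma exists_first_critical : (forall p q, ~ critical ta p q) ->
  forall t p q, ta <= t -> t <= tb -> critical t p q -> exists t0 p0 q0, first_critical t0 p0 q0.
Proof.
move=> init t p q at_ tb_ cr.
pose S := [set z : R * V * V | [/\ ta <= z.1.1, z.1.1 <= tb & critical z.1.1 z.1.2 z.2]].
pose K := (`[ta, tb]%classic `*` M) `*` N.
have cK : compact K.
  apply: compact_setX; last exact: (mcf_compact fZ).
  by apply: compact_setX; [exact: segment_compact|exact: (mcf_compact fY)].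
have SK : S `<=` K.
  by move=> [[s x] y] [/= a b [Mx Ny _ _ _]]; split => //=; split => //=; rewrite in_itv/= a.
have cS : closed S.
  move=> [[s x] y] cl.
  have : K (s, x, y).
    have cKl : closed K by apply: compact_closed => //; exact: norm_hausdorff.
    by apply: cKl; exact: (closureS SK).
  move=> [/= [/=]]; rewrite in_itv/= => /andP[a b] Mx Ny.
  have [Is _ _ _ _] := slices a b; have [_ _ _ cphi ccc] := window a b.
  have ph : phi s <= h s x y.
    rewrite leNgt; apply/negP => hp.
    have [[[s' x'] y'] [[/= _ _ [_ _ _ h1 _]] h2]] := cl _ ((near_h a b Mx Ny cphi).2 hp).
    by move: h2; rewrite /= ltNge h1.
  have hc : h s x y <= cc s.
    rewrite leNgt; apply/negP => hp.
    have [[[s' x'] y'] [[/= _ _ [_ _ _ _ h1]] h2]] := cl _ ((near_h a b Mx Ny ccc).1 hp).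
    by move: h2; rewrite /= ltNge h1.
  split => //; split => //=.
  have [C [e [e0 CN NC HC]]] := sheet a b Mx Ny hc.
  apply: slice_min_normal => //.
  apply: filterS (near_enorm y e0) => w wy Nw; rewrite leNgt; apply/negP => lt.
  have cw : {for (s, x, y), continuous (fun z : R * V * V => h z.1.1 z.1.2 w)}.
    apply: (@continuous_comp _ _ _ (fun z : R * V * V => (z.1, w)) (fun z : R * V * V => h z.1.1 z.1.2 z.2)).
      by apply: continuous_pair; [exact: cvg_fst|exact: cst_continuous].
    exact: h3_continuous.
  have [[[s' x'] y'] [[/= a' b' cr'] [/= h1 [h2 h3 h4]]]] :=
    cl _ (filterI (near_ltC cw (h3_continuous Is Mx Ny) lt) (nbhs_prod3 s x y e0)).
  have Cy' : C y' by apply: NC => //; case: cr'.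
  have wy' : w != y' by apply: contraTneq h1 => ->; rewrite ltxx.
  have := HC s' x' y' a' b' h2 h3 Cy' cr' w (NC _ Nw wy) wy'.
  by rewrite ltNge ltW.
have compS : compact S by apply: subclosed_compact cS cK SK.
have cw : {within S, continuous (fun z : R * V * V => z.1.1)}.
  apply: continuous_subspaceT => z.
  by apply: (@continuous_comp _ _ _ (fun z : R * V * V => z.1) fst); [exact: cvg_fst|exact: cvg_fst].
have St : S (t, p, q) by [].
have [[[s x] y]] := compact_EVT_min (ex_intro _ _ St) compS cw.
rewrite inE => -[/= a b crs] smin; exists s, x, y; split => //.
  by rewrite lt_neqAle a andbT; apply/eqP => e; apply: (init x y); rewrite e.
move=> s' x' y' a' s's cr'; have : s <= s'.
  by apply: (smin (s', x', y')); rewrite inE; split => //=; apply: ltW; exact: lt_le_trans b.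
by rewrite leNgt s's.
Qed.

Hypothesis phi_derive : forall t, ta < t -> t <= tb ->
  exists2 d, is_derive t (1 : R) phi d & 8 * kap t ^+ 2 * phi t < d.
(** Two ways to guard the upper barrier: no normal pair reaches it, or it falls too fast for a pair
    to have come from above. *)
Hypothesis cc_derive : forall t, ta < t -> t <= tb ->
  (forall p q, M p -> N q -> normal_to (Z t) (G t q) (F t p - G t q) -> h t p q != cc t) \/
  exists2 d, is_derive t (1 : R) cc d & d < - (8 * kap t ^+ 2 * cc t).

(** The earlier minimiser may differ from [q], so [lower] has to hold for all [x] near [q];
    minimising only lowers the distance, so [upper] is needed for [q] alone. *)
Lemma no_critical : (forall p q, ~ critical ta p q) ->
  forall t p q, ta <= t -> t <= tb -> ~ critical t p q.
Proof.
move=> init t' p' q' a' b' cr'.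
have [t0 [p [q fc]]] := exists_first_critical init a' b' cr'.
have [at0 t0b cr first] := fc; have [Mp Nq nq ph hc] := cr.
have [It0 k0 _ _ _] := slices (ltW at0) t0b.
have [ph0 pc _ cph ccc] := window (ltW at0) t0b.
have pp : enorm (p - p) = 0 by rewrite subrr enorm0.
have qq : enorm (q - q) = 0 by rewrite subrr enorm0.
have cs : {for (F t0 p, G t0 q), continuous (fun z : V * V => sqdist z.1 z.2)}.
  by apply: dot_continuous; apply: continuousB; (exact: cvg_snd || exact: cvg_fst).
have near2 (A : set (V * V)) : nbhs (F t0 p, G t0 q) A -> exists2 del : R, 0 < del &
    forall s w, enorm (s - F t0 p) < del -> enorm (w - G t0 q) < del -> A (s, w).
  move=> [[B C]/= [/nbhs_enormP[e1 e10 eB] /nbhs_enormP[e2 e20 eC]] BC].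
  exists (Num.min e1 e2); first by rewrite lt_min e10.
  by move=> s w; rewrite !lt_min => /andP[s1 _] /andP[_ w2]; apply: (BC (s, w)); split; [exact: eB|exact: eC].
have sqE (s w : V) : sqdist s w = enorm (s - w) ^+ 2 by rewrite sqdistE -enormN opprB.
have lower : exists2 e : R, 0 < e & forall t x, ta <= t -> t0 - e < t -> t < t0 -> N x ->
    enorm (x - q) < e -> h t0 p q <= h t0 p x -> phi t <= h t p x.
  move: (ph); rewrite le_eqVlt => /orP[/eqP ph'|ph'].
    have [d dphi dk] := phi_derive at0 t0b.
    have Dd : D t0 p q < d.
      apply: le_lt_trans dk; rewrite ph' -[D _ _ _]mul1r.
      apply: critical_derivative => //; rewrite ?normr1//.
      have hc' : sqdist (F t0 p, G t0 q).1 (F t0 p, G t0 q).2 < cc t0 by rewrite /= -/(h t0 p q) -ph'.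
      have [del del0 delP] := near2 _ (near_lt cs hc').
      exists del => // s w _ _ sd wd; rewrite mul1r subr_gt0 => lt; split; last exact: delP.
      by rewrite ph' hE sqE ltrXn2r ?nnegrE ?enorm_ge0.
    (* A slope strictly between the two derivatives: by continuity [D] stays below [m] for nearby
       times and points, while [phi t - m * t] lies below its value at [t0] just before [t0]. *)
    pose m := (D t0 p q + d) / 2.
    have [Dm md] : D t0 p q < m /\ m < d by rewrite /m; split; lra.
    have dl : is_derive t0 (1 : R) (fun t => phi t - m * t) (d - m).
      have hm : is_derive t0 (1 : R) (fun t : R => m * t) m.
        by apply: (is_derive_eq (is_deriveZ m (is_derive_id t0 (1 : R)))); rewrite [_ *: _]mulr1.
      exact: (is_deriveB dphi hm).
    have dm0 : 0 < d - m by rewrite subr_gt0.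
    have [e1 e10 e1P] := is_derive_gt0 dl dm0.
    have [e2 e20 e2P] := near_prod (near_lt (D_continuous It0 Mp Nq) Dm).
    exists (Num.min e1 e2); first by rewrite lt_min e10.
    move=> t x at_ te tt0 Nx; rewrite lt_min => /andP[_ xe] hx.
    have te1 : t0 - e1 < t by apply: le_lt_trans te; rewrite lerD2l lerN2 ge_min lexx.
    have te2 : t0 - e2 < t by apply: le_lt_trans te; rewrite lerD2l lerN2 ge_min lexx orbT.
    have dh c : t <= c -> c <= t0 -> is_derive c (1 : R) (fun s => h s p x) (D c p x).
      move=> tc ct0; apply: h_derive => //.
      by have [] := slices (le_trans at_ tc) (le_trans ct0 t0b).
    have hcw : {within `[t, t0], continuous (fun s => h s p x)}.
      by apply: derivable_within_continuous => c; rewrite in_itv/= => /andP[c1' c2']; case: (dh c c1' c2').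
    have dh' c : c \in `]t, t0[ -> is_derive c (1 : R) (fun s => h s p x) (D c p x).
      by rewrite in_itv/= => /andP[/ltW u /ltW w]; exact: dh.
    have [c] := MVT tt0 dh' hcw; rewrite in_itv/= => /andP[tc ct0] hcE.
    have Dc : D c p x < m.
      by apply: (e2P c x) => //; apply: tball => //; exact: lt_trans tc.
    have t00 : 0 < t0 - t by rewrite subr_gt0.
    have te3 : t0 - t < e1 by rewrite ltrBlDr -ltrBlDl.
    have [b2 _] := e1P (t0 - t) t00 te3; rewrite subKr in b2.
    have b1 : D c p x * (t0 - t) <= m * (t0 - t) by rewrite ler_pM2r// ltW.
    have b3 : h t0 p x - h t p x <= m * t0 - m * t by rewrite hcE -mulrBr.
    have := hx; rewrite -ph'; lra.
  have [e e0 eP] := near_prod3 ((near_h (ltW at0) t0b Mp Nq cph).1 ph').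
  exists e => // t x _ te tt0 _ xe _; apply: ltW; apply: (eP t p x); rewrite ?pp//.
  exact: tball.
have upper : exists2 e : R, 0 < e & forall t, ta <= t -> t0 - e < t -> t < t0 -> h t p q <= cc t.
  move: (hc); rewrite le_eqVlt => /orP[/eqP hc'|hc'].
    have [ne|[d dcc dk]] := cc_derive at0 t0b.
      by have := ne p q Mp Nq nq; rewrite hc' eqxx.
    have Dd : d < D t0 p q.
      apply: (lt_le_trans dk); rewrite -hc' lerNl -mulN1r.
      apply: critical_derivative => //; rewrite ?normrN1//.
      have hp' : phi t0 < sqdist (F t0 p, G t0 q).1 (F t0 p, G t0 q).2 by rewrite /= -/(h t0 p q) hc'.
      have [del del0 delP] := near2 _ (near_gt cs hp').
      exists del => // s w _ _ sd wd; rewrite mulN1r opprB subr_gt0 => lt; split; first exact: delP.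
      by rewrite -hc' hE sqE ltrXn2r ?nnegrE ?enorm_ge0.
    have dl := is_deriveB (h_derive It0 Mp Nq) dcc.
    have dm0 : 0 < D t0 p q - d by rewrite subr_gt0.
    have [e1 e10 e1P] := is_derive_gt0 dl dm0.
    exists e1 => // t at_ te tt0.
    have te1 : t0 - t < e1 by rewrite ltrBlDr -ltrBlDl.
    have t00 : 0 < t0 - t by rewrite subr_gt0.
    have [+ _] := e1P (t0 - t) t00 te1.
    by rewrite subKr !fctE hc' subrr subr_lt0 => /ltW.
  have [e e0 eP] := near_prod3 ((near_h (ltW at0) t0b Mp Nq ccc).2 hc').
  by exists e => // t _ te tt0; apply: ltW; apply: (eP t p q); rewrite ?pp ?qq//; exact: tball.
have [e1 e10 low] := lower; have [e2 e20 up] := upper.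
have [|||t [x [at_ tt0 crt]]] := @critical_persists t0 p q (Num.min e1 e2) at0 t0b cr.
- by rewrite lt_min e10.
- move=> t x at_ te tt0 Nx; rewrite lt_min => /andP[xe _]; apply: low => //.
  by apply: le_lt_trans te; rewrite lerD2l lerN2 ge_min lexx.
- move=> t at_ te tt0; apply: up => //.
  by apply: le_lt_trans te; rewrite lerD2l lerN2 ge_min lexx orbT.
exact: (first t p x).
Qed.


(* At the first time when dist(y_t, Z_t)^2 = phi, the nearest point would be critical. *)
Lemma stays_close p : (forall t p q, ta <= t -> t <= tb -> ~ critical t p q) -> M p ->
  (exists2 q, N q & h ta p q < phi ta) ->
  forall t, ta <= t -> t <= tb -> exists2 q, N q & h t p q < phi t.
Proof.
move=> nc Mp init t at_ tb_; apply: contrapT => far.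
have neg s : ~ (exists2 q, N q & h s p q < phi s) <-> forall q, N q -> phi s <= h s p q.
  split=> [H q Nq|H [q Nq]]; last by rewrite ltNge H.
  by rewrite leNgt; apply/negP => lt; apply: H; exists q.
pose B := [set s | [/\ ta <= s, s <= tb & forall q, N q -> phi s <= h s p q]].
have cB : closed B.
  move=> s cl.
  have : `[ta, tb]%classic s.
    have cI : closed `[ta, tb]%classic by apply: compact_closed; [exact: norm_hausdorff|exact: segment_compact].
    by apply: cI; apply: closureS cl => x [a b _]; rewrite /= in_itv/= a.
  rewrite /= in_itv/= => /andP[a b]; split => // q Nq.
  have [_ _ _ cphi _] := window a b; have [Is _ _ _ _] := slices a b.
  rewrite leNgt; apply/negP => lt.
  have [e e0 eP] := near_prod3 ((near_h a b Mp Nq cphi).2 lt).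
  have ns : nbhs s [set x | `|x - s| < e].
    by apply/nbhs_ballP; exists e => // x; rewrite -ball_normE /ball_/= distrC.
  have [x [[_ _ h1] xe]] := cl _ ns.
  have := eP x p q xe; rewrite !subrr !enorm0 => /(_ e0 e0) /=.
  by rewrite ltNge h1.
have compB : compact B.
  apply: (subclosed_compact cB (@segment_compact R ta tb)).
  by move=> x [a b _]; rewrite /= in_itv/= a.
have Bt : B t by split => //; apply/neg.
have cw : {within B, continuous (@id R)} by apply: continuous_subspaceT => x; exact: cvg_id.
have [t0] := compact_EVT_min (ex_intro _ t Bt) compB cw.
rewrite inE => -[a b far0] tmin.
have at0 : ta < t0.
  rewrite lt_neqAle a andbT; apply/eqP => e; apply: ((neg ta).2 _ init).
  by rewrite e.
have [It0 _ _ _ _] := slices a b; have [ph0 pc _ cphi _] := window a b.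
have close s : ta <= s -> s < t0 -> exists2 q, N q & h s p q < phi s.
  move=> as_ st; apply: contrapT => /neg fs.
  have : t0 <= s.
    by apply: tmin; rewrite inE; split => //; apply: ltW; exact: lt_le_trans b.
  by rewrite leNgt st.
have [q Nq qle] : exists2 q, N q & h t0 p q <= phi t0.
  apply: contrapT => nq.
  have gt q : N q -> phi t0 < h t0 p q.
    by move=> Nq; rewrite ltNge; apply/negP => le; apply: nq; exists q.
  have tube : \forall s \near t0, forall q, N q -> phi s < h s p q.
    apply: (compact_tube (mcf_compact fZ)) => q Nq.
    have c : {for (t0, q), continuous (fun z : R * V => (z.1, p, z.2))}.
      apply: continuous_pair; last exact: cvg_snd.
      by apply: continuous_pair; [exact: cvg_fst|exact: cst_continuous].
    exact: (c _ ((near_h a b Mp Nq cphi).1 (gt q Nq))).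
  have /nbhs_ballP[e /= e0 eP] := tube.
  pose s := Num.max ta (t0 - e / 2).
  have s1 : ta <= s by rewrite le_max lexx.
  have e20 : 0 < e / 2 by rewrite divr_gt0.
  have s2 : s < t0 by rewrite gt_max at0 ltrBlDr ltrDl.
  have s3 : t0 - e / 2 <= s by rewrite le_max lexx orbT.
  have bs : ball t0 e s by rewrite -ball_normE /ball_/= gtr0_norm ?subr_gt0//; lra.
  have [q Nq] := close s s1 s2.
  by rewrite ltNge ltW// (eP s bs q Nq).
apply: (nc t0 p q a b); split => //; [|exact: far0|by apply: (le_trans qle); exact: ltW].
by apply: slice_min_normal => //; near=> x => Nx; apply: (le_trans qle); exact: far0.
Unshelve. all: by end_near.
Qed.

End Gap.
End TwoFlows.

(** * Approximate evolutions *)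

Section HausdorffDistance.
Variables (R : realType) (n : nat).
Implicit Types (A B : set 'rV[R]_n.+1) (d e : R).

(** The infimum in [dH] may not be attained, hence the strictly larger [e]. *)
Lemma dH_thickening A B d e : (dH A B <= d%:E)%E -> d < e ->
  A `<=` thickening B e /\ B `<=` thickening A e.
Proof.
move=> hd de; have lt : (dH A B < e%:E)%E by apply: (le_lt_trans hd); rewrite lte_fin.
have [_ [d' [d'0 [AB BA]] <-]] := ereal_inf_lt lt; rewrite lte_fin => d'e.
by split=> x => [/AB|/BA] [a Aa xa]; exists a => //; apply: (le_trans xa); exact: ltW.
Qed.

Lemma thickening_dH A B d : 0 <= d -> A `<=` thickening B d -> B `<=` thickening A d ->
  (dH A B <= d%:E)%E.
Proof. by move=> d0 AB BA; apply: ereal_inf_lbound; exists d. Qed.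

End HausdorffDistance.

Section SelfSimilar.
Variables (R : realType) (a c t : R).
Hypotheses (t0 : 0 < t) (k1 : c ^+ 2 < 80^-1) (a0 : 0 < a).
Let s := Num.sqrt t.
Let s0 : 0 < s. Proof. by rewrite sqrtr_gt0. Qed.
Let sn : s != 0. Proof. by rewrite gt_eqF. Qed.

Lemma inv_sqrt_continuous (b : R) : {for t, continuous (fun t => b / Num.sqrt t)}.
Proof.
apply: continuousM; first exact: cst_continuous.
by apply: continuousV => //; exact: sqrt_continuous.
Qed.

(** The comparison is [8 c^2 < 1/2] times [a / sqrt t]; the hypothesis on [c] even gives
    [8 c^2 < 1/10]. *)
Lemma sqrt_derive : exists2 d, is_derive t (1 : R) (fun t => a * Num.sqrt t) d &
  8 * (c / Num.sqrt t) ^+ 2 * (a * Num.sqrt t) < d.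
Proof.
have := is_deriveZ a (is_derive1_sqrt t0); set d := (_ *: _) => hd.
exists d => //; rewrite /d -/s.
have -> : 8 * (c / s) ^+ 2 * (a * s) = (8 * c ^+ 2) * (a / s) by field.
have -> : a *: (2 * s)^-1 = 2^-1 * (a / s) by rewrite [_ *: _]mulrC invfM; ring.
by rewrite ltr_pM2r ?divr_gt0//; move: k1; rewrite -div1r; lra.
Qed.

Lemma inv_sqrt_derive : exists2 d, is_derive t (1 : R) (fun t => a / Num.sqrt t) d &
  d < - (8 * (c / Num.sqrt t) ^+ 2 * (a / Num.sqrt t)).
Proof.
have := is_deriveZ a (is_deriveV sn (is_derive1_sqrt t0)); set d := (_ *: _) => hd.
exists d => //; rewrite /d -/s.
have -> : 8 * (c / s) ^+ 2 * (a / s) = (8 * c ^+ 2) * (a / s ^+ 3) by field.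
have -> : a *: (- s ^- 2 *: (2 * s)^-1) = - (2^-1 * (a / s ^+ 3)).
  by rewrite /GRing.scale/=; field.
by rewrite ltrN2 ltr_pM2r ?divr_gt0 ?exprn_gt0//; move: k1; rewrite -div1r; lra.
Qed.

End SelfSimilar.

Section Estimates.
Variables (R : realType) (n : nat) (k : constants R) (rad : R).
Local Notation V := 'rV[R]_n.+1.
Variables (X Yt Zt : set V) (t : R).
Hypotheses (c1_gt0 : 0 < c1 k) (c2_gt0 : 0 < c2 k) (k12 : c1 k * c2 k < 10 ^- 6) (t0 : 0 < t).
Hypotheses (eY : estimates k rad X t Yt) (eZ : estimates k rad X t Zt).

(** The factor [101 / 100] gives the strict margin for [dH_thickening]; two such steps remain below
    [3 c2 sqrt t]. *)
Lemma estimates_near y : Yt y -> exists x z, [/\ X x, Zt z,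
  enorm (y - x) <= 101 / 100 * (c2 k * Num.sqrt t) &
  enorm (x - z) <= 101 / 100 * (c2 k * Num.sqrt t)].
Proof.
move=> Yy; have s0 : 0 < c2 k * Num.sqrt t by rewrite mulr_gt0 ?sqrtr_gt0.
have lt : c2 k * Num.sqrt t < 101 / 100 * (c2 k * Num.sqrt t) by lra.
have [_ dY _] := eY; have [_ dZ _] := eZ.
have [x Xx yx] := (dH_thickening dY lt).1 _ Yy.
by have [z Zz xz] := (dH_thickening dZ lt).2 _ Xx; exists x, z.
Qed.

Lemma estimates_close y : Yt y -> exists2 z, Zt z & enorm (y - z) <= 3 * (c2 k * Num.sqrt t).
Proof.
move=> /estimates_near[x [z [_ Zz yx xz]]]; exists z => //.
have s0 : 0 < c2 k * Num.sqrt t by rewrite mulr_gt0 ?sqrtr_gt0.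
by have := enormDB y x z; lra.
Qed.

(* The two-sheeted picture is excluded by connectivity: z and a point of Zt at
   distance O(sqrt t) from y lie in the same component. *)
Lemma normal_pair_close y z : compact_hypersurface Zt -> Num.sqrt t / c1 k < rad / 4 ->
  Yt y -> Zt z -> normal_to Zt z (y - z) -> c1 k / Num.sqrt t * enorm (y - z) <= 5 / 100 ->
  sqdist y z <= 9 * c2 k ^+ 2 * t.
Proof.
move=> cZ sm Yy Zz nz kz; have [kZ _ conn] := eZ.
have [x [z2 [Xx Zz2 yx xz2]]] := estimates_near Yy.
have st0 : 0 < Num.sqrt t by rewrite sqrtr_gt0.
set w := Num.sqrt t / c1 k in sm conn *.
have w0 : 0 < w by rewrite divr_gt0.
set m := c2 k * Num.sqrt t in yx xz2 *.
have m0 : 0 < m by rewrite mulr_gt0.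
have mw : m <= 10 ^- 6 * w.
  have -> : m = c1 k * c2 k * w by rewrite /m /w; field; rewrite gt_eqF.
  by rewrite ler_pM2r// ltW.
have m6 : 10 ^- 6 * w <= w / 1000 by rewrite mulrC ler_pM2l//; lra.
have yz2 : enorm (y - z2) <= 202 / 100 * m by have := enormDB y x z2; lra.
have kap0 : 0 < c1 k / Num.sqrt t by rewrite divr_gt0.
have kw : c1 k / Num.sqrt t * w = 1 by rewrite /w; field; rewrite !gt_eqF.
have yzw : enorm (y - z) <= 5 / 100 * w.
  by rewrite -(ler_pM2l kap0) mulrCA kw mulr1.
(* (E3) asks for a radius strictly between [w] and [rad / 4], which the midpoint provides; the bound
   [101 / 100 * w] keeps the ball about [x] within [1.1 w] of [y]. *)
pose s := Num.min (101 / 100 * w) ((w + rad / 4) / 2).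
have [ws sr s1] : [/\ w < s, s < rad / 4 & s <= 101 / 100 * w].
  split; rewrite ?lt_min ?gt_min ?ge_min ?lexx//.
    by apply/andP; split; lra.
  by apply/orP; right; lra.
have [G [B [GB cG BB]]] := conn x s Xx ws sr.
have inG g : Zt g -> enorm (g - x) < 9 / 10 * s -> G g.
  move=> Zg gx; have : (G `|` B) g.
    by rewrite -GB; split => //; rewrite /eball/=; lra.
  by case=> // Bg; have : (B `&` eball x (9 / 10 * s)) g by []; rewrite BB.
have Gz : G z by apply: inG => //; have := enormDB z y x; rewrite (enormB z y); lra.
have Gz2 : G z2 by apply: inG => //; rewrite enormB; lra.
have close : enorm (y - z) <= 3 * m.
  have [e|z2z] := eqVneq z2 z; first by rewrite -e; lra.
  have inball g : G g -> Zt g /\ c1 k / Num.sqrt t * enorm (g - y) < 11 / 10.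
    move=> Gg; have : (G `|` B) g by left.
    rewrite -GB => -[gx Zg]; split => //; rewrite /eball/= in gx.
    have gy : enorm (g - y) < 11 / 10 * w by have := enormDB g x y; rewrite (enormB x y); lra.
    by have := gy; rewrite -(ltr_pM2l kap0) mulrCA kw mulr1.
  have := sheet_strict_min kap0 cZ kZ Zz nz kz cG inball Gz Gz2 z2z.
  rewrite !sqdistE !(enormB _ y) ltr_pXn2r ?nnegrE ?enorm_ge0//; lra.
have -> : 9 * c2 k ^+ 2 * t = (3 * m) ^+ 2.
  by rewrite /m !exprMn sqr_sqrtr ?ltW//; ring.
by rewrite sqdistE enormB lerXn2r ?nnegrE ?enorm_ge0//; lra.
Qed.

End Estimates.

(** * Barriers within and beyond the range of (E3) *)

Section CloseFlows.
Variables (R : realType) (n : nat) (k : constants R) (rad t1 T0 : R).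
Local Notation V := 'rV[R]_n.+1.
Variables (X : set V) (Y Z : R -> set V) (M N : set V) (F G : R -> V -> V).
Hypotheses (c1_gt0 : 0 < c1 k) (c2_gt0 : 0 < c2 k) (k12 : c1 k * c2 k < 10 ^- 6)
  (k11 : c1 k ^+ 2 < 80^-1) (rad_gt0 : 0 < rad) (t1_gt0 : 0 < t1).
Hypotheses (fY : mcf_on `]0, T0] Y M F) (fZ : mcf_on `]0, T0] Z N G).
Hypothesis est : forall t, t1 <= t -> t <= T0 ->
  estimates k rad X t (Y t) /\ estimates k rad X t (Z t).

(** This makes [phi t1 = (4 c2 sqrt t1)^2], strictly above the [(3 c2 sqrt t1)^2] that the estimates
    give for the initial distances. *)
Let a := 16 * c2 k ^+ 2 * Num.sqrt t1.
Let phi t := a * Num.sqrt t.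
Let kap t := c1 k / Num.sqrt t.
(** Half of the limit [c1 rad / 4] for [sqrt t], so that (E3) is available up to and including
    [T2]. *)
Let T2 := (c1 k * rad / 8) ^+ 2.

Let a_gt0 : 0 < a.
Proof. by rewrite !mulr_gt0 ?sqrtr_gt0// exprn_gt0. Qed.

Let c12 : c2 k ^+ 2 * c1 k ^+ 2 <= 1 / 100 * (1 / 100).
Proof.
have p : 0 < c1 k * c2 k by rewrite mulr_gt0.
have h : c1 k * c2 k <= 1 / 100 by apply: (le_trans (ltW k12)); lra.
have -> : c2 k ^+ 2 * c1 k ^+ 2 = (c1 k * c2 k) * (c1 k * c2 k) by ring.
by rewrite ler_pM// ltW.
Qed.

Let slices ta tb : t1 <= ta -> tb <= T0 -> forall t, ta <= t -> t <= tb ->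
  [/\ `]0, T0]%classic t, 0 < kap t, sff_le (Y t) (kap t), sff_le (Z t) (kap t) & {for t, continuous kap}].
Proof.
move=> a1 b0 t at_ tb_; have t1t := le_trans a1 at_; have tT := le_trans tb_ b0.
have t0 := lt_le_trans t1_gt0 t1t.
have [[kY _ _] [kZ _ _]] := est t1t tT.
split => //; first by rewrite /= in_itv/= t0.
  by rewrite divr_gt0 ?sqrtr_gt0.
exact: inv_sqrt_continuous.
Qed.

Let phi_cont t : {for t, continuous phi}.
Proof. by apply: continuousM; [exact: cst_continuous|exact: sqrt_continuous]. Qed.

Let phi_d ta tb : t1 <= ta -> forall t, ta < t -> t <= tb ->
  exists2 d, is_derive t (1 : R) phi d & 8 * kap t ^+ 2 * phi t < d.
Proof.
by move=> a1 t at_ _; apply: sqrt_derive => //; apply: lt_trans at_; exact: lt_le_trans a1.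
Qed.

Let phi_le t : t1 <= t -> phi t <= 16 * c2 k ^+ 2 * t.
Proof.
move=> tt; have t0 := lt_le_trans t1_gt0 tt.
have e : Num.sqrt t * Num.sqrt t = t by rewrite -expr2 sqr_sqrtr// ltW.
rewrite /phi /a -mulrA -[X in _ <= _ * X]e ler_pM2l ?mulr_gt0 ?exprn_gt0//.
by rewrite ler_pM2r ?sqrtr_gt0//; exact: ler_wsqrtr.
Qed.

Let phi1 : phi t1 = 16 * c2 k ^+ 2 * t1.
Proof. by rewrite /phi /a -mulrA -expr2 sqr_sqrtr// ltW. Qed.

Let sqrtT2 : Num.sqrt T2 = c1 k * rad / 8.
Proof. by rewrite sqrtr_sqr ger0_norm// divr_ge0// mulr_ge0// ltW. Qed.

(** The square of [1 / (20 kap)], the largest distance at which normal pairs are controlled. *)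
Let cc1 t := t / (20 * c1 k) ^+ 2.

Let cc1_gt t : 0 < t -> 16 * c2 k ^+ 2 * t < cc1 t.
Proof.
move=> t0; rewrite /cc1 ltr_pdivlMr; last by rewrite exprn_gt0// mulr_gt0.
have -> : 16 * c2 k ^+ 2 * t * (20 * c1 k) ^+ 2 = (80 ^+ 2 * (c2 k ^+ 2 * c1 k ^+ 2)) * t by ring.
have le1 : 80 ^+ 2 * (c2 k ^+ 2 * c1 k ^+ 2) < 1.
  have le2 : 80 ^+ 2 * (c2 k ^+ 2 * c1 k ^+ 2) <= 80 ^+ 2 * (1 / 100 * (1 / 100)).
    by rewrite ler_wpM2l ?sqr_ge0.
  by apply: (le_lt_trans le2); rewrite expr2; lra.
by rewrite -[ltRHS]mul1r (ltr_pM2r t0).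
Qed.

Let sq_kap t : 0 < t -> kap t ^+ 2 = c1 k ^+ 2 / t.
Proof. by move=> t0; rewrite /kap expr_div_n sqr_sqrtr// ltW. Qed.

Let window1 tb : forall t, t1 <= t -> t <= tb ->
  [/\ 0 < phi t, phi t < cc1 t, kap t ^+ 2 * cc1 t <= 1 / 400,
      {for t, continuous phi} & {for t, continuous cc1}].
Proof.
move=> t tt _; have t0 := lt_le_trans t1_gt0 tt; split => //.
- by rewrite mulr_gt0 ?sqrtr_gt0.
- by apply: (le_lt_trans (phi_le tt)); exact: cc1_gt.
- rewrite sq_kap// /cc1 le_eqVlt; apply/orP; left; apply/eqP; field.
  by rewrite !gt_eqF.
- by apply: continuousM; [exact: cvg_id|exact: cst_continuous].
Qed.

Let phase1_pairs t p q : t1 <= t -> t <= T0 -> t <= T2 -> M p -> N q ->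
  normal_to (Z t) (G t q) (F t p - G t q) -> sqdist (F t p) (G t q) <= cc1 t ->
  sqdist (F t p) (G t q) <= 9 * c2 k ^+ 2 * t.
Proof.
move=> tt tT t2 Mp Nq nn hc; have t0 := lt_le_trans t1_gt0 tt.
have [It k0 _ _ _] := slices (lexx t1) (lexx T0) tt tT.
have [eY eZ] := est tt tT.
have Yp : Y t (F t p) by rewrite (mcf_image fY It); exists p.
have Zq : Z t (G t q) by rewrite (mcf_image fZ It); exists q.
apply: (normal_pair_close c1_gt0 c2_gt0 k12 t0 eY eZ) => //.
- exact: (mcf_slice fZ It).
- have : Num.sqrt t <= Num.sqrt T2 by exact: ler_wsqrtr.
  have cr : 0 < c1 k * rad by rewrite mulr_gt0.
  by rewrite sqrtT2 ltr_pdivrMr//; lra.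
- have p5 : (0 : R) <= 5 / 100 by lra.
  rewrite -(@ler_pXn2r _ 2)// ?nnegrE ?mulr_ge0 ?enorm_ge0//; last exact: ltW.
  rewrite exprMn -/(kap t) enormB -sqdistE; apply: (le_trans (ler_wpM2l (sqr_ge0 _) hc)).
  by have [_ _ h _ _] := window1 tt (lexx t); apply: (le_trans h); lra.
Qed.

(** Normal pairs below [cc1] are in fact below [9 c2^2 t], so none touches the upper barrier. The
    lower barrier still needs the maximum principle, since it grows only like [sqrt t] and may drop
    below [9 c2^2 t]. *)
Let phase1 tb t p q : tb <= T0 -> tb <= T2 -> t1 <= t -> t <= tb ->
  ~ critical Z M N F G phi cc1 t p q.
Proof.
move=> bT b2 tt tb_.
apply: (no_critical fY fZ (slices (lexx t1) bT) (@window1 tb) (phi_d (lexx t1)) _ _ tt tb_).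
  move=> s ts sb; left=> p' q' Mp Nq nn; apply/negP => /eqP hc.
  have := phase1_pairs (ltW ts) (le_trans sb bT) (le_trans sb b2) Mp Nq nn; rewrite hc => /(_ (lexx _)).
  have s0 := lt_trans t1_gt0 ts; have := cc1_gt s0.
  have : 0 < c2 k ^+ 2 * s by rewrite mulr_gt0// exprn_gt0.
  lra.
move=> p' q' [Mp Nq nn h1 h2].
have t1b := le_trans tt tb_.
have := phase1_pairs (lexx t1) (le_trans t1b bT) (le_trans t1b b2) Mp Nq nn h2.
rewrite phi1 in h1.
have : 0 < c2 k ^+ 2 * t1 by rewrite mulr_gt0// exprn_gt0.
move: h1; lra.
Qed.

Let close1 tb t p : tb <= T0 -> tb <= T2 -> t1 <= t -> t <= tb -> M p ->
  exists2 q, N q & sqdist (F t p) (G t q) < phi t.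
Proof.
move=> bT b2 tt tb_ Mp.
apply: (stays_close fY fZ (slices (lexx t1) bT) (@window1 tb) (fun t p q => phase1 bT b2) Mp _ tt tb_).
have t1T := le_trans (le_trans tt tb_) bT.
have [eY eZ] := est (lexx t1) t1T.
have [It _ _ _ _] := slices (lexx t1) (lexx T0) (lexx t1) t1T.
have Yp : Y t1 (F t1 p) by rewrite (mcf_image fY It); exists p.
have [z] := estimates_close c2_gt0 t1_gt0 eY eZ Yp.
rewrite (mcf_image fZ It) => -[q Nq <-] close; exists q => //.
rewrite phi1 sqdistE enormB.
set m := c2 k * Num.sqrt t1 in close.
have m0 : 0 < m by rewrite mulr_gt0 ?sqrtr_gt0.
have -> : 16 * c2 k ^+ 2 * t1 = (4 * m) ^+ 2 by rewrite /m !exprMn sqr_sqrtr ?ltW//; ring.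
by rewrite ltr_pXn2r ?nnegrE ?enorm_ge0//; lra.
Qed.

(** Normalised so that [cc2] and [cc1] agree at [T2], where the first phase hands over a free
    window. The hypothesis [aC] keeps the two barriers apart until [T0]. *)
Let C := T2 * Num.sqrt T2 / (20 * c1 k) ^+ 2.
Hypotheses (t1T2 : t1 <= T2) (aC : a * T0 < C).
Let cc2 t := C / Num.sqrt t.

Let T2_gt0 : 0 < T2. Proof. exact: lt_le_trans t1T2. Qed.

Let C_gt0 : 0 < C.
Proof. by rewrite divr_gt0 ?mulr_gt0 ?sqrtr_gt0. Qed.

Let window2 : forall t, T2 <= t -> t <= T0 ->
  [/\ 0 < phi t, phi t < cc2 t, kap t ^+ 2 * cc2 t <= 1 / 400,
      {for t, continuous phi} & {for t, continuous cc2}].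
Proof.
move=> t tt tT; have t0 := lt_le_trans T2_gt0 tt; have s0 : 0 < Num.sqrt t by rewrite sqrtr_gt0.
split => //; first by rewrite mulr_gt0.
- rewrite /cc2 ltr_pdivlMr// /phi -mulrA -expr2 sqr_sqrtr ?ltW//.
  by apply: le_lt_trans aC; rewrite ler_pM2l.
(* [kap^2 cc2] equals [1 / 400] at [T2] and decays like the power -3/2 of [t]. *)
- rewrite sq_kap// /cc2 /C.
  have -> : c1 k ^+ 2 / t * (T2 * Num.sqrt T2 / (20 * c1 k) ^+ 2 / Num.sqrt t) =
     (T2 * Num.sqrt T2) / (t * Num.sqrt t) / 400 by field; rewrite !gt_eqF.
  have le1 : T2 * Num.sqrt T2 / (t * Num.sqrt t) <= 1.
    by rewrite ler_pdivrMr ?mulr_gt0// mul1r ler_pM ?sqrtr_ge0 ?ler_wsqrtr// ltW.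
  by apply: (ler_wpM2r _ le1); rewrite invr_ge0 ler0n.
- exact: inv_sqrt_continuous.
Qed.

Let cc21 : cc2 T2 = cc1 T2.
Proof.
rewrite /cc2 /C /cc1; field.
by rewrite !gt_eqF// sqrtr_gt0.
Qed.

Let phase2 t p q : T2 <= t -> t <= T0 -> ~ critical Z M N F G phi cc2 t p q.
Proof.
move=> tt tT.
apply: (no_critical fY fZ (slices t1T2 (lexx T0)) window2 (phi_d t1T2) _ _ tt tT).
  move=> s ts sT; right; apply: inv_sqrt_derive => //.
  exact: lt_trans ts.
move=> p' q' [Mp Nq nn h1 h2].
have cr : critical Z M N F G phi cc1 T2 p' q' by split => //; rewrite -cc21.
exact: (phase1 (le_trans tt tT) (lexx T2) t1T2 (lexx T2) cr).
Qed.

Lemma close_flows t y : t1 <= t -> t <= T0 -> Y t y ->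
  exists2 z, Z t z & enorm (y - z) ^+ 2 <= 16 * c2 k ^+ 2 * Num.sqrt t1 * Num.sqrt t.
Proof.
move=> tt tT.
have [It _ _ _ _] := slices (lexx t1) (lexx T0) tt tT.
rewrite (mcf_image fY It) => -[p Mp <-].
suff [q Nq hq] : exists2 q, N q & sqdist (F t p) (G t q) < phi t.
  exists (G t q); first by rewrite (mcf_image fZ It); exists q.
  by rewrite enormB -sqdistE ltW.
have [t2|t2] := leP t T2; first exact: (close1 tT t2 tt (lexx t)).
apply: (stays_close fY fZ (slices t1T2 (lexx T0)) window2 (fun t p q => @phase2 t p q) Mp _ (ltW t2) tT).
have T2T := le_trans (ltW t2) tT.
exact: (close1 T2T (lexx T2) t1T2 (lexx T2)).
Qed.

End CloseFlows.

Section Evolutions.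
Variables (R : realType) (n : nat) (k : constants R).
Local Notation V := 'rV[R]_n.+1.
Hypotheses (c0_gt0 : 0 < c0 k) (c1_gt0 : 0 < c1 k) (c2_gt0 : 0 < c2 k) (c3_gt0 : 0 < c3 k)
  (k12 : c1 k * c2 k < 10 ^- 6) (k11 : c1 k ^+ 2 < 80^-1).

(* For sqrt (c3) r >= scale_ratio * rad the estimate follows from (E2) alone. *)
Definition scale_ratio : R :=
  Num.min (c1 k / 8) ((c1 k / 8) ^+ 3 / (20 * c1 k) ^+ 2 / (16 * c2 k ^+ 2 * c0 k)).

(** The sum of the constants for small and for large [r / rad], so that it dominates both. *)
Definition closeness_constant : R :=
  16 * c2 k ^+ 2 * Num.sqrt (c3 k) +
  (3 * c2 k) ^+ 2 * (Num.sqrt (c0 k) * Num.sqrt (c3 k) / scale_ratio).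

Lemma scale_ratio_gt0 : 0 < scale_ratio.
Proof.
by rewrite lt_min !divr_gt0 ?exprn_gt0 ?divr_gt0 ?mulr_gt0 ?exprn_gt0.
Qed.

Lemma closeness_constant_gt0 : 0 < closeness_constant.
Proof.
have p := scale_ratio_gt0.
have q : 0 < 3 * c2 k by rewrite mulr_gt0.
by rewrite addr_gt0 ?mulr_gt0 ?exprn_gt0 ?sqrtr_gt0 ?invr_gt0.
Qed.

Variables (rad r : R) (X : set V) (Y Z : R -> set V).
Hypotheses (rad_gt0 : 0 < rad) (r_gt0 : 0 < r).
Let T0 := c0 k * rad ^+ 2.
Let t1 := c3 k * r ^+ 2.
Hypotheses (fY : smooth_mcf `]0, T0] Y) (fZ : smooth_mcf `]0, T0] Z).
Hypothesis est : forall t, t1 <= t -> t <= T0 ->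
  estimates k rad X t (Y t) /\ estimates k rad X t (Z t).

Lemma evolution_close t y : t1 <= t -> t <= T0 -> Y t y ->
  exists2 z, Z t z & enorm (y - z) ^+ 2 <= closeness_constant * r * Num.sqrt t.
Proof.
move=> tt tT Yy; have m0 := scale_ratio_gt0.
have t10 : 0 < t1 by rewrite mulr_gt0// exprn_gt0.
have t0 := lt_le_trans t10 tt.
have s0 : 0 < Num.sqrt t by rewrite sqrtr_gt0.
have s1 : Num.sqrt t1 = Num.sqrt (c3 k) * r.
  by rewrite sqrtrM ?(ltW c3_gt0)// sqrtr_sqr gtr0_norm.
have sT : Num.sqrt T0 = Num.sqrt (c0 k) * rad.
  by rewrite sqrtrM ?(ltW c0_gt0)// sqrtr_sqr gtr0_norm.
set A := 16 * c2 k ^+ 2 * Num.sqrt (c3 k).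
set B := (3 * c2 k) ^+ 2 * (Num.sqrt (c0 k) * Num.sqrt (c3 k) / scale_ratio).
have A0 : 0 <= A by rewrite !mulr_ge0 ?sqrtr_ge0 ?exprn_ge0// ltW.
have B0 : 0 <= B.
  apply: mulr_ge0; first exact: sqr_ge0.
  by rewrite mulr_ge0 ?mulr_ge0 ?sqrtr_ge0// invr_ge0 ltW.
have rs : 0 <= r * Num.sqrt t by rewrite mulr_ge0 ?ltW.
have [small|large] := ltP (Num.sqrt t1) (scale_ratio * rad).
  have [M [F mY]] := smooth_mcf_on fY; have [N [G mZ]] := smooth_mcf_on fZ.
  have T2E : Num.sqrt ((c1 k * rad / 8) ^+ 2) = c1 k * rad / 8.
    by rewrite sqrtr_sqr ger0_norm// divr_ge0// mulr_ge0// ltW.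
  (* The first term of [scale_ratio] gives [h1], which places [t1] in the range of (E3); the second
     gives [h2], which separates the barriers of the late phase. *)
  have h1 : t1 <= (c1 k * rad / 8) ^+ 2.
    rewrite -(@sqr_sqrtr _ t1) ?(ltW t10)// lerXn2r ?nnegrE ?sqrtr_ge0 ?divr_ge0 ?mulr_ge0 ?ltW//.
    by apply: (lt_le_trans small); rewrite mulrAC ler_pM2r// ge_min lexx.
  have h2 : 16 * c2 k ^+ 2 * Num.sqrt t1 * T0 <
      (c1 k * rad / 8) ^+ 2 * Num.sqrt ((c1 k * rad / 8) ^+ 2) / (20 * c1 k) ^+ 2.
    rewrite T2E; set b := 16 * c2 k ^+ 2 * c0 k.
    have b0 : 0 < b by rewrite !mulr_gt0// exprn_gt0.
    have -> : 16 * c2 k ^+ 2 * Num.sqrt t1 * T0 = Num.sqrt t1 * (b * rad ^+ 2) by rewrite /b /T0; ring.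
    have -> : (c1 k * rad / 8) ^+ 2 * (c1 k * rad / 8) / (20 * c1 k) ^+ 2 =
        ((c1 k / 8) ^+ 3 / (20 * c1 k) ^+ 2 / b * rad) * (b * rad ^+ 2).
      by field; rewrite !gt_eqF.
    have br : 0 < b * rad ^+ 2 by rewrite mulr_gt0// exprn_gt0.
    rewrite ltr_pM2r//; apply: (lt_le_trans small).
    by rewrite ler_pM2r// ge_min lexx orbT.
  have [z Zz hz] := close_flows c1_gt0 c2_gt0 k12 k11 rad_gt0 t10 mY mZ est h1 h2 tt tT Yy.
  exists z => //; apply: (le_trans hz).
  have -> : 16 * c2 k ^+ 2 * Num.sqrt t1 * Num.sqrt t = A * (r * Num.sqrt t) by rewrite s1 /A; ring.
  by rewrite -mulrA ler_wpM2r// lerDl.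
have [eY eZ] := est tt tT.
have [z Zz hz] := estimates_close c2_gt0 t0 eY eZ Yy.
exists z => //.
apply: (@le_trans _ _ ((3 * (c2 k * Num.sqrt t)) ^+ 2)).
  by rewrite lerXn2r ?nnegrE ?enorm_ge0 ?(le_trans (enorm_ge0 _) hz).
(* As [rad] is at most a multiple of [r], one of the two factors [sqrt t] in [(3 c2 sqrt t)^2] can
   be traded for a multiple of [r]. *)
have rb : rad <= Num.sqrt (c3 k) * r / scale_ratio by rewrite ler_pdivlMr// mulrC -s1.
have tb : Num.sqrt t <= Num.sqrt (c0 k) * (Num.sqrt (c3 k) * r / scale_ratio).
  apply: (@le_trans _ _ (Num.sqrt T0)); first exact: ler_wsqrtr.
  by rewrite sT ler_wpM2l// sqrtr_ge0.
have -> : (3 * (c2 k * Num.sqrt t)) ^+ 2 =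
    (3 * c2 k) ^+ 2 * (Num.sqrt t * Num.sqrt t) by ring.
apply: (@le_trans _ _ (B * (r * Num.sqrt t))); last by rewrite -mulrA ler_wpM2r// lerDr.
have -> : B * (r * Num.sqrt t) = (3 * c2 k) ^+ 2 *
    (Num.sqrt (c0 k) * (Num.sqrt (c3 k) * r / scale_ratio) * Num.sqrt t) by rewrite /B; ring.
by rewrite ler_wpM2l ?sqr_ge0// ler_wpM2r// ltW.
Qed.

End Evolutions.

Theorem theorem1p20 (R : realType) (n : nat) (n_ge1 : (1 <= n)%N)
  (a1 a2 eps0 : R) (ha : approximation_constants n a1 a2 eps0)
  (K : R -> constants R)
  (hK : forall Lam : R, 0 < Lam -> flow_constants n a1 a2 Lam (K Lam)) :
  exists Lam C : R, [/\ 0 < Lam, 0 < C &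
    forall (rad : R) (X : set 'rV[R]_n.+1) (r s : R)
           (Y Z : R -> set 'rV[R]_n.+1),
      0 < rad ->
      reifenberg_flat (ceps (K Lam)) rad X ->
      0 < s -> s <= r ->
      approximate_evolution (K Lam) rad r X Y ->
      approximate_evolution (K Lam) rad s X Z ->
      forall t : R,
        c3 (K Lam) * r ^+ 2 <= t -> t <= c0 (K Lam) * rad ^+ 2 ->
        (dH (Y t) (Z t) <= (C * (r `^ 2^-1) * (t `^ 4^-1))%:E)%E].
Proof.
(* With [Lam = 1] the constants satisfy [c1 * c2 < 10 ^- 6] and [c1 ^+ 2 < 80^-1], the smallness
   used by the barriers. *)
have [[e0 k0 k1 k2 k3] k12 k11 _] := hK 1 ltr01.
move: k12; rewrite lt_min => /andP[k12 _].
have E0 := closeness_constant_gt0 k0 k1 k2 k3.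
exists 1, (Num.sqrt (closeness_constant (K 1))); split => //; first by rewrite sqrtr_gt0.
move=> rad X r s Y Z rad0 _ s0 sr [fY eY] [fZ eZ] t tt tT.
have r0 := lt_le_trans s0 sr.
have t0 : 0 < t by apply: lt_le_trans tt; rewrite mulr_gt0// exprn_gt0.
(* Since [s <= r], the estimates for [Z] start no later than those for [Y]; from [c3 r^2] on both
   flows satisfy them. *)
have eYZ u : c3 (K 1) * r ^+ 2 <= u -> u <= c0 (K 1) * rad ^+ 2 ->
    estimates (K 1) rad X u (Y u) /\ estimates (K 1) rad X u (Z u).
  move=> ru uT; split; first exact: eY.
  apply: eZ => //; apply: le_trans ru.
  by rewrite (ler_wpM2l (ltW k3))// lerXn2r ?nnegrE ?(ltW s0) ?(ltW r0).
(* On this time range the two flows play symmetric roles, which gives the second inclusion. *)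
have eZY u : c3 (K 1) * r ^+ 2 <= u -> u <= c0 (K 1) * rad ^+ 2 ->
    estimates (K 1) rad X u (Z u) /\ estimates (K 1) rad X u (Y u).
  by move=> h1 h2; have [] := eYZ u h1 h2.
have t4 : t `^ 4^-1 = Num.sqrt (Num.sqrt t).
  rewrite -!powR12_sqrt ?powR_ge0 ?ltW// -powRrM; congr (_ `^ _).
  by field.
set b := Num.sqrt _ * _ * _.
have b0 : 0 <= b by rewrite !mulr_ge0 ?sqrtr_ge0 ?powR_ge0.
have bE : b ^+ 2 = closeness_constant (K 1) * r * Num.sqrt t.
  by rewrite /b t4 powR12_sqrt ?(ltW r0)// !exprMn !sqr_sqrtr ?sqrtr_ge0 ?ltW.
have le_b (x : 'rV[R]_n.+1) : enorm x ^+ 2 <= closeness_constant (K 1) * r * Num.sqrt t -> enorm x <= b.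
  by rewrite -bE ler_pXn2r// ?nnegrE ?enorm_ge0.
apply: thickening_dH => // [y Yy|z Zz].
  have [z Zz /le_b hz] := evolution_close k0 k1 k2 k3 k12 k11 rad0 r0 fY fZ eYZ tt tT Yy.
  by exists z.
have [y Yy /le_b hy] := evolution_close k0 k1 k2 k3 k12 k11 rad0 r0 fZ fY eZY tt tT Zz.
by exists y.
Qed.
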